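(* Let $\mathfrak{g}$ be a semisimple Lie algebra over $\Bbbk$, let $\operatorname{rg}(\mathfrak{g})$ be its rank, let $k_{\mathfrak{g}}$ be the cardinality of the set $\mathcal{K}(\Pi)$ defined in the context, and let $\mathfrak{b}$ be a Borel subalgebra of $\mathfrak{g}$. (i) The space $\mathfrak{b}^{*}$ contains a stable element. (ii) The index of $\mathfrak{b}$ is equal to $\operatorname{rg}(\mathfrak{g})-k_{\mathfrak{g}}$.
   Context: $\Bbbk$ is an algebraically closed field of characteristic zero; Lie algebras are finite-dimensional, and finite-dimensional vector spaces carry the Zariski topology. Index and stability. For a Lie algebra $\mathfrak{a}$ and $f\in\mathfrak{a}^{*}$, $\mathfrak{a}^{f}=\{x\in\mathfrak{a}: f([x,y])=0\ \text{for all } y\in\mathfrak{a}\}$. The index of $\mathfrak{a}$ is $\chi(\mathfrak{a})=\min\{\dim\mathfrak{a}^{f}: f\in\mathfrak{a}^{*}\}$. The algebraic adjoint group of $\mathfrak{a}$ is the smallest algebraic subgroup of $\operatorname{Aut}\mathfrak{a}$ whose Lie algebra contains $\operatorname{ad}_{\mathfrak{a}}\mathfrak{a}$. A linear form $f\in\mathfrak{a}^{*}$ is stable if there is a neighbourhood $V$ of $f$ in $\mathfrak{a}^{*}$ such that for every $g\in V$ there is $\alpha$ in the algebraic adjoint group of $\mathfrak{a}$ with $\mathfrak{a}^{g}=\alpha(\mathfrak{a}^{f})$. The set $\mathcal{K}(\Pi)$. Let $\mathfrak{h}$ be a Cartan subalgebra of $\mathfrak{g}$, $R$ the root system of $(\mathfrak{g},\mathfrak{h})$,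 and $\Pi$ a base of $R$. For $\alpha\in R$, $H_{\alpha}$ is the unique element of $[\mathfrak{g}^{\alpha},\mathfrak{g}^{-\alpha}]$ with $\alpha(H_{\alpha})=2$, where $\mathfrak{g}^{\alpha}$ denotes the root space, and $\langle\lambda,\alpha^{\vee}\rangle=\lambda(H_{\alpha})$ for $\lambda\in\mathfrak{h}^{*}$. For $S\subset\Pi$, $R^{S}=R\cap\mathbb{Z}S$ is a root system with base $S$; if $S$ is connected (as a subset of the Dynkin diagram) and nonempty, $R^{S}$ is irreducible and $\varepsilon_{S}$ denotes its highest root. For $S\subset\Pi$, a set $\mathcal{K}(S)$ of subsets of $S$ is defined by induction on the cardinality of $S$: a) $\mathcal{K}(\emptyset)=\emptyset$; b) if $S_{1},\dots,S_{r}$ are the connected components of $S$, then $\mathcal{K}(S)=\mathcal{K}(S_{1})\cup\cdots\cup\mathcal{K}(S_{r})$; c) if $S$ is connected (and nonempty), then $\mathcal{K}(S)=\{S\}\cup\mathcal{K}(\{\alpha\in S:\ \langle\alpha,\varepsilon_{S}^{\vee}\rangle=0\})$. The integer $k_{\mathfrak{g}}=|\mathcal{K}(\Pi)|$ depends only on $\mathfrak{g}$, not on $\mathfrak{h}$ or $\Pi$. *)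

(* Defs.v *)
From HB Require Import structures.
From mathcomp Require Import all_boot all_order all_algebra.
From mathcomp Require Import finmap boolp classical_sets.
From mathcomp Require Import mpoly.

Set Implicit Arguments.
Unset Strict Implicit.
Unset Printing Implicit Defensive.

Import GRing.Theory.
Local Open Scope classical_set_scope.
Local Open Scope ring_scope.

HB.mixin Record Vector_isLieAlgebra (K : fieldType) V of Vector K V := {
  lie_br : V -> V -> V;
  lie_br_linl : forall y : V, linear (lie_br ^~ y);
  lie_br_linr : forall x : V, linear (lie_br x);
  lie_brxx : forall x : V, lie_br x x = 0;
  lie_jacobi : forall x y z : V,
    lie_br x (lie_br y z) + lie_br y (lie_br z x) + lie_br z (lie_br x y) = 0
}.

#[short(type="lieAlgType")]
HB.structure Definition LieAlgebra (K : fieldType) :=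
  { V of Vector_isLieAlgebra K V & Vector K V }.

Notation "[ 'lie' x , y ]" := (lie_br x y)
  (at level 0, x, y at level 99, format "[ 'lie'  x ,  y ]") : ring_scope.

Section LieAlgebra.
Variables (K : fieldType) (g : lieAlgType K).
Implicit Types (x y z : g) (U V : {vspace g}).

HB.instance Definition _ x :=
  GRing.isLinear.Build K g g *:%R (lie_br x) (@lie_br_linr K g x).

Definition lie_ad x : 'End(g) := linfun (lie_br x).

Lemma lie_adE x y : lie_ad x y = [lie x, y].
Proof. by rewrite lfunE. Qed.

(* Spanning by brackets of basis vectors suffices, see mem_lie_brv. *)
Definition lie_brv U V : {vspace g} :=
  <<[seq [lie u, v] | u <- vbasis U, v <- vbasis V]>>%VS.

Definition lie_closed U := forall x y, x \in U -> y \in U -> [lie x, y] \in U.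

Definition lie_ideal U := forall x y, y \in U -> [lie x, y] \in U.

Definition derived_series U n := iter n (fun V => lie_brv V V) U.

Definition lie_solvable U := exists n, derived_series U n = 0%VS.

Definition lower_central_series U n := iter n (lie_brv U) U.

Definition lie_nilpotent U := exists n, lower_central_series U n = 0%VS.

Lemma lie_antisym x y : [lie x, y] = - [lie y, x].
Proof.
apply/eqP; rewrite -addr_eq0; apply/eqP.
have linl u v w : [lie u + v, w] = [lie u, w] + [lie v, w].
  by rewrite -[u]scale1r lie_br_linl !scale1r.
have := lie_brxx (x + y).
by rewrite linl !linearD /= !lie_brxx add0r addr0.
Qed.

Lemma mem_lie_brv U V x y : x \in U -> y \in V -> [lie x, y] \in lie_brv U V.
Proof.
move=> xU yV; rewrite (coord_vbasis yV) linear_sum; apply: rpred_sum => j _.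
rewrite linearZ; apply: rpredZ; rewrite /= lie_antisym rpredN.
rewrite (coord_vbasis xU) linear_sum; apply: rpred_sum => i _.
rewrite linearZ; apply: rpredZ; rewrite /= lie_antisym rpredN.
apply/memv_span/allpairsP; exists ((vbasis U)`_i, (vbasis V)`_j).
by rewrite !mem_nth ?size_tuple.
Qed.

End LieAlgebra.

(* The radical, i.e. the largest solvable ideal, is zero. *)
Definition lie_semisimple (K : fieldType) (g : lieAlgType K) :=
  forall I : {vspace g}, lie_ideal I -> lie_solvable I -> I = 0%VS.

Record lieSubalg (K : fieldType) (g : lieAlgType K) := LieSubalg {
  lsub_vspace :> {vspace g};
  lsub_closed : lie_closed lsub_vspace
}.

Definition lsub_of (K : fieldType) (g : lieAlgType K) (B : lieSubalg g) : Type :=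
  subvs_of B.

Section SubLie.
Variables (K : fieldType) (g : lieAlgType K) (B : lieSubalg g).

HB.instance Definition _ := Vector.on (lsub_of B).

Definition lsub_br (u v : lsub_of B) : lsub_of B :=
  Subvs (lsub_closed (subvsP u) (subvsP v)).

Fact lsub_br_linl v : linear (lsub_br ^~ v).
Proof. by move=> a u w; apply: val_inj; rewrite /= lie_br_linl. Qed.

Fact lsub_br_linr u : linear (lsub_br u).
Proof. by move=> a v w; apply: val_inj; rewrite /= lie_br_linr. Qed.

Fact lsub_brxx u : lsub_br u u = 0.
Proof. by apply: val_inj; rewrite /= lie_brxx. Qed.

Fact lsub_jacobi u v w :
  lsub_br u (lsub_br v w) + lsub_br v (lsub_br w u) + lsub_br w (lsub_br u v)
    = 0.
Proof. by apply: val_inj; rewrite /= lie_jacobi. Qed.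

HB.instance Definition _ := Vector_isLieAlgebra.Build K (lsub_of B)
  lsub_br_linl lsub_br_linr lsub_brxx lsub_jacobi.

End SubLie.

(* The ground field is meant to be algebraically closed. *)
Definition borel_subalgebra (K : fieldType) (g : lieAlgType K)
    (B : lieSubalg g) :=
  lie_solvable B /\
  forall C : lieSubalg g, lie_solvable C -> (B <= C)%VS -> (B = C :> {vspace g}).

Definition cartan_subalgebra (K : fieldType) (g : lieAlgType K)
    (H : lieSubalg g) :=
  lie_nilpotent H /\
  forall x : g, (forall y, y \in H -> [lie x, y] \in H) -> x \in H.

Section Zariski.
Variables (K : fieldType) (V : vectType K).

(* Coordinates are taken in a fixed basis of V; the topology and the tangent
   spaces below do not depend on that basis. *)
Definition vcoord (v : V) : 'I_(\dim {:V}) -> K :=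
  fun i => coord (vbasis {:V}) i v.

Definition zariski_closed (Z : set V) :=
  exists I : set {mpoly K[\dim {:V}]},
    Z = [set v | forall p, I p -> p.@[vcoord v] = 0].

Definition zariski_open (U : set V) := zariski_closed (~` U)%classic.

Definition zariski_nbhs (v : V) (N : set V) :=
  exists U : set V, [/\ zariski_open U, U v & (U `<=` N)%classic].

(* tangent space at v of (the Zariski closure of) Z *)
Definition zariski_tangent (Z : set V) (v : V) : set V :=
  [set w | forall p : {mpoly K[\dim {:V}]},
     (forall z, Z z -> p.@[vcoord z] = 0) ->
     \sum_i (p^`M(i)).@[vcoord v] * vcoord w i = 0].

End Zariski.

Definition dualv (K : fieldType) (V : vectType K) := 'Hom(V, K^o).

Section Index.
Variables (K : fieldType) (a : lieAlgType K).
Implicit Types (f : dualv a) (x y : a).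

(* a^f, as the kernel of x |-> (y |-> f [x, y]) *)
Definition lie_stab f : {vspace a} :=
  lker (linfun (fun x => (f \o lie_ad x)%VF)).

Lemma lie_stabP f x : reflect (forall y, f [lie x, y] = 0) (x \in lie_stab f).
Proof.
have lF : linear (fun x => (f \o lie_ad x)%VF : dualv a).
  move=> c u v; apply/lfunP => y.
  rewrite add_lfunE scale_lfunE !comp_lfunE !lie_adE lie_br_linl.
  by rewrite linearD linearZ.
pose F : {linear a -> dualv a} :=
  HB.pack (fun x => (f \o lie_ad x)%VF : dualv a)
    (GRing.isLinear.Build K a (dualv a) *:%R _ lF).
have stabE z : (z \in lie_stab f) = ((f \o lie_ad z)%VF == 0).
  by rewrite memv_ker (lfunE F).
rewrite stabE; apply: (iffP eqP) => [fx y|fx].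
  by move/lfunP/(_ y): fx; rewrite comp_lfunE lie_adE zero_lfunE.
by apply/lfunP => y; rewrite comp_lfunE lie_adE zero_lfunE fx.
Qed.

Fact lie_index_subproof : exists n, `[< exists f, \dim (lie_stab f) = n >].
Proof. by exists (\dim (lie_stab 0)); apply/asboolP; exists 0. Qed.

Definition lie_index : nat := ex_minn lie_index_subproof.

Definition lie_automorphism (u : 'End(a)) :=
  lker u = 0%VS /\ forall x y, u [lie x, y] = [lie u x, u y].

(* Zariski-closed subgroups of Aut a, which is itself closed in GL(a) *)
Definition algebraic_subgroup_aut (G : set 'End(a)) :=
  [/\ (forall u, G u -> lie_automorphism u),
      G \1%VF,
      (forall u v, G u -> G v -> G (u \o v)%VF),
      (forall u, G u -> G (u^-1)%VF) &
      exists2 Z : set 'End(a), zariski_closed Z &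
        G = [set u | lker u = 0%VS /\ Z u]].

(* The Lie algebra of G is its tangent space at the identity. *)
Definition lie_algebra_of (G : set 'End(a)) : set 'End(a) :=
  zariski_tangent G \1%VF.

Definition contains_ad (G : set 'End(a)) :=
  forall x, lie_algebra_of G (lie_ad x).

(* The smallest subgroup with these properties is the intersection of them
   all; in characteristic zero it has them itself. *)
Definition algebraic_adjoint_group : set 'End(a) :=
  [set u | forall G, algebraic_subgroup_aut G -> contains_ad G -> G u].

Lemma algebraic_adjoint_groupE (G : set 'End(a)) :
  algebraic_subgroup_aut G -> contains_ad G ->
  (forall G', algebraic_subgroup_aut G' -> contains_ad G' ->
     (G `<=` G')%classic) ->
  algebraic_adjoint_group = G.
Proof.
by move=> aG adG minG; apply/seteqP; split=> u; [exact|move=> Gu G' *; exact: (minG G')].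
Qed.

Definition stable_form f :=
  exists2 V : set (dualv a), zariski_nbhs f V &
    forall f', V f' ->
      exists2 u, algebraic_adjoint_group u &
        lie_stab f' = (u @: lie_stab f)%VS.

End Index.

Local Open Scope fset_scope.

Section Roots.
Variables (K : fieldType) (g : lieAlgType K) (h : lieSubalg g).
Local Notation "h^*" := (dualv (lsub_of h)).
Implicit Types (al be : h^*) (S T C : {fset h^*}).

Definition root_space al : {vspace g} :=
  (\bigcap_(i < \dim {:lsub_of h})
     let t := (vbasis {:lsub_of h})`_i in
     lker (lie_ad (vsval t) - (al t : K) *: (\1%VF : 'End(g))))%VS.

Lemma root_spaceP al (x : g) :
  reflect (forall t : lsub_of h, [lie vsval t, x] = (al t : K) *: x)
          (x \in root_space al).
Proof.
have memE (t : lsub_of h) :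
    (x \in lker (lie_ad (vsval t) - (al t : K) *: (\1%VF : 'End(g)))) =
    ([lie vsval t, x] == (al t : K) *: x).
  rewrite memv_ker add_lfunE opp_lfunE scale_lfunE id_lfunE lie_adE.
  by rewrite subr_eq0.
rewrite memvE; apply: (iffP subv_bigcapP) => [xr t|xr i _]; last first.
  by rewrite -memvE memE xr.
rewrite (coord_vbasis (memvf t)) !linear_sum scaler_suml lie_antisym linear_sum.
rewrite -sumrN; apply: eq_bigr => i _.
have /eqP xri : [lie vsval (vbasis {:lsub_of h})`_i, x]
    == (al (vbasis {:lsub_of h})`_i : K) *: x by rewrite -memE memvE xr.
set c := coord _ i t; set v := _`_i in xri *.
transitivity ((c * al v) *: x); last by rewrite linearZ.
by rewrite -scalerA -xri lie_antisym /= linearZ scalerN.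
Qed.

Definition is_root al := (al != 0) && (root_space al != 0%VS).

Definition root_base S :=
  [/\ basis_of {:h^*} S,
      {in S, forall al, is_root al} &
      forall be, is_root be -> exists n : h^* -> nat,
        be = \sum_(al <- S) al *+ n al \/ be = - \sum_(al <- S) al *+ n al].

(* H_al, the element of [g^al, g^(-al)] on which al takes the value 2 *)
Definition coroot al : lsub_of h :=
  xget 0 [set t : lsub_of h |
    vsval t \in lie_brv (root_space al) (root_space (- al)) /\ al t = 2%:R].

Definition pairing (la al : h^*) : K := la (coroot al).

Definition sub_roots S : set h^* :=
  [set be | is_root be /\
    exists z : h^* -> int, be = \sum_(al <- S) al *~ z al].

(* the greatest element of R^S for the order defined by the base S *)
Definition highest_root S : h^* :=
  xget 0 [set ep | sub_roots S ep /\
    forall be, sub_roots S be ->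
      exists n : h^* -> nat, ep - be = \sum_(al <- S) al *+ n al].

(* For roots the two pairings vanish simultaneously. *)
Definition dynkin_adj : rel h^* := fun al be =>
  (al != be) && ((pairing al be != 0) || (pairing be al != 0)).

Definition dynkin_connect S : rel S := connect (relpre val dynkin_adj).

Definition dynkin_connected S := [forall s : S, forall t : S, dynkin_connect s t].

Definition dynkin_component S (s : S) : {fset h^*} :=
  [fset val t | t in dynkin_connect s].

Definition highest_orth S : {fset h^*} :=
  [fset al in S | pairing al (highest_root S) == 0].

(* [in_cascade S T] means that T belongs to K(S); the defining equations of K
   are cascade0, cascade_components and cascade_connected below. *)
Inductive in_cascade : {fset h^*} -> {fset h^*} -> Prop :=
| Cascade_component S (s : S) T :
    in_cascade (dynkin_component s) T -> in_cascade S T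
| Cascade_self S : S != fset0 -> dynkin_connected S -> in_cascade S S
| Cascade_orth S T : S != fset0 -> dynkin_connected S ->
    in_cascade (highest_orth S) T -> in_cascade S T.

Definition cascade S : {fset {fset h^*}} :=
  [fset T in fpowerset S | `[< in_cascade S T >]].


Lemma component_connected S (s : S) :
  dynkin_connected S -> dynkin_component s = S.
Proof.
move=> /forallP/(_ s)/forallP cS; apply/fsetP => al.
apply/imfsetP/idP => [[t _ ->]|Sal]; first exact: valP.
by exists [` Sal]; [exact: cS|].
Qed.

Lemma cascade_sub S T : in_cascade S T -> T `<=` S.
Proof.
elim=> {S T} [S s T _ sTC|S _ _|S T _ _ _ sTS]; last 2 first.
- exact: fsubset_refl.
- by apply: fsubset_trans sTS _; apply/fsubsetP => al; rewrite !inE => /andP[].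
apply: fsubset_trans sTC _; apply/fsubsetP => al /imfsetP[t _ ->].
exact: valP.
Qed.

Lemma cascadeP S T : reflect (in_cascade S T) (T \in cascade S).
Proof.
rewrite !inE /= fpowersetE; apply: (iffP andP) => [[_ /asboolP]//|ST].
by split; [exact: cascade_sub|apply/asboolP].
Qed.

Lemma cascade0 : cascade fset0 = fset0.
Proof.
apply/fsetP => T; rewrite inE; apply/negbTE/negP => /cascadeP.
move E: fset0 => S ST; case: ST E => {S T} [S s T _ E|S + _ E|S T + _ _ E].
- by case: s => s; rewrite -E.
- by rewrite -E eqxx.
- by rewrite -E eqxx.
Qed.

Lemma cascade_components S T :
  (T \in cascade S) = [exists s : S, T \in cascade (dynkin_component s)].
Proof.
apply/cascadeP/existsP => [ST|[s /cascadeP]]; last exact: Cascade_component.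
suff [s Ts] : exists s : S, in_cascade (dynkin_component s) T.
  by exists s; apply/cascadeP.
case: ST => {S T} [S s T|S S0 cS|S T S0 cS ST]; first by exists s.
- have [al Sal] := fset0Pn _ S0; exists [` Sal].
  by rewrite component_connected //; exact: Cascade_self.
- have [al Sal] := fset0Pn _ S0; exists [` Sal].
  by rewrite component_connected //; exact: Cascade_orth.
Qed.

Lemma cascade_connected S : S != fset0 -> dynkin_connected S ->
  cascade S = S |` cascade (highest_orth S).
Proof.
move=> S0 cS; apply/fsetP => T; rewrite in_fset1U.
apply/cascadeP/predU1P => [ST|[->|/cascadeP]]; last 2 first.
- exact: Cascade_self.
- exact: Cascade_orth.
elim: ST S0 cS => {S T} [S s T _ IH S0 cS|S _ _ _ _|S T _ _ ST _ _ _].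
- by rewrite component_connected // in IH; exact: IH.
- by left.
- by right; apply/cascadeP.
Qed.

End Roots.

(* Main.v *)
Require Import Defs.
From HB Require Import structures.
From mathcomp Require Import all_boot all_order all_algebra.
From mathcomp Require Import finmap.
From mathcomp Require Import boolp classical_sets mpoly ring zify.

(** Let [h] be a Cartan subalgebra contained in the Borel subalgebra [b], so that
    [b] is the sum of [h] and of the root spaces of a positive system P.  Choose
    positive roots ep_1, ..., ep_m greedily: ep_i is maximal among the positive
    roots orthogonal to ep_1, ..., ep_(i-1), until no root is left.  If a
    positive root ga <> ep_i is orthogonal to ep_1, ..., ep_(i-1) but not to
    ep_i, then ep_i - ga has the same property; hence, if f(e_(ep_i)) <> 0, the
    automorphism exp(s ad e_(ep_i - ga)) can be used to annihilate f(e_ga).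
    Doing so in order of increasing i carries every f of a nonempty Zariski open
    set to a form supported by [h] and the vectors e_(ep_i), and the stabilizer
    of such a form is the common kernel of the ep_i in [h].  Hence stability,
    and the index is dim h - m.

    When P is defined by a base Pi, the ep_i are the highest roots of the members
    of K(Pi).  To pass from [b] to the Borel subalgebra given by (h, Pi), one
    uses that two Borel subalgebras contain a common Cartan subalgebra (the
    Killing-orthogonal of a Borel subalgebra lies in it, and a dimension count
    then provides a large enough common torus), and that the positive systems
    of a given Cartan subalgebra are linked by reflections, which preserve m.

    The Jordan decomposition is replaced by polynomials in ad x acting by F(a) on
    the generalized eigenspace for a, where F is an additive map of the ground
    field; rational-valued F give Cartan's criterion. *)

Set Implicit Arguments.
Unset Strict Implicit.
Unset Printing Implicit Defensive.

Import GRing.Theory.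
Local Open Scope fset_scope.
Local Open Scope ring_scope.

(** * Subspaces and brackets *)

(** The stabilizer of a cleared form is one and the same subspace [tE] of the Cartan subalgebra: it
    depends only on which root vectors carry the form. This is why exponentials of nilpotent
    elements suffice, and all that has to be known of the adjoint group is that an algebraic
    subgroup whose tangent space contains a nilpotent ad x contains exp (ad x); this comes from the
    Taylor expansion of polynomials along t |-> exp (t ad x).

    The parameter s of each elimination step is a quotient of coordinates of f. The forms that can
    be cleared thus contain the nonvanishing set of a polynomial, and a form [f0] fixed by every
    step shows this polynomial to be nonzero. That the index is exactly dim [tE] then follows by
    semicontinuity, as two nonempty open sets meet.

    The index of a Borel subalgebra can be computed in any Cartan subalgebra inside it. So the given
    one and the one defined by (h, Pi) are compared inside a Cartan subalgebra common to both, and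
    only the latter is computed in h. *)

Section VspaceExtra.
Variables (K : fieldType) (V : vectType K).
Implicit Types (U W : {vspace V}).

Lemma ex_vspace_max (P : {vspace V} -> Prop) U0 : P U0 ->
  exists U, P U /\ forall U', P U' -> (\dim U' <= \dim U)%N.
Proof.
move=> PU0.
pose Q n := `[< exists U, P U /\ \dim U = n >].
have exQ : exists n, Q n by exists (\dim U0); apply/asboolP; exists U0.
have ubQ n : Q n -> (n <= \dim {:V})%N.
  by move=> /asboolP[U [_ <-]]; apply/dimvS/subvf.
case: (ex_maxnP exQ ubQ) => n /asboolP[U [PU <-]] maxU.
by exists U; split=> // U' PU'; apply: maxU; apply/asboolP; exists U'.
Qed.

Lemma ex_vspace_maxS (P : {vspace V} -> Prop) U0 : P U0 ->
  exists U, [/\ P U, (U0 <= U)%VS &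
    forall U', P U' -> (U <= U')%VS -> U' = U].
Proof.
move=> PU0.
have [|U [[PU sU] maxU]] := @ex_vspace_max (fun U => P U /\ (U0 <= U)%VS) U0.
  by split.
exists U; split=> // U' PU' sUU'; apply/esym/eqP.
by rewrite eqEdim sUU' maxU //; split=> //; apply: subv_trans sU sUU'.
Qed.

(** A subspace of maximal dimension inside [P] absorbs every [x] with [P x], since adding the line
    of [x] stays inside [P]. Centralizers and orthogonals are obtained in this way. *)
Lemma vspace_of_pred (P : V -> Prop) :
  P 0 -> (forall a x y, P x -> P y -> P (a *: x + y)) ->
  exists U : {vspace V}, forall x, x \in U <-> P x.
Proof.
move=> P0 Plin.
have [|U [PU maxU]] := @ex_vspace_max (fun U => forall x, x \in U -> P x) 0%VS.
  by move=> x; rewrite memv0 => /eqP->.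
exists U => x; split=> [/PU//|Px].
have PU' y : y \in (U + <[x]>)%VS -> P y.
  move=> /memv_addP[u uU [_ /vlineP[a ->] ->]].
  by rewrite addrC; apply: Plin => //; apply: PU.
have: (U + <[x]> == U)%VS.
  by rewrite eq_sym eqEdim addvSl maxU.
by move/eqP=> <-; rewrite memvE addvSr.
Qed.

Lemma span_ind (X : seq V) (P : V -> Prop) :
  P 0 -> (forall a x y, P x -> P y -> P (a *: x + y)) ->
  (forall x, x \in X -> P x) -> forall x, x \in <<X>>%VS -> P x.
Proof.
move=> P0 Plin PX x xX.
have [U UP] := vspace_of_pred P0 Plin.
by apply/UP; move: xX; apply/subvP/span_subvP => y /PX /UP.
Qed.

Lemma hyperplane_over U W : (W <= U)%VS -> W <> U ->
  exists H z, [/\ (W <= H)%VS, z \in U, z \notin H & U = (H + <[z]>)%VS].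
Proof.
move=> sWU nWU.
have [|H [[sHU nHU] sWH maxH]] :=
    @ex_vspace_maxS (fun H => (H <= U)%VS /\ H <> U) W; first by split.
have /subvPn[z zU zH] : ~~ (U <= H)%VS.
  by apply/negP => sUH; apply: nHU; apply/eqP; rewrite eqEsubv sHU.
exists H, z; split=> //.
have sHz : (H + <[z]> <= U)%VS by rewrite subv_add sHU -memvE.
apply: contrapT => nU; case/negP: zH.
rewrite -(maxH (H + <[z]>)%VS) ?addvSl ?memvE ?addvSr //.
by split=> // e; apply: nU.
Qed.

Lemma memv_addline U z x : x \in (U + <[z]>)%VS ->
  exists u a, u \in U /\ x = u + a *: z.
Proof. by move=> /memv_addP[u uU [_ /vlineP[a ->] ->]]; exists u, a. Qed.

End VspaceExtra.

Section LieBasics.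
Variables (K : fieldType) (g : lieAlgType K).
Implicit Types (x y z : g) (U V W s : {vspace g}).

Lemma lieDl x y z : [lie x + y, z] = [lie x, z] + [lie y, z].
Proof. by have := lie_br_linl z 1 x y; rewrite !scale1r. Qed.
Lemma lie0l z : [lie 0, z] = 0.
Proof. by have := lie_br_linl z (-1) 0 0; rewrite scaler0 addr0 scaleN1r addNr. Qed.
Lemma lieZl a x z : [lie a *: x, z] = a *: [lie x, z].
Proof. by have := lie_br_linl z a x 0; rewrite lie0l !addr0. Qed.
Lemma lieNl x z : [lie - x, z] = - [lie x, z].
Proof. by rewrite -scaleN1r lieZl scaleN1r. Qed.
Lemma lieBl x y z : [lie x - y, z] = [lie x, z] - [lie y, z].
Proof. by rewrite lieDl lieNl. Qed.
Lemma lieDr x y z : [lie z, x + y] = [lie z, x] + [lie z, y].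
Proof. exact: linearD. Qed.
Lemma lie0r z : [lie z, 0] = 0.
Proof. exact: linear0. Qed.
Lemma lieZr a x z : [lie z, a *: x] = a *: [lie z, x].
Proof. by rewrite linearZ. Qed.
Lemma lieNr x z : [lie z, - x] = - [lie z, x].
Proof. exact: linearN. Qed.
Lemma lieBr x y z : [lie z, x - y] = [lie z, x] - [lie z, y].
Proof. exact: linearB. Qed.
Lemma lie_suml I (r : seq I) (P : pred I) F z :
  [lie \sum_(i <- r | P i) F i, z] = \sum_(i <- r | P i) [lie F i, z].
Proof. by apply: (big_morph (lie_br ^~ z)) => [x y|]; rewrite ?lieDl ?lie0l. Qed.
Lemma lie_sumr I (r : seq I) (P : pred I) F z :
  [lie z, \sum_(i <- r | P i) F i] = \sum_(i <- r | P i) [lie z, F i].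
Proof. exact: linear_sum. Qed.

Lemma lie_jac x y z :
  [lie x, [lie y, z]] = [lie [lie x, y], z] + [lie y, [lie x, z]].
Proof.
have /eqP := lie_jacobi x y z.
rewrite -addrA addr_eq0 => /eqP->.
by rewrite opprD addrC [[lie _, z]]lie_antisym [[lie x, z]]lie_antisym lieNr.
Qed.

Lemma lie_brvP U V W :
  (forall x y, x \in U -> y \in V -> [lie x, y] \in W) <-> (lie_brv U V <= W)%VS.
Proof.
split=> [UVW|/subvP sW x y xU yV]; last by apply/sW/mem_lie_brv.
apply/span_subvP => _ /allpairsP[[u v] /= [uU vV ->]].
by apply: UVW; apply: vbasis_mem.
Qed.

Lemma lie_brv_ind U V (P : g -> Prop) :
  P 0 -> (forall a x y, P x -> P y -> P (a *: x + y)) ->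
  (forall x y, x \in U -> y \in V -> P [lie x, y]) ->
  forall x, x \in lie_brv U V -> P x.
Proof.
move=> P0 Plin PX; apply: span_ind => // _ /allpairsP[[u v] /= [uU vV ->]].
by apply: PX; apply: vbasis_mem.
Qed.

Lemma lie_brvS U U' V V' :
  (U <= U')%VS -> (V <= V')%VS -> (lie_brv U V <= lie_brv U' V')%VS.
Proof.
move=> /subvP sU /subvP sV; apply/lie_brvP => x y xU yV.
by apply: mem_lie_brv; [apply: sU|apply: sV].
Qed.

Lemma lie_closedP U : lie_closed U <-> (lie_brv U U <= U)%VS.
Proof. by rewrite -lie_brvP; split=> cU x y xU yU; apply: cU. Qed.

Lemma lie_brv_closed s : lie_closed s -> lie_closed (lie_brv s s).
Proof.
move=> /lie_closedP cs x y xs ys.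
by apply: mem_lie_brv; apply: (subvP cs).
Qed.

Lemma derived_seriesS U V n :
  (U <= V)%VS -> (derived_series U n <= derived_series V n)%VS.
Proof. by move=> sUV; elim: n => //= n IHn; apply: lie_brvS. Qed.

Lemma lie_solvableS U V : (U <= V)%VS -> lie_solvable V -> lie_solvable U.
Proof.
move=> sUV [n V0]; exists n; apply/eqP; rewrite -subv0 -V0.
exact: derived_seriesS.
Qed.

Lemma derived_series_brv U n :
  derived_series (lie_brv U U) n = derived_series U n.+1.
Proof. by rewrite /derived_series iterSr. Qed.

Lemma lie_solvable_brv U V :
  (lie_brv U U <= V)%VS -> lie_solvable V -> lie_solvable U.
Proof.
move=> sUV [n V0]; exists n.+1; rewrite -derived_series_brv.
by apply/eqP; rewrite -subv0 -V0; apply: derived_seriesS.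
Qed.

Lemma lie_solvable_abelian U :
  (forall x y, x \in U -> y \in U -> [lie x, y] = 0) -> lie_solvable U.
Proof.
move=> abU; exists 1; apply/eqP; rewrite -subv0; apply/lie_brvP => x y xU yU.
by rewrite abU ?mem0v.
Qed.

Lemma lie_solvable_proper s :
  lie_solvable s -> s <> 0%VS -> lie_brv s s <> s.
Proof.
move=> [n s0] nz_s e; apply: nz_s; rewrite -s0.
by elim: n {s0} => //= n <-.
Qed.

(** A nonzero [s] has a derived algebra of smaller dimension, whose subalgebras are subalgebras of
    [s]; induction on the dimension does the rest. *)
Lemma lie_solvable_of_proper s : lie_closed s ->
  (forall s', lie_closed s' -> (s' <= s)%VS -> s' <> 0%VS ->
    lie_brv s' s' <> s') -> lie_solvable s.
Proof.
move: {2}(\dim s) (leqnn (\dim s)) => d.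
elim: d s => [|d IHd] s.
  rewrite leqn0 dimv_eq0 => /eqP-> _ _; exists 0%N; by [].
move=> ds cs sprop.
have [->|nz_s] := eqVneq s 0%VS; first by exists 0%N.
have sb : (lie_brv s s <= s)%VS by apply/lie_closedP.
apply: (lie_solvable_brv (subvv (lie_brv s s))); apply: IHd.
- rewrite -ltnS; apply: leq_trans ds; rewrite ltnNge; apply/negP => ds'.
  apply: (sprop s) => //; first exact/eqP.
  by apply/eqP; rewrite eqEdim sb.
- exact: lie_brv_closed.
- by move=> s' cs' ss' ; apply: sprop => //; apply: subv_trans sb.
Qed.

End LieBasics.

(** * Lie's theorem *)

Section EigenIn.
Variable (k : closedFieldType).

(** The characteristic polynomial splits and kills [v]; applying its linear factors one at a time,
    the last nonzero vector is an eigenvector. [W] is a bare predicate so that a weight space can be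
    used without constructing it as a subspace. *)
Lemma eigenvector_in n (A : 'M[k]_n.+1) (W : 'rV[k]_n.+1 -> Prop) v :
  (forall w a, W w -> W (w *m A - a *: w)) -> v != 0 -> W v ->
  exists w a, [/\ w != 0, W w & w *m A = a *: w].
Proof.
move=> Wst nz_v Wv.
have [r pE] := closed_field_poly_normal (char_poly A).
move/monicP: (char_poly_monic A) pE => -> ; rewrite scale1r => pE.
have: v *m horner_mx A (\prod_(a <- r) ('X - a%:P)) = 0.
  by rewrite -pE Cayley_Hamilton mulmx0.
elim: r v nz_v Wv {pE} => [|a r IHr] v nz_v Wv.
  by rewrite big_nil rmorph1 mulmx1 => v0; rewrite v0 eqxx in nz_v.
rewrite big_cons rmorphM /= mulmxA rmorphB /= horner_mx_X horner_mx_C.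
rewrite mulmxBr mul_mx_scalar => vr0.
have [e|nz] := eqVneq (v *m A - a *: v) 0.
  by exists v, a; split=> //; apply/subr0_eq.
by apply: (IHr (v *m A - a *: v)) => //; apply: Wst.
Qed.

End EigenIn.

Section LieTheorem.
Variables (k : closedFieldType) (char_k : [pchar k] =i pred0).
Variable (g : lieAlgType k).
Implicit Types (x y z : g) (s U V W : {vspace g}).

Lemma natr_neq0 n : (n.+1%:R : k) != 0.
Proof. by move/pcharf0P: char_k => ->. Qed.

Definition lin_on n (rho : g -> 'M[k]_n) :=
  forall a x y, rho (a *: x + y) = a *: rho x + rho y.

(* Matrices act on row vectors, hence the reversed commutator. *)
Definition antirep_on n s (rho : g -> 'M[k]_n) :=
  forall x y, x \in s -> y \in s ->
    rho [lie x, y] = rho y *m rho x - rho x *m rho y.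

Section WeightInvariance.
Variables (n : nat) (s1 : {vspace g}) (z : g) (rho : g -> 'M[k]_n.+1).
Variables (chi : g -> k) (w : 'rV[k]_n.+1).
Hypothesis rhoz : forall y, y \in s1 ->
  rho [lie z, y] = rho y *m rho z - rho z *m rho y.
Hypothesis zs1 : forall y, y \in s1 -> [lie z, y] \in s1.
Hypothesis nz_w : w != 0.
Hypothesis ww : forall y, y \in s1 -> w *m rho y = chi y *: w.

Let v i := w *m (rho z) ^+ i.
Let U i := (\sum_(l < i) <<v l>>)%MS.

Let vS i : v i *m rho z = v i.+1.
Proof. by rewrite /v exprSr mulmxA. Qed.

Let US i : U i.+1 = (U i + <<v i>>)%MS.
Proof. by rewrite /U big_ord_recr. Qed.

Let v_U l i : (l < i)%N -> (v l <= U i)%MS.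
Proof.
by move=> li; apply: (sumsmx_sup (Ordinal li)) => //=; rewrite genmxE.
Qed.

Let U_sub i j : (i <= j)%N -> (U i <= U j)%MS.
Proof.
move=> ij; apply/sumsmx_subP => l _; rewrite genmxE.
by apply: v_U; apply: leq_trans ij.
Qed.

Let U_z i : (U i *m rho z <= U i.+1)%MS.
Proof.
rewrite /U sumsmxMr_gen; apply/sumsmx_subP => l _.
rewrite genmxE (eqmxMr _ (genmxE _)) vS; exact: (@v_U l.+1 i.+1 (ltn_ord l)).
Qed.

(** Modulo [U i], [rho y] acts on [v i.+1] as [chi y] with a correction along [v i] that grows
    linearly in [i]. This coefficient plays the part of the trace in the usual argument. *)
Let tri i : forall y, y \in s1 ->
  ((v i.+1 *m rho y - chi y *: v i.+1 + (i.+1%:R * chi [lie z, y]) *: v i)%R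
     <= U i)%MS.
Proof.
elim: i => [|i IHi] y ys.
  rewrite -vS /v expr0 mulmx1.
  have -> : w *m rho z *m rho y = w *m rho y *m rho z - w *m rho [lie z, y].
    by rewrite rhoz // mulmxBr !mulmxA subKr.
  rewrite (ww ys) (ww (zs1 ys)) -scalemxAl.
  rewrite mul1r.
  set u := w *m rho z; rewrite [X in (X <= _)%MS](_ : _ = 0) ?sub0mx //.
  by apply/rowP => j; rewrite !mxE; ring.
have -> : v i.+2 *m rho y = v i.+1 *m rho y *m rho z - v i.+1 *m rho [lie z, y].
  by rewrite rhoz // mulmxBr !mulmxA vS subKr.
have [zy IH1 IH2] := And3 (zs1 ys) (IHi y ys) (IHi _ (zs1 ys)).
set c := chi [lie z, y] in IH1 *; set y' := [lie z, y] in zy IH2 *.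
set l1 := (X in (X <= _)%MS) in IH1; set l2 := (X in (X <= _)%MS) in IH2.
have aux (p q r : 'rV[k]_n.+1) : p = p - q + r + q - r.
  by apply/rowP => j; rewrite !mxE; ring.
have -> : v i.+1 *m rho y = l1 + chi y *: v i.+1 - (i.+1%:R * c) *: v i.
  exact: aux.
have -> : v i.+1 *m rho y' =
    l2 + c *: v i.+1 - (i.+1%:R * chi [lie z, y']) *: v i.
  exact: aux.
set d := chi [lie z, y']; clearbody l1 l2 d c y'.
rewrite !mulmxBl !mulmxDl -!scalemxAl !vS.
rewrite [X in (X <= _)%MS](_ : _ =
    (l1 *m rho z - l2 + (i.+1%:R * d) *: v i)%R); last first.
  move: (v i.+2) (v i.+1) (v i) (l1 *m rho z) => v2 v1 v0 p.
  by apply/rowP => j; rewrite !mxE -[i.+2]addn1 natrD; ring.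
apply: addmx_sub; first apply: addmx_sub.
- by apply: submx_trans (U_z i); apply: submxMr.
- by rewrite eqmx_opp; apply: submx_trans IH2 (U_sub _).
- by apply: scalemx_sub; apply: v_U.
Qed.

(** Take the least [m.+1] such that [v m.+1] lies in the span [U m.+1] of its predecessors. On that
    span [rho y - chi y] lowers the filtration by one, so [tri] puts [m.+1%:R * chi [lie z, y]]
    times [v m] into [U m]; minimality and characteristic zero make the scalar vanish. *)
Lemma weight_invariant y : y \in s1 -> chi [lie z, y] = 0.
Proof.
move=> ys.
have [m vm mmin] : exists2 m, (v m <= U m)%MS &
    forall i, (i < m)%N -> ~~ (v i <= U i)%MS.
  have ex : exists m, (v m <= U m)%MS.
    apply: contrapT => nex.
    have rk i : (i <= \rank (U i))%N.
      elim: i => // i IHi; apply: leq_ltn_trans IHi _.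
      rewrite US ltnNge; apply/negP => le.
      apply: nex; exists i; rewrite -(genmxE (v i)).
      apply: submx_trans (addsmxSr (U i) _) _.
      by have [_ /esym] := mxrank_leqif_sup (addsmxSl (U i) <<v i>>%MS);
        rewrite eqn_leq le mxrankS ?addsmxSl // => ->.
    by have := leq_trans (rk n.+2) (rank_leq_col _); rewrite ltnn.
  exists (ex_minn ex) => [|i]; case: ex_minnP => // m _ mmin im.
  by apply/negP => /mmin; rewrite leqNgt im.
case: m => [|m] in vm mmin.
  move: vm; rewrite /U big_ord0 submx0 /v expr0 mulmx1 => w0.
  by case/negP: nz_w.
have [A vmE] := submxP vm.
have triU i : (U i.+1 *m (rho y - (chi y)%:M) <= U i)%MS.
  rewrite /U sumsmxMr_gen; apply/sumsmx_subP => -[l /= li] _.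
  rewrite genmxE (eqmxMr _ (genmxE _)) mulmxBr mul_mx_scalar.
  case: l => [|l] in li *.
    by rewrite /v expr0 mulmx1 ww // subrr sub0mx.
  have := tri l ys; move/submx_trans/(_ (U_sub (leq_trans (leqnSn l) li))) => h.
  rewrite -[X in (X <= _)%MS](addrK ((l.+1%:R * chi [lie z, y]) *: v l)).
  apply: addmx_sub h _; rewrite eqmx_opp; apply: scalemx_sub.
  exact: v_U.
have h1 : (v m.+1 *m (rho y - (chi y)%:M) <= U m)%MS.
  by apply: submx_trans (triU m); apply: submxMr.
have h2 := tri m ys.
apply/eqP; apply: contraTT (mmin m (ltnSn m)) => nz_c; rewrite negbK.
have nz : m.+1%:R * chi [lie z, y] != 0 by rewrite mulf_neq0 ?natr_neq0.
rewrite -(eqmx_scale _ nz).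
rewrite -[X in (X <= _)%MS](addKr (v m.+1 *m (rho y - (chi y)%:M))).
rewrite {2}mulmxBr mul_mx_scalar.
by apply: addmx_sub h2; rewrite eqmx_opp.
Qed.

End WeightInvariance.

Lemma lie_eigenvector s : lie_closed s -> lie_solvable s ->
  forall n (rho : g -> 'M[k]_n.+1), lin_on rho -> antirep_on s rho ->
  exists2 v : 'rV[k]_n.+1, v != 0 & forall x, x \in s -> exists c, v *m rho x = c *: v.
Proof.
move: {2}(\dim s) (leqnn (\dim s)) => d.
elim: d s => [|d IHd] s ds cs sols n rho lrho arho.
  exists (const_mx 1) => [|x].
    by apply/eqP => /rowP/(_ 0); rewrite !mxE => /eqP; rewrite oner_eq0.
  move: ds; rewrite leqn0 dimv_eq0 => /eqP->; rewrite memv0 => /eqP->.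
  have := lrho (-1) 0 0; rewrite scaler0 addr0 scaleN1r addNr => ->.
  by exists 0; rewrite mulmx0 scale0r.
have [s0|/eqP nz_s] := eqVneq s 0%VS.
  by apply: IHd => //; rewrite s0 dimv0.
have sb : (lie_brv s s <= s)%VS by apply/lie_closedP.
have [s1 [z [sbs1 zs zs1 sE]]] :=
  hyperplane_over sb (lie_solvable_proper sols nz_s).
have s1s : (s1 <= s)%VS by rewrite sE addvSl.
have ids x y : x \in s -> y \in s -> [lie x, y] \in s1.
  by move=> xs ys; apply/(subvP sbs1)/mem_lie_brv.
have cs1 : lie_closed s1 by move=> x y /(subvP s1s) xs /(subvP s1s); apply: ids.
have [|||v nz_v ev] := IHd s1 _ cs1 _ n rho lrho.
- rewrite -ltnS; apply: leq_trans ds; rewrite ltnNge; apply/negP => le.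
  by move/negP: zs1; apply; have /eqP-> : s1 == s by rewrite eqEdim s1s.
- exact: lie_solvableS sols.
- by move=> x y /(subvP s1s) xs /(subvP s1s); apply: arho.
have [i0 vi0] : exists i0, v 0 i0 != 0.
  apply/existsP; apply: contraNT nz_v; rewrite negb_exists => /forallP v0.
  by apply/eqP/rowP => i; rewrite mxE; apply/eqP; have := v0 i; rewrite negbK.
(* The weight is read off a nonzero coordinate of [v], which makes [chi] a function on all of [g];
   it is a weight on [s1] only. *)
pose chi y := (v *m rho y) 0 i0 / v 0 i0.
pose W (w : 'rV[k]_n.+1) := forall y, y \in s1 -> w *m rho y = chi y *: w.
have Wv : W v.
  by move=> y /ev[c e]; rewrite /chi e mxE mulfK.
have [|w [a [nz_w Ww wz]]] := @eigenvector_in k n (rho z) W v _ nz_v Wv.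
  move=> w a Ww y ys.
  have [->|nz_w] := eqVneq w 0; first by rewrite mul0mx scaler0 subrr mul0mx scaler0.
  have c0 : chi [lie z, y] = 0.
    apply: (@weight_invariant n s1 z rho chi w) => // y' ys'.
    - by apply: arho => //; apply: (subvP s1s).
    - by apply: ids => //; apply: (subvP s1s).
  have := Ww _ (ids _ _ zs (subvP s1s _ ys)).
  rewrite c0 scale0r arho // ?(subvP s1s) // mulmxBr !mulmxA => /subr0_eq e.
  by rewrite mulmxBl -scalemxAl -e (Ww y ys) -scalemxAl scalerBr !scalerA (mulrC a).
exists w => // x; rewrite sE => /memv_addline[u [b [us ->]]].
exists (b * a + chi u); rewrite addrC lrho mulmxDr -scalemxAr wz Ww //.
by rewrite scalerA scalerDl.
Qed.

Lemma row_complete n (v : 'rV[k]_n.+1) : v != 0 ->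
  exists2 P, P \in unitmx & exists2 a, a != 0 & row 0 P = a *: v.
Proof.
move=> nz_v; exists (row_ebase v); first exact: row_ebase_unit.
have rv : \rank v = 1%N by rewrite rank_rV nz_v.
have e := mulmx_ebase v; rewrite rv in e.
pose c := col_ebase v 0 0.
have ce : col_ebase v = c%:M by apply/matrixP => i j; rewrite !ord1 !mxE eqxx mulr1n.
have nz_c : c != 0.
  by have := col_ebase_unit v; rewrite ce unitmxE det_scalar1 unitfE.
exists c^-1; first by rewrite invr_eq0.
rewrite -[in RHS]e ce mul_scalar_mx -scalemxAl scalerA mulVf // scale1r.
apply/rowP => j; rewrite !mxE (bigD1 0) //= big1 => [|i ni].
  by rewrite !mxE eqxx /= mul1r addr0.
by rewrite !mxE /= [0%N == _]eq_sym -[_ == 0%N]/(i == 0) (negPf ni) mul0r.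
Qed.

(** Since matrices act on rows, an eigenvector in the first row kills the upper right block, and the
    lower right block is again an antirepresentation of [s]. *)
Lemma lie_trig s : lie_closed s -> lie_solvable s ->
  forall n (rho : g -> 'M[k]_n), lin_on rho -> antirep_on s rho ->
  exists2 P, P \in unitmx &
    forall x, x \in s -> is_trig_mx (P *m rho x *m invmx P).
Proof.
move=> cs sols; elim=> [|n IHn] rho lrho arho.
  exists 1%:M; first exact: unitmx1.
  by move=> x _; apply/is_trig_mxP => -[].
have [v nz_v ev] := lie_eigenvector cs sols lrho arho.
have [P0 uP0 [a nz_a P0v]] := row_complete nz_v.
have [r1 r1E] : exists r1 : g -> 'M[k]_(1 + n),
    forall x, r1 x = P0 *m rho x *m invmx P0
  by exists (fun x => P0 *m rho x *m invmx P0).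
have lr1 : lin_on r1.
  by move=> b x y; rewrite !r1E lrho mulmxDr mulmxDl -scalemxAr -scalemxAl.
have r1M x y : r1 x *m r1 y = P0 *m (rho x *m rho y) *m invmx P0.
  by rewrite !r1E !mulmxA mulmxKV.
have ar1 : antirep_on s r1.
  by move=> x y xs ys; rewrite r1E arho // mulmxBr mulmxBl -!r1M.
have ur0 x : x \in s -> ursubmx (r1 x) = 0.
  move=> xs; have [c vc] := ev x xs.
  have e : row 0 (r1 x) = c *: row 0 1%:M.
    rewrite r1E -mulmxA row_mul P0v -scalemxAl mulmxA vc -scalemxAl.
    rewrite !scalerA [a * c]mulrC -scalerA scalemxAl -P0v -row_mul mulmxV //.
  have e0 j : r1 x 0 (rshift 1 j) = 0.
    have := congr1 (fun u : 'rV[k]_(1 + n) => u 0 (rshift 1 j)) e.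
    by rewrite [row 0 _ _ _]mxE => ->; rewrite !mxE mulr0.
  apply/matrixP => i j; rewrite ord1 [LHS]mxE [LHS]mxE [RHS]mxE -(e0 j).
  by congr (r1 x _ _); apply: val_inj.
pose r2 x := drsubmx (r1 x).
have lr2 : lin_on r2.
  by move=> b x y; apply/matrixP => i j; rewrite /r2 lr1 !mxE.
have r2M x y : y \in s -> drsubmx (r1 x *m r1 y) = r2 x *m r2 y.
  move=> ys; rewrite -{1}[r1 x]submxK -{1}[r1 y]submxK mulmx_block.
  by rewrite block_mxKdr ur0 // mulmx0 add0r.
have ar2 : antirep_on s r2.
  by move=> x y xs ys; rewrite -!r2M // /r2 ar1 //; apply/matrixP => i j; rewrite !mxE.
have [P' uP' trP'] := IHn r2 lr2 ar2.
pose P1 : 'M[k]_(1 + n) := block_mx 1%:M 0 0 P'.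
have uP1 : P1 \in unitmx by rewrite unitmxE det_ublock det1 mul1r -unitmxE.
have iP1 : invmx P1 = block_mx 1%:M 0 0 (invmx P').
  apply: (can_inj (mulKmx uP1)); rewrite mulmxV // mulmx_block.
  by rewrite !(mulmx0, mul0mx, addr0, add0r, mulmx1) mulmxV // -scalar_mx_block.
have uP : P1 *m P0 \in unitmx by rewrite unitmx_mul uP1.
have iP : invmx (P1 *m P0) = invmx P0 *m invmx P1.
  apply: (can_inj (mulKmx uP)); rewrite mulmxV // !mulmxA mulmxK //.
  by rewrite mulmxV.
exists (P1 *m P0) => //.
move=> x xs.
have -> : P1 *m P0 *m rho x *m invmx (P1 *m P0) = P1 *m r1 x *m invmx P1.
  by rewrite iP !r1E !mulmxA.
rewrite -[r1 x]submxK ur0 // iP1 !mulmx_block.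
rewrite !(mulmx0, mul0mx, addr0, add0r, mulmx1, mul1mx).
by rewrite (@is_trig_block_mx _ 1 n 1 n) // eqxx mx11_is_trig trP'.
Qed.

End LieTheorem.

Import passmx.

(** * Engel's theorem *)

Section Engel.
Variables (K : fieldType) (g : lieAlgType K).
Implicit Types (x y z : g) (s U V W : {vspace g}).

Lemma iter_lie_mem x U n y :
  (forall u, u \in U -> [lie x, u] \in U) -> y \in U ->
  iter n (lie_br x) y \in U.
Proof. by move=> xU yU; elim: n => //= n; apply: xU. Qed.

(** A maximal proper subalgebra together with a vector normalizing it spans a larger subalgebra,
    hence all of [s]. *)
Lemma codim1_of_normalizers s : lie_closed s -> s <> 0%VS ->
  (forall s', lie_closed s' -> (s' <= s)%VS -> s' <> s ->
    exists z, [/\ z \in s, z \notin s' & forall y, y \in s' -> [lie y, z] \in s']) ->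
  exists s' z, [/\ lie_closed s', z \in s, z \notin s', s = (s' + <[z]>)%VS &
    forall y, y \in s' -> [lie y, z] \in s'].
Proof.
move=> cs nz_s norm.
have [|s' [[cs' ss' ns'] _ max_s']] := @ex_vspace_maxS _ _
    (fun s' => [/\ lie_closed s', (s' <= s)%VS & s' <> s]) 0%VS.
  split; [|exact: sub0v|by move=> e; apply: nz_s].
  by move=> x y; rewrite !memv0 => /eqP-> _; rewrite lie0l.
have [z [zs zs' nz]] := norm s' cs' ss' ns'.
exists s', z; split=> //; apply: contrapT => ne; case/negP: zs'.
rewrite -(max_s' (s' + <[z]>)%VS) ?addvSl ?memvE ?addvSr //.
split; last 1 [by move=> e; apply: ne].
  move=> x y /memv_addline[u [a [us ->]]] /memv_addline[v [b [vs ->]]].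
  rewrite !(lieDl, lieDr, lieZl, lieZr) lie_brxx !scaler0 addr0.
  apply: (subvP (addvSl s' <[z]>)); rewrite !rpredD ?rpredZ ?nz //.
    exact: cs'.
  by rewrite lie_antisym rpredN nz.
by rewrite subv_add ss' -memvE.
Qed.

(** Working modulo [W] lets the induction apply the statement to [V = s] and [W = s'], which
    produces the normalizing vector that [codim1_of_normalizers] asks for. *)
Lemma engel s V W : lie_closed s -> (W <= V)%VS -> W <> V ->
  (forall x y, x \in s -> y \in V -> [lie x, y] \in V) ->
  (forall x y, x \in s -> y \in W -> [lie x, y] \in W) ->
  (forall x, x \in s -> exists m, forall y, y \in s -> iter m (lie_br x) y = 0) ->
  (forall x, x \in s -> exists m, forall y, y \in V -> iter m (lie_br x) y \in W) ->
  exists v, [/\ v \in V, v \notin W & forall x, x \in s -> [lie x, v] \in W].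
Proof.
move: {2}(\dim s) (leqnn (\dim s)) => d.
elim: d s V W => [|d IHd] s V W ds cs sWV nWV sV sW nils nilV.
  move: ds; rewrite leqn0 dimv_eq0 => /eqP s0.
  have /subvPn[v vV vW] : ~~ (V <= W)%VS.
    by apply/negP => sVW; apply: nWV; apply/eqP; rewrite eqEsubv sWV.
  exists v; split=> // x; rewrite s0 memv0 => /eqP->.
  by rewrite lie0l mem0v.
have [s0|/eqP nz_s] := eqVneq s 0%VS.
  by apply: IHd => //; rewrite s0 dimv0.
have norm s' : lie_closed s' -> (s' <= s)%VS -> s' <> s ->
    (\dim s' <= d)%N /\
    exists z, [/\ z \in s, z \notin s' & forall y, y \in s' -> [lie y, z] \in s'].
  move=> cs' ss' ns'.
  have ds' : (\dim s' <= d)%N.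
    rewrite -ltnS; apply: leq_trans ds; rewrite ltnNge; apply/negP => le.
    by apply: ns'; apply/eqP; rewrite eqEdim ss'.
  split=> //; apply: IHd => // x.
  - by move=> y /(subvP ss') xs ys; apply: cs.
  - by move/(subvP ss')/nils => [m xm]; exists m => y /(subvP ss')/xm.
  - by move/(subvP ss')/nils => [m xm]; exists m => y /xm->; rewrite mem0v.
have [|s' [z [cs' zs zs' sE nz]]] := codim1_of_normalizers cs nz_s.
  by move=> s' cs' ss' ns'; have [] := norm s' cs' ss' ns'.
have ss' : (s' <= s)%VS by rewrite sE addvSl.
have [|ds' _] := norm s' cs' ss'; first by move=> e; rewrite e zs in zs'.
have [||||v0 [v0V v0W s'v0]] // := IHd s' V W ds' cs' sWV nWV.
- by move=> x y /(subvP ss'); apply: sV.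
- by move=> x y /(subvP ss'); apply: sW.
- by move=> x /(subvP ss')/nils[m xm]; exists m => y /(subvP ss')/xm.
- by move=> x /(subvP ss')/nilV.
pose Q v := [/\ v \in V, v \notin W & forall y, y \in s' -> [lie y, v] \in W].
have [m zm] := nilV z zs.
have Qz v : Q v -> [lie z, v] \notin W -> Q [lie z, v].
  move=> [vV vW s'v] zvW; split=> //; first exact: sV.
  move=> y ys'; rewrite lie_jac rpredD // ?s'v ?nz //.
  by apply: sW => //; apply: s'v.
(* The iterates of [z] on [v0] keep the property [Q] as long as they stay outside [W], and they end
   in [W]; the last one outside is the vector sought. *)
have [v [[vV vW s'v] zvW]] : exists v, Q v /\ [lie z, v] \in W.
  apply: contrapT => none.
  have Qi i : Q (iter i (lie_br z) v0).
    elim: i => [|i IHi]; first by split.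
    by apply: Qz => //; apply/negP => zW; apply: none; exists (iter i (lie_br z) v0).
  by have [_ /negP nW _] := Qi m; apply: nW; apply: zm.
exists v; split=> // x; rewrite sE => /memv_addline[u [a [us ->]]].
by rewrite lieDl lieZl; apply: rpredD; [apply: s'v|apply: rpredZ].
Qed.

(** Otherwise some nonzero subalgebra [s1] would be perfect; but it has a hyperplane [s'], a
    subalgebra stable under [z], and all brackets of [s' + <[z]>] lie in [s']. *)
Lemma lie_solvable_nil s : lie_closed s ->
  (forall x, x \in s -> exists m, forall y, y \in s -> iter m (lie_br x) y = 0) ->
  lie_solvable s.
Proof.
move=> cs nils; apply: lie_solvable_of_proper => // s1 cs1 ss1 nz_s1.
have nils1 x : x \in s1 -> exists m, forall y, y \in s1 -> iter m (lie_br x) y = 0.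
  by move=> /(subvP ss1)/nils[m xm]; exists m => y /(subvP ss1)/xm.
have [|s' [z [cs' zs zs' sE nz]]] := codim1_of_normalizers cs1 nz_s1.
  move=> s' cs' ss' ns'; apply: engel => // x.
  - by move=> y /(subvP ss') xs ys; apply: cs1.
  - by move/(subvP ss')/nils1 => [m xm]; exists m => y /(subvP ss')/xm.
  - by move/(subvP ss')/nils1 => [m xm]; exists m => y /xm->; rewrite mem0v.
move=> e; case/negP: zs'; rewrite -e in zs; move: zs; apply/subvP/lie_brvP.
rewrite sE => x y /memv_addline[u [a [us ->]]] /memv_addline[v [b [vs ->]]].
rewrite !(lieDl, lieDr, lieZl, lieZr) lie_brxx !scaler0 addr0.
rewrite !rpredD ?rpredZ ?nz //; first exact: cs'.
by rewrite lie_antisym rpredN nz.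
Qed.

Lemma lie_nilpotent_ad s x : lie_closed s -> lie_nilpotent s -> x \in s ->
  exists m, forall y, y \in s -> iter m (lie_br x) y = 0.
Proof.
move=> cs [m sm] xs; exists m => y ys; apply/eqP; rewrite -memv0 -sm.
by elim: m {sm} => //= m IHm; apply: mem_lie_brv.
Qed.

End Engel.

(** * Matrices of endomorphisms and triangular matrices *)

Section LfunMatrix.
Variables (K : fieldType) (V : vectType K).
Implicit Types (u v : 'End(V)).

Definition vrow (x : V) := rVof (vbasis {:V}) x.
Definition vvec (r : 'rV[K]_(\dim {:V})) := vecof (vbasis {:V}) r.
Definition lfun_mx u := mxof (vbasis {:V}) (vbasis {:V}) u.

Lemma vrowK : cancel vrow vvec. Proof. exact/rVofK/vbasisP. Qed.
Lemma vvecK : cancel vvec vrow. Proof. exact/vecofK/vbasisP. Qed.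

Lemma vrowD x y : vrow (x + y) = vrow x + vrow y.
Proof. exact: linearD. Qed.
Lemma vrowZ a x : vrow (a *: x) = a *: vrow x.
Proof. exact: linearZ. Qed.
Lemma vrow_eq0 x : (vrow x == 0) = (x == 0).
Proof. exact/rVof_eq0/vbasisP. Qed.
Lemma vrow0 : vrow 0 = 0.
Proof. by apply/eqP; rewrite vrow_eq0. Qed.

Lemma lfun_mxE u x : vrow (u x) = vrow x *m lfun_mx u.
Proof. exact/rVof_app/vbasisP. Qed.

Lemma lfun_mx_eq u A :
  (forall x, vrow (u x) = vrow x *m A) -> lfun_mx u = A.
Proof.
move=> uA; apply/row_matrixP => i; rewrite !rowE -[delta_mx 0 i]vvecK.
by rewrite -lfun_mxE uA.
Qed.

Lemma lfun_mx_comp u v : lfun_mx (u \o v)%VF = lfun_mx v *m lfun_mx u.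
Proof. by apply: lfun_mx_eq => x; rewrite comp_lfunE !lfun_mxE mulmxA. Qed.

Lemma lfun_mxD u v : lfun_mx (u + v) = lfun_mx u + lfun_mx v.
Proof. exact: linearD. Qed.

Lemma lfun_mxZ a u : lfun_mx (a *: u) = a *: lfun_mx u.
Proof. exact: linearZ. Qed.

Lemma lfun_mx1 : lfun_mx \1%VF = 1%:M.
Proof. by apply: lfun_mx_eq => x; rewrite id_lfunE mulmx1. Qed.

End LfunMatrix.

Section Trig.
Variables (K : fieldType).

Lemma trig_mul n (A B : 'M[K]_n) : is_trig_mx A -> is_trig_mx B ->
  is_trig_mx (A *m B) /\ forall i, (A *m B) i i = A i i * B i i.
Proof.
move=> /is_trig_mxP tA /is_trig_mxP tB; split.
  apply/is_trig_mxP => i j ij; rewrite mxE big1 // => l _.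
  have [il|li] := ltnP i l; first by rewrite tA ?mul0r.
  by rewrite tB ?mulr0 //; apply: leq_ltn_trans ij.
move=> i; rewrite mxE (bigD1 i) //= big1 ?addr0 // => l nl.
have [il|li] := ltnP i l; first by rewrite tA ?mul0r.
by rewrite tB ?mulr0 //; rewrite ltn_neqAle li andbT.
Qed.

Lemma trig_exp n (A : 'M[K]_n) m : is_trig_mx A ->
  is_trig_mx (A ^+ m) /\ forall i, (A ^+ m) i i = A i i ^+ m.
Proof.
move=> tA; elim: m => [|m [IH1 IH2]].
  rewrite expr0; split=> [|i]; last by rewrite mxE eqxx.
  by apply/is_trig_mxP => i j; rewrite mxE; case: eqVneq => // ->; rewrite ltnn.
rewrite exprS; have [t d] := trig_mul tA IH1; split=> // i.
by rewrite -[A * _]/(A *m _) d IH2 exprS.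
Qed.

Lemma trig_nilp n (A : 'M[K]_n) : is_trig_mx A ->
  (forall i, A i i = 0) -> A ^+ n = 0.
Proof.
move=> /is_trig_mxP tA A0.
have H m (i j : 'I_n) : (i < j + m)%N -> (A ^+ m) i j = 0.
  elim: m i j => [|m IHm] i j ij.
    rewrite expr0 mxE; case: eqVneq => // e; move: ij; rewrite e addn0 ltnn //.
  rewrite exprS -[A * _]/(A *m _) mxE big1 // => l _.
  have [il|li|il] := ltngtP i l; first by rewrite tA ?mul0r.
    by rewrite IHm ?mulr0 //; rewrite -ltnS -addnS; apply: leq_ltn_trans ij.
  by rewrite (val_inj il : i = l) A0 mul0r.
by apply/matrixP => i j; rewrite H ?mxE // ltn_addl.
Qed.

End Trig.

(** * The Killing form *)

Section Killing.
Variables (K : fieldType) (g : lieAlgType K).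
Implicit Types (x y z : g) (s U V W : {vspace g}).

Definition adm x : 'M[K]_(\dim {:g}) := lfun_mx (lie_ad x).
Definition killing x y : K := \tr (adm x *m adm y).

Lemma admE x y : vrow [lie x, y] = vrow y *m adm x.
Proof. by rewrite -lie_adE lfun_mxE. Qed.

Lemma adm_eq x A : (forall y, vrow [lie x, y] = vrow y *m A) -> adm x = A.
Proof. by move=> xA; apply: lfun_mx_eq => y; rewrite lie_adE. Qed.

Lemma adm_lin a x y : adm (a *: x + y) = a *: adm x + adm y.
Proof.
apply: adm_eq => z.
by rewrite lieDl lieZl vrowD vrowZ !admE mulmxDr scalemxAr.
Qed.

Lemma adm_br x y : adm [lie x, y] = adm y *m adm x - adm x *m adm y.
Proof.
apply: adm_eq => z; rewrite mulmxBr !mulmxA -!admE lie_jac.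
by rewrite vrowD addrK.
Qed.

Lemma admD x y : adm (x + y) = adm x + adm y.
Proof. by rewrite -[x]scale1r adm_lin !scale1r. Qed.
Lemma adm0 : adm 0 = 0.
Proof. by apply: adm_eq => y; rewrite lie0l mulmx0 vrow0. Qed.
Lemma admZ a x : adm (a *: x) = a *: adm x.
Proof. by rewrite -[a *: x]addr0 adm_lin adm0 addr0. Qed.

Lemma killingC x y : killing x y = killing y x.
Proof. exact: mxtrace_mulC. Qed.
Lemma killingDl x y z : killing (x + y) z = killing x z + killing y z.
Proof. by rewrite /killing admD mulmxDl mxtraceD. Qed.
Lemma killingDr x y z : killing z (x + y) = killing z x + killing z y.
Proof. by rewrite killingC killingDl !(killingC z). Qed.
Lemma killingZl a x z : killing (a *: x) z = a * killing x z.
Proof. by rewrite /killing admZ -scalemxAl mxtraceZ. Qed.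
Lemma killingZr a x z : killing z (a *: x) = a * killing z x.
Proof. by rewrite killingC killingZl killingC. Qed.
Lemma killing0l z : killing 0 z = 0.
Proof. by rewrite -[0](scale0r 0) killingZl mul0r. Qed.
Lemma killing0r z : killing z 0 = 0.
Proof. by rewrite killingC killing0l. Qed.
Lemma killingNl x z : killing (- x) z = - killing x z.
Proof. by rewrite -scaleN1r killingZl mulN1r. Qed.
Lemma killing_suml I (r : seq I) (P : pred I) F z :
  killing (\sum_(i <- r | P i) F i) z = \sum_(i <- r | P i) killing (F i) z.
Proof.
by apply: (big_morph (killing^~ z)) => [x y|]; rewrite ?killingDl ?killing0l.
Qed.

Lemma mxtraceB n (M N : 'M[K]_n) : \tr (M - N) = \tr M - \tr N.
Proof. by rewrite -scaleN1r mxtraceD mxtraceZ mulN1r. Qed.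

Lemma killing_inv x y z : killing [lie x, y] z = killing x [lie y, z].
Proof.
rewrite /killing !adm_br mulmxBl mulmxBr !mxtraceB.
congr (_ - _); last by rewrite mulmxA.
by rewrite mxtrace_mulC mulmxA mxtrace_mulC.
Qed.

Definition ad_nilp x := exists m, forall y, iter m (lie_br x) y = 0.

Lemma iter_adm x m y : vrow (iter m (lie_br x) y) = vrow y *m adm x ^+ m.
Proof.
elim: m => [|m IHm]; first by rewrite expr0 mulmx1.
by rewrite iterS admE IHm -mulmxA exprSr.
Qed.

Lemma ad_nilpP x : ad_nilp x <-> exists m, adm x ^+ m = 0.
Proof.
split=> -[m xm]; exists m; last first.
  by move=> y; apply/eqP; rewrite -vrow_eq0 iter_adm xm mulmx0.
apply/row_matrixP => i; rewrite rowE row0 -[delta_mx 0 i]vvecK -iter_adm xm.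
exact: vrow0.
Qed.

End Killing.

Section LieWeights.
Variables (k : closedFieldType) (char_k : [pchar k] =i pred0).
Variable (g : lieAlgType k).
Implicit Types (x y z : g) (s U V W : {vspace g}).

(** The forms [chi i] are the diagonal entries of a simultaneous triangular form of the adjoint
    action of [s] on the whole of [g]. They turn the Killing form, traces of powers and nilpotency
    on [s] into statements about scalars. *)
Lemma lie_weights s : lie_closed s -> lie_solvable s ->
  exists chi : 'I_(\dim {:g}) -> g -> k,
  [/\ forall i a x y, chi i (a *: x + y) = a * chi i x + chi i y,
      forall i x y, x \in s -> y \in s -> chi i [lie x, y] = 0,
      forall x y, x \in s -> y \in s ->
        killing x y = \sum_i chi i x * chi i y,
      forall x, x \in s -> ad_nilp x <-> forall i, chi i x = 0 &
      (forall x m, x \in s -> \tr (adm x ^+ m) = \sum_i chi i x ^+ m) /\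
      (forall x i, x \in s -> exists2 y, y != 0 & [lie x, y] = chi i x *: y)].
Proof.
move=> cs sols.
have [|P uP trP] := lie_trig char_k cs sols (@adm_lin _ g).
  by move=> x y _ _; apply: adm_br.
pose T x := P *m adm x *m invmx P.
have TM x y : P *m (adm x *m adm y) *m invmx P = T x *m T y.
  by rewrite /T !mulmxA mulmxKV.
have Ttr (A : 'M[k]__) : \tr (P *m A *m invmx P) = \tr A.
  by rewrite -mulmxA mxtrace_mulC mulmxKV.
have TX x m : P *m adm x ^+ m *m invmx P = T x ^+ m.
  elim: m => [|m IHm]; first by rewrite !expr0 mulmx1 mulmxV.
  by rewrite !exprS -IHm /T -![_ * _]/(_ *m _) !mulmxA mulmxKV.
have chi0 i x y : x \in s -> y \in s -> T [lie x, y] i i = 0.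
  move=> xs ys; rewrite /T adm_br mulmxBr mulmxBl !TM mxE [X in _ + X]mxE.
  have [_ ->] := trig_mul (trP y ys) (trP x xs).
  have [_ ->] := trig_mul (trP x xs) (trP y ys).
  by rewrite [X in X - _]mulrC subrr.
exists (fun i x => T x i i); split=> //.
- by move=> i a x y; rewrite /T adm_lin mulmxDr mulmxDl -scalemxAr -scalemxAl !mxE.
- move=> x y xs ys; rewrite /killing -Ttr TM /mxtrace.
  by apply: eq_bigr => i _; have [_ ->] := trig_mul (trP x xs) (trP y ys).
- move=> x xs; rewrite ad_nilpP; split=> [[m xm] i|T0].
    have := TX x m; rewrite xm mulmx0 mul0mx => /matrixP/(_ i i).
    have [_ ->] := trig_exp m (trP x xs).
    by rewrite mxE => /esym/eqP; rewrite expf_eq0 => /andP[_ /eqP].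
  exists (\dim {:g}); apply: (can_inj (mulKmx uP)).
  apply: (can_inj (mulmxK (_ : invmx P \in unitmx))); first by rewrite unitmx_inv.
  by rewrite TX mulmx0 mul0mx trig_nilp //; apply: trP.
split=> [x m xs|x i xs].
  rewrite -Ttr TX /mxtrace; apply: eq_bigr => i _.
  by have [_ ->] := trig_exp m (trP x xs).
have: \det (adm x - (T x i i)%:M) == 0.
  have -> A : \det A = \det (P *m A *m invmx P).
    by rewrite !det_mulmx mulrAC -det_mulmx mulmxV // det1 mul1r.
  rewrite mulmxBr mulmxBl -/(T x).
  rewrite mul_mx_scalar -scalemxAl mulmxV //.
  have /is_trig_mxP := trP x xs; rewrite -/(T x); move: (T x) => Tx tTx.
  rewrite det_trig; last first.
    apply/is_trig_mxP => a b ab; rewrite !mxE.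
    rewrite tTx //.
    by rewrite -[a == b]/(val a == val b) ltn_eqF // mulr0 subrr.
  by apply/eqP; rewrite (bigD1 i) //= !mxE eqxx mulr1 subrr mul0r.
move=> /det0P[v nz_v vx].
exists (vvec v).
  by apply: contraNneq nz_v => v0; rewrite -[v]vvecK v0 vrow0.
apply: (can_inj (@vrowK _ _)); rewrite admE vrowZ vvecK.
by apply/subr0_eq; rewrite -mul_mx_scalar -mulmxBr.
Qed.

End LieWeights.

(** * Generalized eigenspaces *)

Section PolyCRT.
Variable K : fieldType.
Implicit Types (p q : {poly K}) (L : seq K).

(** One exponent for all eigenvalues avoids any bookkeeping of multiplicities. *)
Definition primary_poly L M : {poly K} := \prod_(a <- L) ('X - a%:P) ^+ M.

Lemma coprime_primary (a : K) L M N : a \notin L ->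
  coprimep (('X - a%:P) ^+ N) (primary_poly L M).
Proof.
move=> aL; apply: coprimep_expl; rewrite /primary_poly.
elim: L aL => [|b L IHL]; first by rewrite big_nil coprimep1.
rewrite inE negb_or big_cons => /andP[ab aL].
rewrite coprimepMr IHL // andbT; apply: coprimep_expr.
by rewrite coprimep_XsubC root_XsubC eq_sym.
Qed.

Lemma primary_dvd L M p : uniq L ->
  (forall a, a \in L -> ('X - a%:P) ^+ M %| p) -> primary_poly L M %| p.
Proof.
rewrite /primary_poly; elim: L => [|a L IHL] /=; first by rewrite big_nil dvd1p.
move=> /andP[aL uL] H; rewrite big_cons Gauss_dvdp ?coprime_primary //.
by rewrite H ?mem_head //= IHL // => b bL; apply: H; rewrite inE bL orbT.
Qed.

Lemma primary_dvdl L M a : a \in L -> ('X - a%:P) ^+ M %| primary_poly L M.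
Proof.
by move=> aL; rewrite /primary_poly (big_rem a) //= dvdp_mulr.
Qed.

Lemma coprimep_bezout p q : coprimep p q ->
  exists u v, u * p + v * q = 1.
Proof. by move=> /Bezout_eq1_coprimepP[[u v] /= e]; exists u, v. Qed.

Lemma poly_crt L M (c : K -> K) : uniq L ->
  exists p, forall a, a \in L -> ('X - a%:P) ^+ M %| p - (c a)%:P.
Proof.
elim: L => [|a L IHL] /=; first by exists 0.
move=> /andP[aL /IHL[p pL]].
have [u [v e]] := coprimep_bezout (coprime_primary M M aL).
(* By Bezout, [v * primary_poly L M] is 1 modulo the power at [a] and 0 modulo the powers at the
   points of [L], so only the residue at [a] changes. *)
exists (p + ((c a)%:P - p) * v * primary_poly L M) => b.
rewrite inE => /predU1P[->|bL].
  have -> : p + ((c a)%:P - p) * v * primary_poly L M - (c a)%:P =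
      (p - (c a)%:P) * u * ('X - a%:P) ^+ M.
    transitivity ((p - (c a)%:P) * (1 - v * primary_poly L M)); first by ring.
    by rewrite -e addrK mulrA.
  exact: dvdp_mull.
rewrite addrAC dvdp_addr ?pL //.
by apply/dvdp_mull/primary_dvdl.
Qed.

End PolyCRT.

Section Lhorner.
Variables (K : fieldType) (V : vectType K).
Implicit Types (u : 'End(V)) (p q : {poly K}).

Definition lpow u i : 'End(V) := iter i (fun w => (u \o w)%VF) \1%VF.
Definition lhorner u p : 'End(V) := \sum_(i < size p) p`_i *: lpow u i.

Lemma lpowE u i x : lpow u i x = iter i u x.
Proof. by elim: i => [|i IHi] /=; rewrite ?id_lfunE // comp_lfunE IHi. Qed.

Lemma lpow_mx u i : lfun_mx (lpow u i) = lfun_mx u ^+ i.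
Proof.
elim: i => [|i IHi] /=; first by rewrite lfun_mx1 expr0.
by rewrite lfun_mx_comp IHi exprSr.
Qed.

Lemma lhorner_widen u p n : (size p <= n)%N ->
  lhorner u p = \sum_(i < n) p`_i *: lpow u i.
Proof.
move=> pn; rewrite /lhorner (big_ord_widen _ (fun i => p`_i *: lpow u i) pn).
rewrite big_mkcond; apply: eq_bigr => i _.
by case: ltnP => // pi; rewrite nth_default // scale0r.
Qed.

Lemma lhornerD u p q : lhorner u (p + q) = lhorner u p + lhorner u q.
Proof.
pose n := maxn (size p) (size q).
rewrite !(@lhorner_widen _ _ n) ?leq_maxl ?leq_maxr //; last first.
  exact: size_polyD.
by rewrite -big_split; apply: eq_bigr => i _; rewrite coefD scalerDl.
Qed.

Lemma lhornerZ u a p : lhorner u (a *: p) = a *: lhorner u p.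
Proof.
rewrite (@lhorner_widen _ _ (size p)) ?size_scale_leq // scaler_sumr.
by apply: eq_bigr => i _; rewrite coefZ scalerA.
Qed.

Lemma lhornerN u p : lhorner u (- p) = - lhorner u p.
Proof. by rewrite -scaleN1r lhornerZ scaleN1r. Qed.

Lemma lhornerC u a : lhorner u a%:P = a *: \1%VF.
Proof.
rewrite (@lhorner_widen _ _ 1) ?size_polyC_leq1 // big_ord1.
by rewrite coefC.
Qed.

Lemma lhorner0 u : lhorner u 0 = 0.
Proof. by rewrite -(scale0r 0) lhornerZ scale0r. Qed.

Lemma lhorner1 u : lhorner u 1 = \1%VF.
Proof. by rewrite -[1]/(1%:P) lhornerC scale1r. Qed.

Lemma lhornerMX u p : lhorner u (p * 'X) = (u \o lhorner u p)%VF.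
Proof.
rewrite (@lhorner_widen _ _ (size p).+1); last first.
  have [->|nz] := eqVneq p 0; first by rewrite mul0r size_poly0.
  by rewrite size_mulX.
rewrite big_ord_recl coefMX eqxx scale0r add0r.
apply/lfunP => x; rewrite comp_lfunE /lhorner !sum_lfunE linear_sum.
apply: eq_bigr => i _; rewrite coefMX /= !scale_lfunE linearZ /=.
by rewrite comp_lfunE.
Qed.

Lemma lhornerM u p q : lhorner u (p * q) = (lhorner u p \o lhorner u q)%VF.
Proof.
elim/poly_ind: p => [|p c IHp]; first by rewrite mul0r lhorner0 comp_lfun0l.
have -> : (p * 'X + c%:P) * q = p * q * 'X + c *: q.
  by rewrite -mul_polyC; ring.
rewrite !lhornerD !lhornerMX IHp lhornerZ lhornerC.
apply/lfunP => x.
by rewrite !(add_lfunE, comp_lfunE, scale_lfunE, id_lfunE).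
Qed.

Lemma lhornerX u : lhorner u 'X = u.
Proof. by rewrite -['X]mul1r lhornerMX lhorner1 comp_lfun1r. Qed.

Lemma lhornerB u p q : lhorner u (p - q) = lhorner u p - lhorner u q.
Proof. by rewrite lhornerD lhornerN. Qed.

Lemma lhornerXn u p n : lhorner u (p ^+ n) = lpow (lhorner u p) n.
Proof.
by elim: n => [|n IHn]; rewrite ?expr0 ?lhorner1 // exprS lhornerM IHn.
Qed.

Lemma lhorner_mx u p :
  lfun_mx (lhorner u p) = \sum_(i < size p) p`_i *: lfun_mx u ^+ i.
Proof.
rewrite /lfun_mx /lhorner linear_sum; apply: eq_bigr => i _.
by rewrite linearZ /= -[mxof _ _ _]/(lfun_mx _) lpow_mx.
Qed.

Lemma lhorner_dvd u p q x : p %| q -> lhorner u p x = 0 -> lhorner u q x = 0.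
Proof.
by move=> /dvdpP[r ->] px; rewrite lhornerM comp_lfunE px linear0.
Qed.

(** Without constant term every monomial of [p] applies [u] at least once. This is how polynomials
    in [ad x] inherit inclusions from [ad x]. *)
Lemma lhorner_stable0 u p (U W : {vspace V}) x : p`_0 = 0 ->
  (W <= U)%VS -> (forall y, y \in U -> u y \in W) -> x \in U ->
  lhorner u p x \in W.
Proof.
move=> p0 /subvP WU uU xU; rewrite sum_lfunE rpred_sum // => -[i /= _] _.
rewrite scale_lfunE; case: i => [|i]; first by rewrite p0 scale0r mem0v.
rewrite rpredZ // lpowE iterS uU //.
by elim: i => //= i IHi; apply/WU/uU.
Qed.

Lemma ex_annihilator u : exists2 q, q != 0 & lhorner u q = 0.
Proof.
pose n := \dim {:'End(V)}.
pose X := [tuple lpow u i | i < n.+1].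
have nfX : ~~ free X.
  rewrite /free; apply/negP => /eqP e.
  have := dimvS (subvf <<X>>%VS); rewrite e size_tuple -/n ltnn //.
apply: contrapT => none; case/negP: nfX; apply/freeP => c c0 i.
apply/eqP; apply: contrapT => /negP ci; apply: none.
exists (\poly_(j < n.+1) c (inord j)).
  apply: contraNneq ci => /polyP/(_ i).
  by rewrite coef_poly coef0 ltn_ord inord_val => ->.
rewrite (@lhorner_widen _ _ n.+1) ?size_poly // -[RHS]c0.
apply: eq_bigr => j _; rewrite coef_poly ltn_ord inord_val.
by rewrite (nth_map j) ?size_tuple // nth_ord_enum.
Qed.

Definition geigen u a x := exists n, lhorner u (('X - a%:P) ^+ n) x = 0.

Lemma lhorner_XsubC u a x : lhorner u ('X - a%:P) x = u x - a *: x.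
Proof.
by rewrite lhornerB lhornerX lhornerC add_lfunE opp_lfunE scale_lfunE id_lfunE.
Qed.

Lemma geigen_eigen u a x : u x = a *: x -> geigen u a x.
Proof. by move=> e; exists 1; rewrite expr1 lhorner_XsubC e subrr. Qed.

Section Primary.
Variables (u : 'End(V)) (L : seq K) (M : nat).
Hypotheses (uL : uniq L) (LM : lhorner u (primary_poly L M) = 0).

Lemma geigen_notin a x : a \notin L -> geigen u a x -> x = 0.
Proof.
move=> aL [n xn]; have [p [q e]] := coprimep_bezout (coprime_primary M n aL).
rewrite -[x]id_lfunE -(lhorner1 u) -e lhornerD !lhornerM add_lfunE !comp_lfunE.
by rewrite xn LM zero_lfunE !linear0 addr0.
Qed.

Lemma geigen_in a x : a \in L -> geigen u a x ->
  lhorner u (('X - a%:P) ^+ M) x = 0.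
Proof.
move=> aL [n xn]; have aL' : a \notin rem a L by rewrite mem_rem_uniqF.
have [p [q e]] := coprimep_bezout (coprime_primary M n aL').
rewrite -[X in lhorner u X]mul1r -e mulrDl lhornerD add_lfunE.
rewrite -mulrA [_ ^+ n * _]mulrC mulrA lhornerM comp_lfunE xn linear0 add0r.
rewrite -mulrA [primary_poly _ _ * _]mulrC.
have -> : ('X - a%:P) ^+ M * primary_poly (rem a L) M = primary_poly L M.
  by rewrite /primary_poly [in RHS](big_rem a).
by rewrite lhornerM LM comp_lfun0r zero_lfunE.
Qed.

Lemma lhorner_primary p x : primary_poly L M %| p -> lhorner u p x = 0.
Proof. by move/lhorner_dvd; apply; rewrite LM zero_lfunE. Qed.

Lemma primary_decomp x : exists w : K -> V,
  x = \sum_(a <- L) w a /\ forall a, a \in L -> geigen u a (w a).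
Proof.
have [P PE] : exists P : K -> {poly K}, forall a b, b \in L ->
    ('X - b%:P) ^+ M %| P a - ((a == b)%:R)%:P.
  have crt a := poly_crt M (fun b => (a == b)%:R) uL.
  by exists (fun a => sval (cid (crt a))) => a; apply: svalP (cid (crt a)).
exists (fun a => lhorner u (P a) x); split.
  apply/eqP; rewrite eq_sym -subr_eq0 -{2}[x]id_lfunE -(lhorner1 u).
  have -> : \sum_(a <- L) lhorner u (P a) x = lhorner u (\sum_(a <- L) P a) x.
    rewrite -sum_lfunE; congr (fun_of_lfun _ x).
    by elim/big_rec2: _ => [|a y z _ ->]; rewrite ?lhorner0 // lhornerD.
  rewrite -opp_lfunE -add_lfunE -lhornerB; apply/eqP/lhorner_primary.
  apply: primary_dvd => // b bL.
  rewrite (bigD1_seq b) //= addrAC dvdp_addr.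
    apply: (big_ind (fun q => _ %| q)) => [|p q|a /negPf ab].
    - exact: dvdp0.
    - by move=> *; rewrite dvdp_addr.
    - by have := PE a b bL; rewrite ab subr0.
  by have := PE b b bL; rewrite eqxx.
move=> a aL; exists M; rewrite -comp_lfunE -lhornerM; apply: lhorner_primary.
apply: primary_dvd => // b bL; have [->|ab] := eqVneq b a.
  exact: dvdp_mulr.
by apply: dvdp_mull; have := PE a b bL; rewrite eq_sym (negPf ab) subr0.
Qed.

(** Interpolating [F] modulo the powers [('X - a%:P) ^+ M] gives a polynomial in [u] acting on each
    generalized eigenspace as a scalar. For [F = id] this is the semisimple part of [u]. *)
Lemma ex_primary_fun (F : K -> K) : exists p,
  [/\ forall a x, a \in L -> geigen u a x -> lhorner u p x = F a *: x,
      forall a, a \in L -> (0 < M)%N -> p.[a] = F a &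
      forall a, a \in L -> ('X - a%:P) ^+ M %| p - (F a)%:P].
Proof.
have [p pE] := poly_crt M F uL; exists p; split=> // [a x aL ax|a aL M0].
  have := lhorner_dvd (pE a aL) (geigen_in aL ax).
  rewrite lhornerB lhornerC add_lfunE opp_lfunE scale_lfunE id_lfunE.
  by move/subr0_eq.
have /dvdpP[r e] := pE a aL; apply/eqP; rewrite -subr_eq0.
have := congr1 (horner^~ a) e.
by rewrite !hornerE subrr expr0n gtn_eqF // mulr0 => ->.
Qed.

End Primary.
End Lhorner.

(** The point 0 is put into [L] on purpose: the polynomial interpolating an [F] with [F 0 = 0] then
    has no constant term, as [lhorner_stable0] requires. *)
Lemma ex_primary (k : closedFieldType) (V : vectType k) (u : 'End(V)) :
  exists L M, [/\ uniq L, 0 \in L, (0 < M)%N & lhorner u (primary_poly L M) = 0].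
Proof.
have [q nz_q uq] := ex_annihilator u.
have [r qE] := closed_field_poly_normal q.
exists (undup (0 :: r)), (size r).+1.
split; rewrite ?undup_uniq ?mem_undup ?mem_head //.
apply/lfunP => x; rewrite zero_lfunE.
have: lhorner u q x = 0 by rewrite uq zero_lfunE.
apply: lhorner_dvd; rewrite qE dvdpZl ?lead_coef_eq0 //.
set L := undup _.
apply: (@dvdp_trans _ ((\prod_(a <- L) ('X - a%:P)) ^+ (size r).+1)); last first.
  by rewrite /primary_poly -prodrXl.
rewrite exprS; apply: dvdp_mull.
have: {subset r <= L} by move=> a ar; rewrite mem_undup inE ar orbT.
elim: (r) => [|a s IHs] sL /=; first by rewrite big_nil expr0.
rewrite big_cons exprS; apply: dvdp_mul; last first.
  by apply: IHs => b bs; apply: sL; rewrite inE bs orbT.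
by rewrite (big_rem a) ?sL ?mem_head //= dvdp_mulr.
Qed.

(** * Cartan's criterion *)

Section RationalFunctional.
Variables (K : fieldType) (char_K : [pchar K] =i pred0).

(** The prime field of [K], a copy of the rational numbers in characteristic zero. *)
Definition ratl (q : K) := exists (a : int) (b : nat), q = a%:~R / b.+1%:R.

Lemma natrS_neq0 n : (n.+1%:R : K) != 0.
Proof. by move/pcharf0P: char_K => ->. Qed.

Lemma intr_eq0_char0 (a : int) : (a%:~R == 0 :> K) = (a == 0).
Proof.
case: a => n; first by rewrite -pmulrn; move/pcharf0P: char_K => ->.
by rewrite NegzE mulrNz oppr_eq0 -pmulrn (negPf (natrS_neq0 n)).
Qed.

Lemma ratl_int (a : int) : ratl a%:~R.
Proof. by exists a, 0%N; rewrite divr1. Qed.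

Lemma ratlB p q : ratl p -> ratl q -> ratl (p - q).
Proof.
move=> [a [b ->]] [c [d ->]].
exists (a * d.+1%:Z - c * b.+1%:Z), (b.+1 * d.+1).-1.
rewrite prednK ?muln_gt0 // natrM intrB !intrM -!pmulrn.
move: (natrS_neq0 b) (natrS_neq0 d).
by move: (b.+1%:R) (d.+1%:R) => u v nu nv; field; rewrite nu nv.
Qed.

Lemma ratlM p q : ratl p -> ratl q -> ratl (p * q).
Proof.
move=> [a [b ->]] [c [d ->]]; exists (a * c), (b.+1 * d.+1).-1.
rewrite prednK ?muln_gt0 // natrM intrM.
move: (natrS_neq0 b) (natrS_neq0 d).
by move: (b.+1%:R) (d.+1%:R) => u v nu nv; field; rewrite nu nv.
Qed.

Lemma ratlV p : ratl p -> ratl p^-1.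
Proof.
move=> [a [b ->]]; case: a => [[|a]|a].
- by rewrite mul0r invr0; apply: (ratl_int 0).
- exists b.+1%:Z, a; rewrite -!pmulrn; move: (natrS_neq0 b) (natrS_neq0 a).
  by move: (b.+1%:R) (a.+1%:R) => u v nu nv; field; rewrite nu nv.
- exists (- b.+1%:Z), a; rewrite NegzE !mulrNz -!pmulrn.
  move: (natrS_neq0 b) (natrS_neq0 a).
  by move: (b.+1%:R) (a.+1%:R) => u v nu nv; field; rewrite ?oppr_eq0 nu nv.
Qed.

Lemma ratl1 : ratl 1. Proof. exact: (ratl_int 1). Qed.
Lemma ratl0 : ratl 0. Proof. exact: (ratl_int 0). Qed.

Lemma ratl_sqsum n (q : 'I_n -> K) :
  (forall i, ratl (q i)) -> \sum_i q i * q i = 0 -> forall i, q i = 0.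
Proof.
move=> rq q0.
have [a [b qE]] : exists (a : 'I_n -> int) (b : 'I_n -> nat),
    forall i, q i = (a i)%:~R / (b i).+1%:R.
  exists (fun i => sval (cid (rq i))), (fun i => sval (cid (svalP (cid (rq i))))).
  by move=> i; apply: svalP (cid (svalP (cid (rq i)))).
(* Denominators are cleared with the common factor [N]; a sum of squares of integers vanishes only
   if each of them does. *)
pose c i := a i * \prod_(j | j != i) (b j).+1%:Z.
pose N : K := \prod_j (b j).+1%:R.
have nz_N : N != 0 by apply/prodf_neq0 => j _; apply: natrS_neq0.
have cE i : (c i)%:~R = q i * N.
  rewrite qE /N (bigD1 i) //= mulrA divfK ?natrS_neq0 // /c intrM.
  by congr (_ * _); rewrite rmorph_prod.
have: \sum_i (c i) ^+ 2 == 0.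
  rewrite -intr_eq0_char0 rmorph_sum /=; apply/eqP.
  transitivity ((\sum_i q i * q i) * (N * N)); last by rewrite q0 mul0r.
  rewrite mulr_suml; apply: eq_bigr => i _.
  by rewrite rmorphXn /= cE; ring.
rewrite Num.Theory.psumr_eq0 => [/allP c0 i|i _]; last exact: Num.Theory.sqr_ge0.
have := c0 i (mem_index_enum i); rewrite sqrf_eq0 /= => /eqP ci.
by have := cE i; rewrite ci => /esym/eqP; rewrite mulf_eq0 (negPf nz_N) orbF => /eqP.
Qed.

Local Open Scope classical_set_scope.

(** By Zorn, a rational subspace [A] maximal among those avoiding [l0] is a complement of the
    rational line through [l0]; [F] is the coordinate along that line. *)
Lemma ex_rational_functional (l0 : K) : l0 != 0 -> exists F : K -> K,
  [/\ forall x, ratl (F x), forall x y, F (x + y) = F x + F y,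
      forall q x, ratl q -> F (q * x) = q * F x & F l0 = 1].
Proof.
move=> nz_l0.
pose closedQ (A : set K) := forall q x y, ratl q -> A x -> A y -> A (q * x + y).
have [|A [[cA nA] maxA]] := @Zorn_bigcup K [set A | closedQ A /\ ~ A l0].
  move=> F FP totF; split.
    move=> q x y rq [X FX Xx] [Y FY Yy].
    have [XY|YX] := totF X Y FX FY.
      by exists Y => //; apply: (FP Y FY).1 => //; apply: XY.
    by exists X => //; apply: (FP X FX).1 => //; apply: YX.
  by move=> [X FX Xl]; apply: (FP X FX).2.
have maxA' B : A `<=` B -> closedQ B -> ~ B l0 -> B `<=` A.
  move=> AB cB nB; apply: contrapT => nBA.
  by apply: (maxA B) => //; split.
(* The empty set passes [closedQ] too, so even the membership of 0 comes from maximality. *)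
have A0 : A 0.
  apply: (maxA' [set x | A x \/ x = 0]); [by left| | |by right].
    move=> q x y rq [Ax|->] [Ay|->].
    - by left; apply: cA.
    - left; have -> : q * x + 0 = (q - 1) * x + x by ring.
      by apply: cA => //; apply: ratlB => //; apply: ratl1.
    - by left; rewrite mulr0 add0r.
    - by right; rewrite mulr0 addr0.
  by case=> // e; rewrite e eqxx in nz_l0.
have AZ q x : ratl q -> A x -> A (q * x).
  by move=> rq Ax; rewrite -[q * x]addr0; apply: cA.
have AD x y : A x -> A y -> A (x + y).
  by move=> Ax Ay; rewrite -[x]mul1r; apply: cA => //; apply: ratl1.
have rN1 : ratl (-1) by rewrite -sub0r; apply: ratlB; [apply: ratl0|apply: ratl1].
have rD p q : ratl p -> ratl q -> ratl (p + q).
  move=> rp rq; rewrite -[q]opprK; apply: ratlB => //.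
  by rewrite -mulN1r; apply: ratlM.
have ex x : exists q, ratl q /\ A (x - q * l0).
  have [Ax|nAx] := pselect (A x).
    by exists 0; rewrite mul0r subr0; split=> //; apply: ratl0.
  pose B := [set y | exists a q, [/\ A a, ratl q & y = a + q * x]].
  have AB : A `<=` B.
    by move=> y Ay; exists y, 0; rewrite mul0r addr0; split=> //; apply: ratl0.
  have cB : closedQ B.
    move=> q _ _ rq [a [r [Aa rr ->]]] [b [t [Ab rt ->]]].
    exists (q * a + b), (q * r + t); split; [exact: cA| |ring].
    by apply: rD => //; apply: ratlM.
  have [[a [q [Aa rq e]]]|nBl] := pselect (B l0); last first.
    case: nAx; apply: (maxA' B) => //; exists 0, 1; rewrite add0r mul1r; split=> //.
    exact: ratl1.
  have nz_q : q != 0.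
    by apply/eqP => q0; apply: nA; rewrite e q0 mul0r addr0.
  exists q^-1; split; first exact: ratlV.
  have -> : x - q^-1 * l0 = (- q^-1) * a by rewrite e; field.
  by apply: AZ => //; rewrite -mulN1r; apply: ratlM => //; apply: ratlV.
pose F x := sval (cid (ex x)).
have FE x : ratl (F x) /\ A (x - F x * l0) := svalP (cid (ex x)).
have Funiq x q : ratl q -> A (x - q * l0) -> F x = q.
  move=> rq Aq; apply: contrapT => ne; have [rF AF] := FE x.
  have nz : q - F x != 0 by rewrite subr_eq0 eq_sym; apply/eqP.
  apply: nA; rewrite -[l0](mulKf nz); apply: (AZ (q - F x)^-1); first by apply/ratlV/ratlB.
  have -> : (q - F x) * l0 = x - F x * l0 + (-1) * (x - q * l0) by ring.
  by apply: AD => //; apply: AZ.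
exists F; split=> [x|x y|q x rq|]; first by have [] := FE x.
- have [[rx Ax] [ry Ay]] := (FE x, FE y); apply: Funiq; first exact: rD.
  have -> : x + y - (F x + F y) * l0 = x - F x * l0 + (y - F y * l0) by ring.
  exact: AD.
- have [rx Ax] := FE x; apply: Funiq; first exact: ratlM.
  have -> : q * x - q * F x * l0 = q * (x - F x * l0) by ring.
  exact: (AZ q).
by apply: Funiq; [apply: ratl1|rewrite mul1r subrr].
Qed.

End RationalFunctional.

(** * Derivations, Jordan components of ad x and Cartan's criterion *)

Section Derivations.
Variables (K : fieldType) (g : lieAlgType K).
Implicit Types (x y z : g) (D : 'End(g)).

Definition derivation D := forall y z, D [lie y, z] = [lie D y, z] + [lie y, D z].

Lemma lie_ad_derivation x : derivation (lie_ad x).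
Proof. by move=> y z; rewrite !lie_adE lie_jac. Qed.

Lemma derivation_adm D y : derivation D ->
  adm (D y) = adm y *m lfun_mx D - lfun_mx D *m adm y.
Proof.
move=> derD; apply: adm_eq => z.
rewrite mulmxBr !mulmxA -admE -(lfun_mxE D [lie y, z]) -(lfun_mxE D z) -admE derD.
by rewrite vrowD addrK.
Qed.

(** [D - (a + b)] acts on [[lie y, z]] as [D - a] on the first factor plus [D - b] on the second, so
    each application lowers one of the two exponents, and after [m + n] of them every term has lost
    a factor. *)
Lemma geigen_br D a b y z : derivation D ->
  geigen D a y -> geigen D b z -> geigen D (a + b) [lie y, z].
Proof.
move=> derD [m ym] [n zn]; exists (m + n)%N.
move: {2}(m + n)%N (leqnn (m + n)) => d.
suff H : forall d m n y z, (m + n <= d)%N ->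
    lhorner D (('X - a%:P) ^+ m) y = 0 -> lhorner D (('X - b%:P) ^+ n) z = 0 ->
    lhorner D (('X - (a + b)%:P) ^+ d) [lie y, z] = 0.
  by move=> _; apply: H ym zn.
move=> {d m n y z ym zn}; elim=> [|d IHd] m n y z le.
  move: le; rewrite leqn0 addn_eq0 => /andP[/eqP-> _].
  by rewrite !expr0 lhorner1 !id_lfunE => -> _; rewrite lie0l.
case: m le => [|m] le.
  by rewrite expr0 lhorner1 id_lfunE => -> _; rewrite lie0l linear0.
case: n le => [|n] le.
  by rewrite expr0 lhorner1 id_lfunE => _ ->; rewrite lie0r linear0.
rewrite !exprSr !lhornerM !comp_lfunE => ym zn.
have -> : lhorner D ('X - (a + b)%:P) [lie y, z] =
    [lie lhorner D ('X - a%:P) y, z] + [lie y, lhorner D ('X - b%:P) z].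
  rewrite !lhorner_XsubC derD lieBl lieBr lieZl lieZr scalerDl.
  by rewrite opprD addrACA.
rewrite linearD /= (IHd m n.+1) ?add0r ?exprSr ?lhornerM ?comp_lfunE //.
apply: (IHd m.+1 n) => //; first by rewrite -ltnS -addnS.
by rewrite exprSr lhornerM comp_lfunE.
Qed.

End Derivations.

Section AdJordan.
Variables (k : closedFieldType) (char_k : [pchar k] =i pred0).
Variable (g : lieAlgType k).
Implicit Types (x y z : g) (s U V W : {vspace g}).

(* For an additive F, the operator D acts as F a on the generalized eigenspace
   of ad x for a: the semisimple part of ad x when F is the identity. *)
Lemma ad_jordan x : exists a : 'I_(\dim {:g}) -> k,
  (ad_nilp x <-> forall i, a i = 0) /\
  forall F, (forall b c, F (b + c) = F b + F c) -> exists D : 'End(g),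
  [/\ derivation D,
      forall U W, (W <= U)%VS -> (forall y, y \in U -> [lie x, y] \in W) ->
        forall y, y \in U -> D y \in W,
      \tr (lfun_mx D *m adm x) = \sum_i F (a i) * a i &
      F =1 id -> diagonalizable (lfun_mx D) /\
        exists m, lfun_mx (lie_ad x - D) ^+ m = 0].
Proof.
pose s := <[x]>%VS; have xs : x \in s by apply: memv_line.
have ab y z : y \in s -> z \in s -> [lie y, z] = 0.
  move=> /vlineP[b ->] /vlineP[c ->].
  by rewrite lieZl lieZr lie_brxx !scaler0.
have cs : lie_closed s by move=> y z ys zs; rewrite ab ?mem0v.
have [chi [_ _ _ nil [trX ev]]] := lie_weights char_k cs (lie_solvable_abelian ab).
exists (chi^~ x); split; first exact: nil.
move=> F addF.
have F0 : F 0 = 0 by apply: (@addrI _ (F 0)); rewrite -addF !addr0.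
have [L [M [uL L0 M0 LM]]] := ex_primary (lie_ad x).
have [p [pL pa pdvd]] := ex_primary_fun uL LM F.
have p0 : p`_0 = 0 by rewrite -horner_coef0 pa.
have aL i : chi i x \in L.
  have [y nz_y xy] := ev x i xs; apply: contraNT nz_y => naL.
  apply/eqP/(geigen_notin LM naL)/geigen_eigen.
  by rewrite lie_adE.
exists (lhorner (lie_ad x) p).
have DE a v : geigen (lie_ad x) a v -> lhorner (lie_ad x) p v = F a *: v.
  move=> av; have [aL'|naL] := boolP (a \in L); first exact: pL.
  by rewrite (geigen_notin LM naL av) linear0 scaler0.
split.
- move=> y z.
  have [w [-> wa]] := primary_decomp uL LM y.
  have [w' [-> w'a]] := primary_decomp uL LM z.
  have sumD (v : k -> g) : (forall a, a \in L -> geigen (lie_ad x) a (v a)) ->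
      lhorner (lie_ad x) p (\sum_(a <- L) v a) = \sum_(a <- L) F a *: v a.
    move=> va; rewrite linear_sum /= big_seq [RHS]big_seq.
    by apply: eq_bigr => a La; apply/DE/va.
  rewrite (sumD w wa) (sumD w' w'a) !lie_suml linear_sum -big_split /=.
  rewrite big_seq [RHS]big_seq; apply: eq_bigr => a La.
  rewrite lieZl !lie_sumr scaler_sumr -big_split linear_sum /=.
  rewrite big_seq [RHS]big_seq; apply: eq_bigr => b Lb.
  rewrite lieZr -scalerDl -addF; apply: DE.
  by apply: geigen_br; [apply: lie_ad_derivation|apply: wa|apply: w'a].
- move=> U W WU UW y yU; apply: (lhorner_stable0 p0 WU) => // z zU.
  by rewrite lie_adE UW.
- rewrite lhorner_mx mulmx_suml linear_sum /=.
  transitivity (\sum_(j < size p) \sum_i p`_j * chi i x ^+ j.+1).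
    apply: eq_bigr => j _; rewrite -scalemxAl linearZ /= -mulr_sumr -trX //.
    by rewrite exprSr.
  rewrite exchange_big; apply: eq_bigr => i _.
  rewrite -pa // horner_coef mulr_suml; apply: eq_bigr => j _.
  by rewrite exprSr mulrA.
move=> Fid; split.
  apply/diagonalizablePeigen; exists L => //.
  apply/eqmxP; rewrite submx1 /=; apply/row_subP => i; rewrite rowE mulmx1.
  rewrite -[delta_mx 0 i]vvecK.
  have [w [-> wa]] := primary_decomp uL LM (vvec (delta_mx 0 i)).
  have -> : vrow (\sum_(a <- L) w a) = \sum_(a <- L) vrow (w a).
    by apply: (big_morph (@vrow _ _)); [apply: vrowD|apply: vrow0].
  rewrite big_seq; apply: summx_sub => a La.
  apply: (@submx_trans _ _ _ _ _ _ (eigenspace (lfun_mx (lhorner (lie_ad x) p)) a)).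
    by apply/eigenspaceP; rewrite -lfun_mxE (DE a _ (wa a La)) vrowZ Fid.
  by rewrite (big_rem a) //= addsmxSl.
exists M; have -> : lie_ad x - lhorner (lie_ad x) p = lhorner (lie_ad x) ('X - p).
  by rewrite lhornerB lhornerX.
rewrite -lpow_mx -lhornerXn; apply: lfun_mx_eq => y; rewrite mulmx0.
rewrite (lhorner_primary LM) ?vrow0 //.
(* For [F = id] the polynomial ['X - p] vanishes at every [a] in [L], so its [M]-th power is a
   multiple of the annihilating polynomial. *)
apply: primary_dvd => // a La; apply: dvdp_exp2r.
have -> : 'X - p = ('X - a%:P) - (p - (F a)%:P) by rewrite Fid; ring.
rewrite dvdp_addr ?dvdpp // dvdpNr; apply: dvdp_trans (pdvd a La).
by rewrite -{1}['X - _]expr1 dvdp_exp2l.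
Qed.

(** Let [D] multiply the generalized eigenspaces of [ad x] by a rational valued additive [F]. The
    trace of [D] against ad [y, z] is [killing (D y) z], which is 0 because [D] maps [p] into its
    derived algebra. Hence the sum of the [F (a i) * a i] is 0, and applying [F] leaves a vanishing
    sum of rational squares. *)
Lemma cartan_nilp p x : lie_closed p ->
  (forall y z, y \in lie_brv p p -> z \in p -> killing y z = 0) ->
  x \in lie_brv p p -> ad_nilp x.
Proof.
move=> cp kp0 xp; have [a [nil DF]] := ad_jordan x; apply/nil => i.
have sp : (lie_brv p p <= p)%VS by apply/lie_closedP.
apply/eqP; apply: contrapT => /negP nz_ai.
have [F [ratF addF linF Fai]] := ex_rational_functional char_k nz_ai.
have [D [derD stD trD _]] := DF F addF.
have F0 : F 0 = 0 by apply: (@addrI _ (F 0)); rewrite -addF !addr0.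
have tr0 : forall y, y \in lie_brv p p -> \tr (lfun_mx D *m adm y) = 0.
  apply: lie_brv_ind => [|b y z IHy IHz|y z yp zp].
  - by rewrite adm0 mulmx0 linear0.
  - by rewrite adm_lin mulmxDr -scalemxAr linearD linearZ /= IHy IHz mulr0 addr0.
  have := kp0 (D y) z (stD p _ sp _ y yp) zp.
  rewrite /killing (derivation_adm y derD) => <- => [|u up]; last first.
    by apply: mem_lie_brv => //; apply: (subvP sp).
  rewrite adm_br mulmxBr mulmxBl !mxtraceB; congr (_ - _).
    by rewrite mulmxA mxtrace_mulC mulmxA.
  by rewrite mulmxA.
have := trD; rewrite tr0 // => /(congr1 F); rewrite F0.
have -> : F (\sum_j F (a j) * a j) = \sum_j F (a j) * F (a j).
  rewrite (big_morph F addF F0); apply: eq_bigr => j _; exact: linF.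
move=> /esym/(ratl_sqsum char_k (fun j => ratF (a j)))/(_ i).
by rewrite Fai => /eqP; rewrite oner_eq0.
Qed.

Lemma cartan_solvable p : lie_closed p ->
  (forall y z, y \in lie_brv p p -> z \in p -> killing y z = 0) ->
  lie_solvable p.
Proof.
move=> cp kp0; apply: (lie_solvable_brv (subvv _)).
apply: lie_solvable_nil; first exact: lie_brv_closed.
by move=> x /(cartan_nilp cp kp0)[m xm]; exists m => y _; apply: xm.
Qed.

(** The kernel of the form is an ideal, and Cartan's criterion makes it solvable. *)
Lemma killing_nondeg x : lie_semisimple g -> (forall y, killing x y = 0) -> x = 0.
Proof.
move=> ssg x0.
have [|a y z y0 z0 t|S SP] := @vspace_of_pred _ g (fun x => forall y, killing x y = 0).
- exact: killing0l.
- by rewrite killingDl killingZl y0 z0 mulr0 addr0.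
have idS : lie_ideal S.
  move=> y z /SP z0; apply/SP => t.
  by rewrite lie_antisym killingNl killing_inv z0 oppr0.
have cS : lie_closed S by move=> y z _; apply: idS.
have S0 : S = 0%VS.
  apply: ssg => //; apply: cartan_solvable => // y z.
  by move/lie_closedP: cS => /subvP sS /sS/SP.
by apply/eqP; rewrite -memv0 -S0; apply/SP.
Qed.

End AdJordan.

Lemma linfunE_of (K : fieldType) (V W : vectType K) (f : V -> W) :
  linear f -> linfun f =1 f.
Proof.
move=> lf; pose F : {linear V -> W} :=
  HB.pack f (GRing.isLinear.Build K V W *:%R f lf).
exact: (lfunE F).
Qed.

(** * Toral subalgebras *)

Section Diagonalizable.
Variables (K : fieldType) (n : nat).
Implicit Types (A B : 'M[K]_n).

Lemma diagonalizable_conjP A : diagonalizable A <->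
  exists P d, P \in unitmx /\ P *m A = diag_mx d *m P.
Proof.
split=> [[P uP /diagonalizable_forPex[d /(simmxPp _)]]|[P [d [uP e]]]].
  move=> H; exists P, d; split=> //.
  by apply: H; rewrite submx_full // row_full_unit.
exists P => //; apply/(diagonalizable_forP _ uP) => i j ij.
by rewrite e mulmxK // mxE -[i == j]/(val i == val j) (negPf ij).
Qed.

Lemma diagonalizable_pair A B a : comm_mx A B ->
  diagonalizable A -> diagonalizable B -> diagonalizable (A + a *: B).
Proof.
move=> cAB dA dB.
have [|P uP] := (codiagonalizableP [:: A; B]).1.
  split=> [X Y|X]; rewrite !inE; last by move=> /orP[] /eqP->.
  by move=> /orP[] /eqP-> /orP[] /eqP->; rewrite ?/comm_mx.
rewrite /= andbT => /andP[PA PB]; exists P => //.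
apply/(diagonalizable_forP _ uP) => i j ij.
rewrite mulmxDr mulmxDl -scalemxAr -scalemxAl mxE [X in _ + X]mxE.
move/(diagonalizable_forP _ uP)/(_ i j ij): PA => ->.
move/(diagonalizable_forP _ uP)/(_ i j ij): PB => ->.
by rewrite mulr0 addr0.
Qed.

Lemma diagonalizable_ker A m (v : 'rV_n) : diagonalizable A ->
  v *m A ^+ m = 0 -> v *m A = 0.
Proof.
move=> /diagonalizable_conjP[P [d [uP PA]]].
have PX : P *m A ^+ m = diag_mx d ^+ m *m P.
  elim: m => [|m IHm]; first by rewrite !expr0 mulmx1 mul1mx.
  by rewrite !exprSr -![_ ^+ m * _]/(_ *m _) mulmxA IHm -mulmxA PA mulmxA.
have dX : forall m, diag_mx d ^+ m = diag_mx (\row_i d 0 i ^+ m).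
  elim=> [|m' IHm]; first by apply/matrixP => i j; rewrite !mxE; case: eqP.
  rewrite exprSr IHm; apply/matrixP => i j.
  rewrite -[_ * _]/(_ *m _) mul_mx_diag !mxE exprSr.
  by case: eqVneq => [->|_]; rewrite ?mulr1n // !mulr0n mul0r.
rewrite -(mulmxKV uP v); set w := v *m invmx P.
rewrite -!mulmxA PX PA dX !mulmxA => e0.
have /rowP w0 : w *m diag_mx (\row_i d 0 i ^+ m) = 0.
  by apply: (can_inj (mulmxK uP)); rewrite e0 mul0mx.
suff -> : w *m diag_mx d = 0 by rewrite mul0mx.
apply/rowP => i; have := w0 i; rewrite !mul_mx_diag !mxE => /eqP.
rewrite mulf_eq0 expf_eq0 => /orP[/eqP->|/andP[_ /eqP->]].
  by rewrite mul0r.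
by rewrite mulr0.
Qed.

End Diagonalizable.

Section Toral.
Variables (K : fieldType) (g : lieAlgType K).
Implicit Types (x y z t : g) (U W T C h : {vspace g}).

Lemma ad_diag_iter x m y : diagonalizable (adm x) ->
  iter m (lie_br x) y = 0 -> [lie x, y] = 0.
Proof.
move=> dx xm; apply/eqP; rewrite -vrow_eq0 admE.
by apply/eqP/(diagonalizable_ker (m := m) dx); rewrite -iter_adm xm vrow0.
Qed.

Lemma adm_comm x y : [lie x, y] = 0 -> comm_mx (adm x) (adm y).
Proof.
move=> xy; have := adm_br x y; rewrite xy adm0 => /esym/subr0_eq e.
by rewrite /comm_mx e.
Qed.

Definition toral T := (forall x y, x \in T -> y \in T -> [lie x, y] = 0) /\
  forall x, x \in T -> diagonalizable (adm x).

(** The shape in which Cartan subalgebras are used: [cartan_split] brings the nilpotent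
    self-normalizing ones into it, and [max_toral_split] produces it from maximal toral
    subalgebras. *)
Definition split_cartan h := toral h /\
  forall x, (forall t, t \in h -> [lie t, x] = 0) -> x \in h.

Lemma toral0 : toral 0%VS.
Proof.
split=> [x y|x]; rewrite !memv0 => /eqP-> //; first by rewrite lie0l.
by rewrite adm0; apply: diagonalizable0.
Qed.

Lemma toral_add T x : toral T -> diagonalizable (adm x) ->
  (forall t, t \in T -> [lie x, t] = 0) -> toral (T + <[x]>)%VS.
Proof.
move=> [abT dT] dx xT; split=> [y z|y] /memv_addline[t [a [tT ->]]].
  move=> /memv_addline[s [b [sT ->]]].
  rewrite !(lieDl, lieDr, lieZl, lieZr) abT // lie_brxx xT //.
  by rewrite lie_antisym xT // !(oppr0, scaler0, addr0).
rewrite admD admZ; apply: diagonalizable_pair => //; last exact: dT.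
by apply: adm_comm; rewrite lie_antisym xT ?oppr0.
Qed.

Lemma toral_closed T : toral T -> lie_closed T.
Proof. by move=> [abT _] x y xT yT; rewrite abT ?mem0v. Qed.

Lemma toral_solvable T : toral T -> lie_solvable T.
Proof. by move=> [abT _]; apply: lie_solvable_abelian. Qed.

Lemma toral_weights T : toral T ->
  exists (w : (\dim {:g}).-tuple g) (mu : 'I_(\dim {:g}) -> g -> K),
    basis_of {:g} w /\
    forall t (i : 'I__), t \in T -> [lie t, w`_i] = mu i t *: w`_i.
Proof.
move=> [abT dT].
have [|P uP /allP PT] := (codiagonalizableP (map (@adm K g) (vbasis T))).1.
  split=> [_ _ /mapP[x xT ->] /mapP[y yT ->]|_ /mapP[x xT ->]].
    by apply: adm_comm; apply: abT; apply: vbasis_mem.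
  by apply: dT; apply: vbasis_mem.
pose w := [tuple vvec (row i P) | i < \dim {:g}].
have wE (i : 'I_(\dim {:g})) : w`_i = vvec (row i P).
  by rewrite (nth_map i) ?size_tuple // nth_ord_enum.
have Tdiag t : t \in T -> forall i j : 'I_(\dim {:g}), i != j ->
    (P *m adm t *m invmx P) i j = 0.
  move=> tT i j ij.
  have: t \in <<vbasis T>>%VS by rewrite (span_basis (vbasisP T)).
  move: t {tT}; apply: span_ind => [|a x y IHx IHy|x xT].
  - by rewrite adm0 mulmx0 mul0mx mxE.
  - rewrite adm_lin mulmxDr mulmxDl -scalemxAr -scalemxAl mxE [X in X + _]mxE.
    by rewrite IHx IHy mulr0 addr0.
  have /(_ (adm x)) := PT; move/(_ (map_f _ xT)) => /=.
  by move/(diagonalizable_forP _ uP); apply.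
exists w, (fun i t => (P *m adm t *m invmx P) i i); split; last first.
  move=> t i tT; rewrite wE; apply: (can_inj (@vrowK _ _)).
  rewrite admE vrowZ !vvecK -row_mul.
  have -> : P *m adm t = (P *m adm t *m invmx P) *m P by rewrite mulmxKV.
  rewrite row_mul mulmxK //; move: (Tdiag t tT).
  move: (P *m adm t *m invmx P) => X Xd.
  apply/rowP => j; rewrite mxE (bigD1 i) //= big1 ?addr0; last first.
    by move=> l li; rewrite mxE Xd ?mul0r // eq_sym.
  by rewrite !mxE.
rewrite basisEdim size_tuple leqnn andbT.
apply/subvP => x _; rewrite -[x]vrowK -(mulmxKV uP (vrow x)).
set r := _ *m invmx P.
have -> : r *m P = \sum_i r 0 i *: row i P by rewrite mulmx_sum_row.
rewrite /vvec linear_sum; apply: rpred_sum => i _; rewrite linearZ rpredZ //.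
apply/memv_span/tnthP; exists i.
by rewrite (tnth_nth 0) wE.
Qed.

End Toral.

(** * Semisimple algebras: duality, Jordan decomposition and Cartan subalgebras *)

Section Semisimple.
Variables (k : closedFieldType) (char_k : [pchar k] =i pred0).
Variables (g : lieAlgType k) (ssg : lie_semisimple g).
Implicit Types (x y z t : g) (U W T C h : {vspace g}).

Lemma korth_ex U : exists W, forall x, x \in W <-> forall y, y \in U -> killing x y = 0.
Proof.
apply: vspace_of_pred => [y _|a x y x0 y0 z zU]; first exact: killing0l.
by rewrite killingDl killingZl x0 // y0 // mulr0 addr0.
Qed.

Definition korth U := sval (cid (korth_ex U)).
Lemma korthP U x : x \in korth U <-> forall y, y \in U -> killing x y = 0.
Proof. exact: (svalP (cid (korth_ex U))). Qed.

Lemma killing_prescribed U (r : 'rV[k]_(\dim U)) :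
  exists x, forall i : 'I_(\dim U), killing x (vbasis U)`_i = r 0 i.
Proof.
pose M : 'M[k]_(\dim U, \dim {:g}) :=
  \matrix_(i, j) killing (vbasis U)`_i (vbasis {:g})`_j.
have fM : row_free M.
  apply: inj_row_free => v vM.
  have e : \sum_i v 0 i *: (vbasis U)`_i = 0.
    apply: (killing_nondeg char_k ssg) => y.
    have [c ->] : exists c : 'I_(\dim {:g}) -> k, y = \sum_j c j *: (vbasis {:g})`_j.
      by exists (fun j => coord (vbasis {:g}) j y); apply: coord_vbasis; rewrite memvf.
    rewrite killingC killing_suml big1 // => j _; rewrite killingZl.
    have /rowP/(_ j) := vM; rewrite !mxE => vMj.
    rewrite killingC killing_suml (eq_bigr (fun i => v 0 i * M i j)).
      by rewrite vMj mulr0.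
    by move=> i _; rewrite killingZl mxE.
  have /freeP fU := basis_free (vbasisP U).
  by apply/rowP => i; rewrite mxE; apply: (fU (v 0)).
have /submxP[y e] : (r <= M^T)%MS.
  by rewrite submx_full // /row_full mxrank_tr; move: fM; rewrite /row_free.
exists (vvec y) => i; rewrite e mxE /vvec /vecof killing_suml.
by apply: eq_bigr => j _; rewrite killingZl !mxE killingC.
Qed.

Lemma dim_korth U : (\dim U + \dim (korth U))%N = \dim {:g}.
Proof.
pose f x : 'rV[k]_(\dim U) := \row_i killing x (vbasis U)`_i.
have lf : linear f.
  by move=> a x y; apply/rowP => i; rewrite !mxE killingDl killingZl.
pose F := linfun f.
have kF : lker F = korth U.
  apply/vspaceP => x; rewrite memv_ker (linfunE_of lf); apply/eqP/idP.
    move=> /rowP fx; apply/korthP => y /coord_vbasis->.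
    rewrite killingC killing_suml big1 // => i _; rewrite killingZl killingC.
    by have := fx i; rewrite !mxE => ->; rewrite mulr0.
  by move=> /korthP xU; apply/rowP => i; rewrite !mxE xU ?vbasis_mem ?mem_nth ?size_tuple.
have iF : limg F = fullv.
  apply/vspaceP => r; rewrite memvf; have [x xr] := killing_prescribed r.
  apply/memv_imgP; exists x; first exact: memvf.
  by rewrite (linfunE_of lf); apply/rowP => i; rewrite mxE xr.
have := limg_ker_dim F fullv; rewrite capfv kF iF dimvf addnC => <-.
by congr (_ + _)%N; rewrite dim_matrix mul1r.
Qed.

Lemma killing_dual (phi : g -> k) : (forall a x y, phi (a *: x + y) = a * phi x + phi y) ->
  exists x, forall y, killing x y = phi y.
Proof.
move=> lphi.
have phi0 : phi 0 = 0.
  by have := lphi (-1) 0 0; rewrite scaler0 addr0 mulN1r addNr.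
have [x xP] := killing_prescribed (\row_(i < \dim {:g}) phi (vbasis {:g})`_i).
exists x => y; rewrite (coord_vbasis (memvf y)).
rewrite killingC killing_suml.
have -> : phi (\sum_i coord (vbasis {:g}) i y *: (vbasis {:g})`_i) =
    \sum_i coord (vbasis {:g}) i y * phi (vbasis {:g})`_i.
  elim/big_rec2: _ => [//|i a z _ <-]; exact: lphi.
by apply: eq_bigr => i _; rewrite killingZl killingC xP mxE.
Qed.

(** Nondegeneracy gives an [x] whose trace form agrees with that of [D]. The derivation
    [E = D - ad x] then has zero trace against every [ad z], and [killing (E y) z] is the trace of
    [E] against [ad [lie y, z]]. *)
Lemma derivation_inner (D : 'End(g)) : derivation D ->
  exists x, forall y, D y = [lie x, y].
Proof.
move=> derD.
have [|x xP] := @killing_dual (fun y => \tr (lfun_mx D *m adm y)).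
  by move=> a y z; rewrite adm_lin mulmxDr -scalemxAr linearD linearZ.
exists x => y.
pose E := D - lie_ad x.
have derE : derivation E.
  move=> u v; rewrite !add_lfunE !opp_lfunE derD lie_ad_derivation lieDl lieDr.
  by rewrite lieNl lieNr opprD addrACA.
have E0 z : \tr (lfun_mx E *m adm z) = 0.
  have -> : lfun_mx E = lfun_mx D - adm x.
    by rewrite /E -scaleN1r lfun_mxD lfun_mxZ scaleN1r.
  by rewrite mulmxBl linearB /= -xP /killing subrr.
have: E y = 0.
  apply: (killing_nondeg char_k ssg) => z.
  rewrite /killing (derivation_adm y derE) -[RHS](E0 [lie y, z]) adm_br.
  rewrite mulmxBr mulmxBl !mxtraceB; congr (_ - _).
    by rewrite [in RHS]mulmxA [RHS]mxtrace_mulC [in RHS]mulmxA.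
  by rewrite mulmxA.
by rewrite add_lfunE opp_lfunE lie_adE => /subr0_eq.
Qed.

(** What is retained of the fact that [ad z] is a polynomial in [ad x] without constant term: enough
    to keep [z] in a Borel subalgebra, a normalizer or a centralizer along with [x]. *)
Definition ad_follows x z := forall U W, (W <= U)%VS ->
  (forall y, y \in U -> [lie x, y] \in W) ->
  forall y, y \in U -> [lie z, y] \in W.

Lemma lie_jordan x : exists a : 'I_(\dim {:g}) -> k,
  (ad_nilp x <-> forall i, a i = 0) /\
  forall F, (forall b c, F (b + c) = F b + F c) -> exists z : g,
  [/\ ad_follows x z, killing z x = \sum_i F (a i) * a i &
      F =1 id -> diagonalizable (adm z) /\ ad_nilp (x - z)].
Proof.
have [a [nil DF]] := ad_jordan char_k x; exists a; split=> // F /DF.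
move=> [D [derD stD trD idD]]; have [z Dz] := derivation_inner derD.
have Dz' : D = lie_ad z by apply/lfunP => y; rewrite lie_adE.
exists z; split; last 2 first.
- by rewrite -trD Dz'.
- move=> /idD[dD nD]; rewrite Dz' in dD nD; split=> //.
  apply/ad_nilpP; case: nD => m nD; exists m; rewrite -nD; congr (_ ^+ m).
  by rewrite -scaleN1r admD admZ lfun_mxD -[- lie_ad z]scaleN1r lfun_mxZ.
by move=> U W WU xU y yU; rewrite -Dz; apply: (stD U W).
Qed.

Lemma lie_jordan_ss x : exists z,
  [/\ ad_follows x z, diagonalizable (adm z) & ad_nilp (x - z)].
Proof.
have [a [_ /(_ id)]] := lie_jordan x.
by case=> // z [fz _ /(_ (frefl _))[dz nz]]; exists z.
Qed.

(** The rational functional argument of [cartan_nilp], with the operators [D] realised as [ad z] by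
    elements of [g]. *)
Lemma ad_nilp_crit x : (forall z, ad_follows x z -> killing z x = 0) -> ad_nilp x.
Proof.
move=> xz; have [a [nil zF]] := lie_jordan x; apply/nil => i.
apply/eqP; apply: contrapT => /negP nz_ai.
have [F [ratF addF linF Fai]] := ex_rational_functional char_k nz_ai.
have F0 : F 0 = 0 by apply: (@addrI _ (F 0)); rewrite -addF !addr0.
have [z [fz kz _]] := zF F addF.
have := kz; rewrite xz // => /(congr1 F); rewrite F0.
have -> : F (\sum_j F (a j) * a j) = \sum_j F (a j) * F (a j).
  rewrite (big_morph F addF F0); apply: eq_bigr => j _; exact: linF.
move=> /esym/(ratl_sqsum char_k (fun j => ratF (a j)))/(_ i).
by rewrite Fai => /eqP; rewrite oner_eq0.
Qed.

Lemma ad_diag_nilp0 x : diagonalizable (adm x) -> ad_nilp x -> x = 0.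
Proof.
move=> dx [m xm]; apply: (killing_nondeg char_k ssg) => y.
rewrite /killing; have -> : adm x = 0; last by rewrite mul0mx linear0.
by apply: adm_eq => z; rewrite mulmx0 (ad_diag_iter dx (xm z)) vrow0.
Qed.

(** The nilpotent part [x - t] of an element of [C] is Killing-orthogonal to [C], its weights on the
    solvable [C] being 0, and to every weight vector of [T] outside [C], whose weight is not 0. As
    the weight vectors of [T] span [g], it vanishes. *)
Lemma toral_self_centralizing T C : toral T ->
  (forall x, x \in C <-> forall t, t \in T -> [lie t, x] = 0) ->
  lie_solvable C ->
  (forall x, x \in C -> exists2 t, t \in T & ad_nilp (x - t)) -> C = T.
Proof.
move=> torT CP solC nilC.
have TC : (T <= C)%VS.
  by apply/subvP => t tT; apply/CP => u uT; apply: torT.1.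
have cC : lie_closed C.
  move=> x y /CP xT /CP yT; apply/CP => t tT.
  by rewrite lie_jac (xT t tT) (yT t tT) lie0l lie0r addr0.
have [chi [_ _ kchi nchi _]] := lie_weights char_k cC solC.
have [w [mu [bw wmu]]] := toral_weights torT.
apply/eqP; rewrite eqEsubv TC andbT; apply/subvP => x xC.
have [t tT nxt] := nilC x xC; have tC := subvP TC t tT.
have xtC : x - t \in C by rewrite rpredB.
suff /subr0_eq-> : x - t = 0 by [].
apply: (killing_nondeg char_k ssg) => y.
rewrite (coord_basis bw (memvf y)) killingC killing_suml big1 // => i _.
rewrite killingZl; have [wC|nwC] := pselect (w`_i \in C).
  rewrite kchi // big1 ?mulr0 // => j _.
  by have -> := (nchi _ xtC).1 nxt j; rewrite mulr0.
have [u uT nz_u] : exists2 u, u \in T & mu i u != 0.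
  apply: contrapT => none; apply: nwC; apply/CP => u uT; rewrite wmu //.
  have -> : mu i u = 0; last by rewrite scale0r.
  by apply/eqP; apply: contrapT => /negP nz; apply: none; exists u.
have /CP/(_ u uT) ux := xtC.
have : mu i u * killing w`_i (x - t) = 0.
  rewrite -killingZl -wmu // lie_antisym killingNl killing_inv ux.
  by rewrite killing0r oppr0.
by move/eqP; rewrite mulf_eq0 (negPf nz_u) /= => /eqP->; rewrite mulr0.
Qed.

Lemma centralizer_ex T :
  exists C, forall x, x \in C <-> forall t, t \in T -> [lie t, x] = 0.
Proof.
apply: vspace_of_pred => [t _|a x y x0 y0 t tT]; first exact: lie0r.
by rewrite lieDr lieZr x0 // y0 // scaler0 addr0.
Qed.

Lemma iter_lie_central C x z m y :
  (forall u, u \in C -> [lie z, u] = 0) -> (forall u, u \in C -> [lie x, u] \in C) ->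
  y \in C -> iter m (lie_br x) y = iter m (lie_br (x - z)) y.
Proof.
move=> zC xC yC; elim: m => //= m <-.
by rewrite lieBl (zC (iter m _ y)) ?subr0 // iter_lie_mem.
Qed.

(** The semisimple part of an element centralizing [T] commutes with [T], so maximality puts it in
    [T]. Hence the centralizer acts nilpotently on itself, which makes it solvable, and
    [toral_self_centralizing] applies. *)
Lemma max_toral_split T : toral T ->
  (forall T', toral T' -> (T <= T')%VS -> T' = T) -> split_cartan T.
Proof.
move=> torT maxT; have [C CP] := centralizer_ex T.
have cC x y : x \in C -> y \in C -> [lie x, y] \in C.
  move=> /CP xT /CP yT; apply/CP => t tT.
  by rewrite lie_jac (xT t tT) (yT t tT) lie0l lie0r addr0.
have nilC x : x \in C -> exists2 t, t \in T & ad_nilp (x - t).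
  move=> xC; have [z [fz dz nz]] := lie_jordan_ss x; exists z => //.
  have zT t : t \in T -> [lie z, t] = 0.
    move=> tT; apply/eqP; rewrite -memv0; apply: (fz T) tT; first exact: sub0v.
    by move=> u uT; rewrite memv0 lie_antisym oppr_eq0; move/CP: xC => ->.
  by rewrite -(maxT _ (toral_add torT dz zT)) ?addvSl // memvE addvSr.
split=> // x /CP; rewrite (toral_self_centralizing torT CP) //.
apply: lie_solvable_nil => // u uC; have [t tT [m um]] := nilC u uC.
exists m => y yC; rewrite (@iter_lie_central C _ t) // => [v|v]; last exact: cC.
by move/CP; apply.
Qed.

(** [T] collects the ad-diagonalizable elements of [h], which are central in [h] because [h] is
    nilpotent; it contains the semisimple parts of elements of [h], as these normalize [h]. If the
    centralizer [C] of [T] were larger than [h], Engel modulo [h] would give a vector outside [h]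
    normalizing [h]. *)
Lemma cartan_split (h : lieSubalg g) : cartan_subalgebra h -> split_cartan h.
Proof.
move=> [nilh normh].
have ch : lie_closed h by apply: lsub_closed.
have nh x : x \in (h : {vspace g}) ->
    exists m, forall y, y \in (h : {vspace g}) -> iter m (lie_br x) y = 0.
  exact: lie_nilpotent_ad.
have dcent x : x \in (h : {vspace g}) -> diagonalizable (adm x) ->
    forall y, y \in (h : {vspace g}) -> [lie x, y] = 0.
  by move=> /nh[m xm] dx y yh; apply: (ad_diag_iter (m := m) dx); apply: xm.
have [|a x y [xh dx] [yh dy]|T TP] := @vspace_of_pred _ g
    (fun x => x \in (h : {vspace g}) /\ diagonalizable (adm x)).
- by rewrite mem0v adm0; split=> //; apply: diagonalizable0.
- split; first by rewrite rpredD // rpredZ.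
  rewrite addrC admD admZ.
  by apply: diagonalizable_pair => //; apply: adm_comm; apply: dcent.
have Th : (T <= h)%VS by apply/subvP => x /TP[].
have torT : toral T.
  split=> [x y /TP[xh dx] /TP[yh _]|x /TP[] //]; exact: dcent.
have hT x : x \in (h : {vspace g}) -> exists2 t, t \in T & ad_nilp (x - t).
  move=> xh; have [z [fz dz nz]] := lie_jordan_ss x; exists z => //.
  apply/TP; split=> //; apply: normh => y yh.
  by apply: (fz h h) => // u uh; apply: ch.
have [C CP] := centralizer_ex T.
have hC : (h <= C)%VS.
  by apply/subvP => x xh; apply/CP => t /TP[th dt]; apply: dcent.
have stC x y : x \in (h : {vspace g}) -> y \in C -> [lie x, y] \in C.
  move=> /(subvP hC)/CP xT /CP yT; apply/CP => t tT.
  by rewrite lie_jac (xT t tT) (yT t tT) lie0l lie0r addr0.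
have eC : C = h.
  apply: contrapT => ne.
  have [|||||v [vC /negP nvh hv]] // := @engel _ g h C h ch hC.
  - by move=> e; apply: ne.
  - move=> x xh; have [t tT [m um]] := hT x xh; exists m => y yC.
    rewrite (@iter_lie_central C _ t) ?um ?mem0v // => u; last exact: stC.
    by move/CP; apply.
  apply: nvh; apply: normh => y yh.
  by rewrite lie_antisym rpredN hv.
have solC : lie_solvable C by rewrite eC; apply: lie_solvable_nil.
have hE : (h : {vspace g}) = T.
  rewrite -eC; apply: (toral_self_centralizing torT CP) => // x.
  by rewrite eC; apply: hT.
by rewrite hE; split=> // x /CP; rewrite eC hE.
Qed.

End Semisimple.

Lemma vrow_inj (K : fieldType) (V : vectType K) (x y : V) :
  (forall i, vrow x 0 i = vrow y 0 i) -> x = y.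
Proof. by move=> e; apply: (can_inj (@vrowK _ _)); apply/rowP. Qed.

Lemma vrowN (K : fieldType) (V : vectType K) (x : V) : vrow (- x) = - vrow x.
Proof. by rewrite -scaleN1r vrowZ scaleN1r. Qed.

(** Vector identities are reduced to [ring] in each coordinate. *)
Ltac vring := apply: vrow_inj => ?;
  rewrite ?(vrowD, vrowN, vrowZ, vrow0);
  repeat (rewrite [fun_of_matrix (GRing.add _ _) _ _]mxE ||
          rewrite [fun_of_matrix (GRing.opp _) _ _]mxE ||
          rewrite [fun_of_matrix (GRing.scale _ _) _ _]mxE ||
          rewrite [fun_of_matrix 0 _ _]mxE); ring.

(** * Borel subalgebras *)

Section ToralEigen.
Variables (K : fieldType) (g : lieAlgType K).
Implicit Types (x y z t : g) (U V W T C h : {vspace g}).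

(** Induction on the number of nonzero weight coordinates of [x]. If two of their weights differ at
    some [t], then [x] is a combination of two vectors of [V], each obtained by killing one of these
    coordinates; otherwise [x] is an eigenvector. *)
Lemma toral_eigen_ind T V (P : g -> Prop) : toral T ->
  (forall t x, t \in T -> x \in V -> [lie t, x] \in V) ->
  P 0 -> (forall a x y, P x -> P y -> P (a *: x + y)) ->
  (forall x (mu : g -> K), x \in V ->
    (forall t, t \in T -> [lie t, x] = mu t *: x) -> P x) ->
  forall x, x \in V -> P x.
Proof.
move=> torT TV P0 Plin Peig x.
have [w [mu [bw wmu]]] := toral_weights torT.
pose c i x := coord w i x.
have cx x' : x' = \sum_i c i x' *: w`_i by apply: coord_basis bw _; apply: memvf.
have ct t x' i : t \in T -> c i [lie t, x'] = mu i t * c i x'.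
  move=> tT; rewrite [x' in LHS]cx lie_sumr.
  rewrite (eq_bigr (fun j => (c j x' * mu j t) *: w`_j)) => [|j _].
    by rewrite /c coord_sum_free ?(basis_free bw) // mulrC.
  by rewrite lieZr wmu // scalerA.
pose S x' := [set i | c i x' != 0].
move: {2}(#|S x|) (leqnn #|S x|) => n; elim: n x => [|n IHn] x Sx xV.
  have -> : x = 0; last exact: P0.
  rewrite (cx x) big1 // => i _; move: Sx; rewrite leqn0 cards_eq0 => /eqP S0.
  have : i \notin S x by rewrite S0 inE.
  by rewrite inE negbK => /eqP->; rewrite scale0r.
have [[i [j [t [tT Si Sj ne]]]]|none] := pselect (exists i j t,
    [/\ t \in T, i \in S x, j \in S x & mu i t != mu j t]).
  have red l : l \in S x -> P ([lie t, x] - mu l t *: x).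
    move=> Sl; apply: IHn; last by rewrite rpredB ?rpredZ ?TV.
    rewrite -ltnS; apply: leq_trans Sx; apply: proper_card; apply/properP.
    have cE m : c m ([lie t, x] - mu l t *: x) = (mu m t - mu l t) * c m x.
      by rewrite /c linearB linearZ /= -![coord _ _ _]/(c _ _) ct // mulrBl.
    split; last by exists l => //; rewrite inE cE subrr mul0r eqxx.
    by apply/fintype.subsetP => m; rewrite !inE cE mulf_eq0 negb_or => /andP[].
  have nz : mu i t - mu j t != 0 by rewrite subr_eq0.
  have -> : x = (mu i t - mu j t)^-1 *: ([lie t, x] - mu j t *: x) +
      (- (mu i t - mu j t)^-1 *: ([lie t, x] - mu i t *: x) + 0).
    transitivity (((mu i t - mu j t)^-1 * (mu i t - mu j t)) *: x).
      by rewrite mulVf // scale1r.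
    vring.
  by apply: (Plin _ _ _ (red j Sj)); apply: (Plin _ _ _ (red i Si)).
have [i Si|S0] := pickP (mem (S x)); last first.
  have -> : x = 0; last exact: P0.
  rewrite (cx x) big1 // => i _; have /negbT := S0 i.
  by rewrite /= inE negbK => /eqP->; rewrite scale0r.
apply: (Peig x (mu i)) => // t tT.
rewrite (cx [lie t, x]) [x in RHS]cx scaler_sumr; apply: eq_bigr => j _.
rewrite ct // scalerA; have [->|nz] := eqVneq (c j x) 0.
  by rewrite !mulr0.
have [-> //|ne] := eqVneq (mu j t) (mu i t).
by case: none; exists j, i, t; split=> //; rewrite inE.
Qed.

End ToralEigen.

Section Borel.
Variables (k : closedFieldType) (char_k : [pchar k] =i pred0).
Variables (g : lieAlgType k) (ssg : lie_semisimple g).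
Implicit Types (x y z t : g) (s B U V W T C h : {vspace g}).

(* Lie's theorem in a quotient: W need not be stable under s. *)
Lemma lie_eigenvector_mod s V W : lie_closed s -> lie_solvable s ->
  (forall x v, x \in s -> v \in V -> [lie x, v] \in V) -> ~~ (V <= W)%VS ->
  exists v, [/\ v \in V, v \notin W &
    forall x, x \in s -> exists c, [lie x, v] - c *: v \in W].
Proof.
move=> cs sols sV nVW.
have [|P uP trP] := lie_trig char_k cs sols (@adm_lin _ g).
  by move=> x y _ _; apply: adm_br.
pose r v := vrow v *m invmx P.
(* Among the vectors of [V] outside [W], one is chosen whose coordinates in the triangularising
   basis stop earliest. Subtracting from [[lie x, v]] the multiple of [v] given by the diagonal
   entry at its last coordinate shortens the vector, so minimality puts the difference in [W]. *)
pose Q m := `[< exists v, [/\ v \in V, v \notin W &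
  forall j : 'I__, (m <= j)%N -> r v 0 j = 0] >].
have exQ : exists m, Q m.
  exists (\dim {:g}); apply/asboolP; have /subvPn[v vV vW] := nVW.
  by exists v; split=> // j; rewrite leqNgt ltn_ord.
case: (ex_minnP exQ) => -[|m] /asboolP[v [vV vW vm]] minm.
  case/negP: vW; have -> : v = 0; last exact: mem0v.
  apply/eqP; rewrite -vrow_eq0 -(mulmxKV uP (vrow v)) -/(r v).
  have -> : r v = 0; last by rewrite mul0mx.
  by apply/rowP => j; rewrite vm ?mxE.
exists v; split=> // x xs.
have [lt_m|ge_m] := ltnP m (\dim {:g}); last first.
  have /minm : Q m; last by rewrite ltnn.
  apply/asboolP; exists v; split=> // j mj.
  by have := leq_ltn_trans (leq_trans ge_m mj) (ltn_ord j); rewrite ltnn.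
pose i := Ordinal lt_m; pose T := P *m adm x *m invmx P.
exists (T i i); apply: contrapT => /negP nW.
have /minm : Q m; last by rewrite ltnn.
apply/asboolP; exists ([lie x, v] - T i i *: v); split=> //.
  by rewrite rpredB ?rpredZ ?sV.
have rE : r ([lie x, v] - T i i *: v) = r v *m T - T i i *: r v.
  rewrite /r -scaleN1r vrowD !vrowZ admE scaleN1r mulmxBl -scalemxAl.
  by rewrite /T !mulmxA mulmxKV.
have /is_trig_mxP tT : is_trig_mx T by apply: trP.
move=> j mj; rewrite rE; move: (T) tT => X tX.
rewrite mxE [X in X + _]mxE [X in _ + X]mxE [X in _ - X]mxE.
have [ij|ji] := eqVneq i j.
  rewrite (bigD1 j) //= big1 ?addr0 -?ij ?[X i i * _]mulrC ?subrr // => l li.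
  have [lt|gt|e] := ltngtP l i; first by rewrite tX ?mulr0.
    by rewrite vm ?mul0r.
  by rewrite (val_inj e : l = i) eqxx in li.
have ltj : (i < j)%N by rewrite ltn_neqAle mj andbT.
rewrite (vm j) // mulr0 subr0 big1 // => l _.
have [lt|gt] := ltnP l j; first by rewrite tX ?mulr0.
by rewrite vm ?mul0r // (leq_trans ltj).
Qed.

Definition borelv B := [/\ lie_closed B, lie_solvable B &
  forall C, lie_closed C -> lie_solvable C -> (B <= C)%VS -> C = B].

Lemma borel_subalgebra_borelv (b : lieSubalg g) : borel_subalgebra b -> borelv b.
Proof.
move=> [solb maxb]; split=> [||C cC solC bC] //; first exact: lsub_closed.
by have /= <- := maxb (LieSubalg cC) solC bC.
Qed.

Lemma ex_borelv s : lie_closed s -> lie_solvable s ->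
  exists2 B, borelv B & (s <= B)%VS.
Proof.
move=> cs sols; have [|B [[cB solB] sB maxB]] := @ex_vspace_maxS _ _
  (fun B => lie_closed B /\ lie_solvable B) s; first by split.
by exists B => //; split=> // C cC solC; apply: maxB.
Qed.

Lemma solvable_nilp_killing s x y : lie_closed s -> lie_solvable s ->
  x \in s -> ad_nilp x -> y \in s -> killing x y = 0.
Proof.
move=> cs sols xs nx ys; have [chi [_ _ kchi nil _]] := lie_weights char_k cs sols.
by rewrite kchi // big1 // => i _; rewrite ((nil x xs).1 nx) mul0r.
Qed.

Lemma solvable_br_nilp s x y : lie_closed s -> lie_solvable s ->
  x \in s -> y \in s -> ad_nilp [lie x, y].
Proof.
move=> cs sols xs ys; have [chi [_ c0 _ nil _]] := lie_weights char_k cs sols.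
by apply/nil => [|i]; [apply: cs|apply: c0].
Qed.

(** All brackets of [B + <[z]>] fall into [B], so that sum is a solvable subalgebra. *)
Lemma borel_follows B x z : borelv B -> x \in B -> ad_follows x z -> z \in B.
Proof.
move=> [cB solB maxB] xB fz.
have zB y : y \in B -> [lie z, y] \in B.
  by apply: (fz B B) => // u; apply: cB.
have brB : (lie_brv (B + <[z]>) (B + <[z]>) <= B)%VS.
  apply/lie_brvP => u v /memv_addline[u' [a [uB ->]]] /memv_addline[v' [b [vB ->]]].
  rewrite !(lieDl, lieDr, lieZl, lieZr) lie_brxx !scaler0 addr0.
  rewrite !rpredD ?rpredZ ?zB //; first exact: cB.
  by rewrite lie_antisym rpredN zB.
rewrite -(maxB (B + <[z]>)%VS) ?addvSl ?memvE ?addvSr //.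
  by apply/lie_closedP; apply: subv_trans brB (addvSl _ _).
exact: lie_solvable_brv brB solB.
Qed.

Lemma borel_korth_nilp B x : borelv B -> x \in B ->
  x \in korth B <-> ad_nilp x.
Proof.
move=> bB xB; have [cB solB _] := bB; split=> [/korthP xo|nx].
  apply: (ad_nilp_crit char_k ssg) => z fz.
  by rewrite killingC xo //; apply: borel_follows fz.
by apply/korthP => y yB; apply: (solvable_nilp_killing cB).
Qed.

(** If not, Lie's theorem modulo [B] yields an [x] orthogonal to [B] and outside it, on which [B]
    acts by scalars modulo [B :&: korth B]. Then [B + <[x]>] is solvable, against maximality: when
    [killing x x] is not 0 the scalars vanish and the brackets lie in [B]; when it is 0 Cartan's
    criterion applies. *)
Lemma borel_korth B : borelv B -> (korth B <= B)%VS.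
Proof.
move=> bB; have [cB solB maxB] := bB; apply/negPn/negP => nsub.
have stO x v : x \in B -> v \in korth B -> [lie x, v] \in korth B.
  move=> xB /korthP vo; apply/korthP => y yB.
  by rewrite lie_antisym killingNl killing_inv vo ?oppr0 ?cB.
have [x [xo xB xev]] := lie_eigenvector_mod cB solB stO nsub.
have xk y : y \in B -> killing x y = 0 by move/korthP: xo; apply.
have brBo u v : u \in B -> v \in B -> [lie u, v] \in korth B.
  move=> uB vB; apply/(borel_korth_nilp bB); first exact: cB.
  exact: solvable_br_nilp cB _ _ _.
pose p := (B + <[x]>)%VS.
have xp u : u \in B -> exists c, [lie u, x] - c *: x \in (B :&: korth B)%VS.
  move=> uB; have [c ux] := xev u uB; exists c; rewrite memv_cap ux.
  by rewrite rpredB ?rpredZ ?stO.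
have brp u v : u \in p -> v \in p ->
    exists c, [lie u, v] - c *: x \in (B :&: korth B)%VS.
  move=> /memv_addline[u' [a [uB ->]]] /memv_addline[v' [b [vB ->]]].
  have [c1 h1] := xp u' uB; have [c2 h2] := xp v' vB.
  exists (b * c1 - a * c2).
  rewrite !(lieDl, lieDr, lieZl, lieZr) lie_brxx !scaler0 addr0.
  have -> : [lie u', v'] + b *: [lie u', x] + a *: [lie x, v'] -
      (b * c1 - a * c2) *: x = [lie u', v'] - a *: ([lie v', x] - c2 *: x) +
      b *: ([lie u', x] - c1 *: x).
    by rewrite (lie_antisym x v'); vring.
  rewrite rpredD ?rpredB ?rpredZ // memv_cap brBo // cB //.
have Bp : (B <= p)%VS by rewrite addvSl.
have cp : lie_closed p.
  move=> u v up vp; have [c] := brp u v up vp; rewrite memv_cap => /andP[/(subvP Bp) h _].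
  by rewrite -(subrK (c *: x) [lie u, v]) rpredD ?rpredZ // memvE addvSr.
suff solp : lie_solvable p.
  by case/negP: xB; rewrite -(maxB p) // memvE addvSr.
have [xx0|nxx] := eqVneq (killing x x) 0; last first.
  apply: lie_solvable_brv solB; apply/lie_brvP => u v up vp.
  suff: forall u, u \in B -> [lie u, x] \in B.
    move=> ux; move: up vp => /memv_addline[u' [a [uB ->]]] /memv_addline[v' [b [vB ->]]].
    rewrite !(lieDl, lieDr, lieZl, lieZr) lie_brxx !scaler0 addr0.
    rewrite !rpredD ?rpredZ ?ux //; first exact: cB.
    by rewrite lie_antisym rpredN ux.
  move=> y yB; have [c] := xp y yB; rewrite memv_cap => /andP[yx _].
  suff c0 : c = 0 by rewrite c0 scale0r subr0 in yx.
  have: killing [lie y, x] x - c * killing x x = 0.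
    rewrite -mulNr -killingZl scaleNr -killingDl killingC xk //.
  rewrite killing_inv lie_brxx killing0r sub0r => /eqP.
  by rewrite oppr_eq0 mulf_eq0 (negPf nxx) orbF => /eqP.
apply: (cartan_solvable char_k) => // w z wp zp; move: w wp.
apply: lie_brv_ind => [|a u v IHu IHv|u v up vp]; first exact: killing0l.
  by rewrite killingDl killingZl IHu IHv mulr0 addr0.
have [c] := brp u v up vp; rewrite memv_cap => /andP[hB /korthP hO].
rewrite -(subrK (c *: x) [lie u, v]) killingDl killingZl.
move: zp => /memv_addline[z' [d [zB ->]]].
rewrite !killingDr !killingZr xx0 hO // (killingC _ x) !xk //.
by rewrite !(mulr0, addr0).
Qed.

(** A weight vector of [T] in [s] with nonzero weight is a multiple of a bracket, hence nilpotent;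
    one of weight 0 has its semisimple part in [T] by maximality. So [s] is the direct sum of [T]
    and [N]. *)
Lemma solvable_toral_part s T (N : {vspace g}) : lie_closed s -> lie_solvable s ->
  (forall x z, x \in s -> ad_follows x z -> z \in s) ->
  (forall x, x \in N <-> x \in s /\ ad_nilp x) ->
  toral T -> (T <= s)%VS ->
  (forall T', toral T' -> (T' <= s)%VS -> (T <= T')%VS -> T' = T) ->
  (\dim T + \dim N)%N = \dim s.
Proof.
move=> cs sols fs NP torT Ts maxT.
have TN : (T :&: N = 0)%VS.
  apply/eqP; rewrite -subv0; apply/subvP => x /memv_capP[xT /NP[_ nx]].
  by rewrite memv0; apply/eqP/(ad_diag_nilp0 char_k ssg) => //; apply: torT.2.
have sE : s = (T + N)%VS.
  apply/eqP; rewrite eqEsubv subv_add Ts /=; apply/andP; split; last first.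
    by apply/subvP => x /NP[].
  apply/subvP; apply: (toral_eigen_ind torT).
  - by move=> t x tT xs; apply: cs => //; apply: (subvP Ts).
  - exact: mem0v.
  - by move=> a x y xT yT; rewrite rpredD ?rpredZ.
  move=> x mu xs xmu.
  have [[t [tT nz]]|none] := pselect (exists t, t \in T /\ mu t != 0).
    apply: (subvP (addvSr T N)).
    have -> : x = (mu t)^-1 *: [lie t, x].
      by rewrite xmu // scalerA mulVf // scale1r.
    rewrite rpredZ //; apply/NP; have ts := subvP Ts t tT.
    by split; [apply: cs|apply: solvable_br_nilp cs _ _ _].
  have xT t : t \in T -> [lie x, t] = 0.
    move=> tT; rewrite lie_antisym xmu //.
    have -> : mu t = 0; last by rewrite scale0r oppr0.
    by apply/eqP; apply: contrapT => /negP nz; apply: none; exists t.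
  have [z [fz dz nz]] := lie_jordan_ss char_k ssg x.
  have zs : z \in s by apply: fs fz.
  have zT t : t \in T -> [lie z, t] = 0.
    move=> tT; apply/eqP; rewrite -memv0; apply: (fz T) tT; first exact: sub0v.
    by move=> u uT; rewrite memv0 xT.
  have zT' : z \in T.
    rewrite -(maxT _ (toral_add torT dz zT)) ?addvSl ?memvE ?addvSr //.
    by rewrite subv_add Ts -memvE.
  rewrite -(subrK z x) addrC memv_add //; apply/NP; split=> //.
  by rewrite rpredB.
by rewrite sE dimv_disjoint_sum.
Qed.

Lemma ex_max_toral s : exists T, [/\ toral T, (T <= s)%VS &
  forall T', toral T' -> (T' <= s)%VS -> (T <= T')%VS -> T' = T].
Proof.
have [|T [[torT Ts] _ maxT]] := @ex_vspace_maxS _ _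
  (fun T => toral T /\ (T <= s)%VS) (0%VS : {vspace g}).
  by split; [apply: toral0|apply: sub0v].
by exists T; split=> // T' torT' T's; apply: maxT.
Qed.

Lemma toral_borel_dim B T : borelv B -> toral T -> (T <= B)%VS ->
  (\dim T + \dim {:g} <= \dim B + \dim B)%N.
Proof.
move=> bB torT TB; rewrite -(dim_korth char_k ssg B) addnCA leq_add2l.
rewrite -dimv_disjoint_sum; first by rewrite dimvS // subv_add TB borel_korth.
apply/eqP; rewrite -subv0; apply/subvP => x /memv_capP[xT xo].
rewrite memv0; apply/eqP/(ad_diag_nilp0 char_k ssg); first exact: torT.2.
by apply/(borel_korth_nilp bB) => //; apply: (subvP TB).
Qed.

(** The nilpotent elements of the intersection are exactly the orthogonal of [B + B'], whose
    dimension is known; [solvable_toral_part] then gives the dimension of a maximal toral part. *)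
Lemma borel_common_toral B B' : borelv B -> borelv B' ->
  exists T, [/\ toral T, (T <= B)%VS, (T <= B')%VS &
    (\dim T + \dim {:g})%N = (\dim B + \dim B')%N].
Proof.
move=> bB bB'; have [[cB solB _] [cB' solB' _]] := (bB, bB').
pose s := (B :&: B')%VS.
have cs : lie_closed s.
  move=> x y /memv_capP[xB xB'] /memv_capP[yB yB'].
  by rewrite memv_cap cB ?cB'.
have sols : lie_solvable s := lie_solvableS (capvSl _ _) solB.
have [T [torT Ts maxT]] := ex_max_toral s.
have NP x : x \in korth (B + B') <-> x \in s /\ ad_nilp x.
  split=> [/korthP xo|[/memv_capP[xB xB'] nx]].
    have xo1 : x \in korth B by apply/korthP => y yB; apply/xo/(subvP (addvSl _ _)).
    have xo2 : x \in korth B' by apply/korthP => y yB; apply/xo/(subvP (addvSr _ _)).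
    have xB := subvP (borel_korth bB) x xo1.
    have xB' := subvP (borel_korth bB') x xo2.
    by rewrite memv_cap xB xB'; split=> //; apply/(borel_korth_nilp bB).
  apply/korthP => _ /memv_addP[u uB [v vB ->]]; rewrite killingDr.
  by rewrite (solvable_nilp_killing cB) // (solvable_nilp_killing cB') // addr0.
have fs x z : x \in s -> ad_follows x z -> z \in s.
  move=> /memv_capP[xB xB'] fz; rewrite memv_cap.
  by rewrite (borel_follows bB xB fz) (borel_follows bB' xB' fz).
have e1 := solvable_toral_part cs sols fs NP torT Ts maxT.
have e2 := dim_korth char_k ssg (B + B')%VS.
have e3 := dimv_sum_cap B B'.
exists T; split=> //.
- exact: subv_trans Ts (capvSl _ _).
- exact: subv_trans Ts (capvSr _ _).
by rewrite -/s in e3; lia.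
Qed.

Lemma borel_dim B B' : borelv B -> borelv B' -> \dim B = \dim B'.
Proof.
move=> bB bB'; have [T [torT TB TB' e]] := borel_common_toral bB bB'.
have := toral_borel_dim bB torT TB; have := toral_borel_dim bB' torT TB'.
lia.
Qed.

(** Every toral subalgebra lies in some Borel subalgebra, and all of these have the same dimension;
    by [toral_borel_dim] none is larger than the [T] found in the intersection. *)
Lemma borel_common B B' : borelv B -> borelv B' ->
  exists T, [/\ split_cartan T, (T <= B)%VS, (T <= B')%VS &
    (\dim T + \dim {:g})%N = (\dim B + \dim B)%N].
Proof.
move=> bB bB'; have [T [torT TB TB' e]] := borel_common_toral bB bB'.
have eB := borel_dim bB bB'.
exists T; split=> //; last by rewrite e -eB.
apply: (max_toral_split char_k ssg torT) => T' torT' TT'.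
have [B1 bB1 T'B1] := ex_borelv (toral_closed torT') (toral_solvable torT').
have := toral_borel_dim bB1 torT' T'B1; have eB1 := borel_dim bB bB1.
move=> le; apply/esym/eqP; rewrite eqEdim TT'; lia.
Qed.

End Borel.

(** * Roots of a split Cartan subalgebra *)

Section Roots.
Variables (k : closedFieldType) (char_k : [pchar k] =i pred0).
Variables (g : lieAlgType k) (ssg : lie_semisimple g).
Variables (h : lieSubalg g) (sh : split_cartan h).
Local Notation "h^*" := (dualv (lsub_of h)).
Local Notation hv := (h : {vspace g}).
Implicit Types (x y z v e f : g) (t : lsub_of h) (al be ga : h^*).

Lemma root_spaceE al x : x \in root_space al <->
  forall t, [lie vsval t, x] = (al t : k) *: x.
Proof. by split=> [/root_spaceP|H]; [|apply/root_spaceP]. Qed.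

Lemma root_weights : exists (w : (\dim {:g}).-tuple g) (M : 'I_(\dim {:g}) -> h^*),
  basis_of {:g} w /\ forall i : 'I_(\dim {:g}), w`_i \in root_space (M i).
Proof.
have [w [mu [bw wmu]]] := toral_weights sh.1.
have nz_w (i : 'I_(\dim {:g})) : w`_i != 0.
  by apply: (free_not0 (basis_free bw)); rewrite mem_nth // size_tuple.
have lmu (i : 'I_(\dim {:g})) : linear (fun t : lsub_of h => mu i (vsval t) : k^o).
  move=> a t u; apply/eqP; rewrite -subr_eq0.
  have : (mu i (vsval (a *: t + u)) - (a * mu i (vsval t) + mu i (vsval u))) *: w`_i = 0.
    rewrite scalerBl scalerDl -scalerA -!wmu ?subvsP //= lieDl lieZl.
    by rewrite subrr.
  by move=> /eqP; rewrite scaler_eq0 (negPf (nz_w i)) orbF.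
exists w, (fun i => linfun (fun t : lsub_of h => mu i (vsval t) : k^o)).
split=> // i; apply/root_spaceE => t.
by rewrite (linfunE_of (lmu i)) wmu ?subvsP.
Qed.

Lemma root_space0 x : x \in root_space (0 : h^*) <-> x \in hv.
Proof.
split=> [/root_spaceE x0|xh]; last first.
  by apply/root_spaceE => t; rewrite zero_lfunE scale0r sh.1.1 ?subvsP.
apply: sh.2 => t th; have := x0 (Subvs th : lsub_of h).
by rewrite /= zero_lfunE scale0r.
Qed.

Lemma root_space_ind (P : g -> Prop) :
  P 0 -> (forall a x y, P x -> P y -> P (a *: x + y)) ->
  (forall al x, x \in root_space al -> P x) -> forall x, P x.
Proof.
move=> P0 Plin Pr x; have [w [M [bw wM]]] := root_weights.
rewrite (coord_basis bw (memvf x)).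
elim/big_rec: _ => // i y _ Py; apply: Plin => //; exact: Pr (wM i).
Qed.

Lemma root_space_weight : exists M : seq h^*, forall al x,
  x \in root_space al -> x != 0 -> al \in M.
Proof.
have [w [M [bw wM]]] := root_weights.
exists (map M (enum 'I_(\dim {:g}))) => al x /root_spaceE xal nz_x.
have [i nz_c] : exists i, coord w i x != 0.
  apply: contrapT => none; case/eqP: nz_x.
  rewrite (coord_basis bw (memvf x)) big1 // => i _.
  have [->|nz] := eqVneq (coord w i x) 0; first by rewrite scale0r.
  by case: none; exists i.
apply/mapP; exists i; first by rewrite mem_enum.
apply/lfunP => t; have := congr1 (coord w i) (xal t); rewrite linearZ /=.
rewrite {1}(coord_basis bw (memvf x)) lie_sumr.
rewrite (eq_bigr (fun j => (coord w j x * (M j t : k)) *: w`_j)) => [|j _].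
  rewrite coord_sum_free ?(basis_free bw) // mulrC => /(mulIf nz_c) //.
by rewrite lieZr; have /root_spaceE-> := wM j; rewrite scalerA.
Qed.

Lemma root_space_br al be x y :
  x \in root_space al -> y \in root_space be -> [lie x, y] \in root_space (al + be).
Proof.
move=> /root_spaceE xa /root_spaceE yb; apply/root_spaceE => t.
by rewrite lie_jac xa yb lieZl lieZr add_lfunE scalerDl.
Qed.

Lemma killing_root_orth al be x y : al + be != 0 ->
  x \in root_space al -> y \in root_space be -> killing x y = 0.
Proof.
move=> nz /root_spaceE xa /root_spaceE yb.
have [t nzt] : exists t, (al + be) t != 0.
  apply: contrapT => none; case/eqP: nz; apply/lfunP => t; rewrite zero_lfunE.
  by apply/eqP; apply: contrapT => /negP nzt; apply: none; exists t.
have: ((al + be) t : k) * killing x y = 0.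
  rewrite add_lfunE mulrDl -killingZl -killingZr -xa -yb lie_antisym.
  by rewrite killingNl killing_inv addNr.
by move/eqP; rewrite mulf_eq0 (negPf nzt) => /eqP.
Qed.

Lemma killing_root_nondeg al x : x \in root_space al ->
  (forall y, y \in root_space (- al) -> killing x y = 0) -> x = 0.
Proof.
move=> xa x0; apply: (killing_nondeg char_k ssg).
apply: root_space_ind => [|a y z y0 z0|be y yb]; first exact: killing0r.
  by rewrite killingDr killingZr y0 z0 mulr0 addr0.
have [e|nz] := eqVneq (al + be) 0; last exact: killing_root_orth nz _ _.
by apply: x0; rewrite (addr0_eq e).
Qed.

Lemma cartan_dual al : exists t, forall u, killing (vsval t) (vsval u) = al u.
Proof.
pose phi y : k := al (vsproj h y).
have [|x xphi] := @killing_dual k char_k g ssg phi.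
  by move=> a y z; rewrite /phi !linearP.
have [t tx] : exists t, forall u : lsub_of h,
    killing (vsval t) (vsval u) = killing x (vsval u).
  move: x {xphi}; apply: root_space_ind => [|a x y [t tx] [u uy]|be x xb].
  - by exists 0 => u; rewrite linear0 !killing0l.
  - exists (a *: t + u) => v; rewrite linearP /= !killingDl !killingZl tx uy //.
  have [be0|nz] := eqVneq be 0.
    rewrite be0 in xb; have xh := (root_space0 x).1 xb.
    by exists (Subvs xh : lsub_of h).
  exists 0 => u; rewrite linear0 killing0l.
  rewrite (@killing_root_orth be 0) ?addr0 //.
  by apply/root_space0/subvsP.
exists t => u; rewrite tx xphi /phi.
by congr (fun_of_lfun al); apply: vsvalK.
Qed.

Definition tdual al : lsub_of h := sval (cid (cartan_dual al)).
Lemma tdualP al u : killing (vsval (tdual al)) (vsval u) = al u.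
Proof. exact: (svalP (cid (cartan_dual al))). Qed.

Lemma tdualC al be : al (tdual be) = be (tdual al).
Proof. by rewrite -tdualP killingC tdualP. Qed.

Lemma tdual_eq x al : x \in hv -> (forall u : lsub_of h, killing x (vsval u) = al u) ->
  x = vsval (tdual al).
Proof.
move=> xh xu; apply/subr0_eq.
have d0 : x - vsval (tdual al) \in root_space (0 : h^*).
  by apply/root_space0; rewrite rpredB // subvsP.
apply: (killing_root_nondeg d0) => y; rewrite oppr0 => /root_space0 yh.
rewrite killingDl killingNl (xu (Subvs yh : lsub_of h)).
by rewrite (tdualP al (Subvs yh : lsub_of h)) subrr.
Qed.

Lemma root_br_opp al x y : x \in root_space al -> y \in root_space (- al) ->
  [lie x, y] = killing x y *: vsval (tdual al).
Proof.
move=> xa ya; have xyh : [lie x, y] \in hv.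
  by apply/root_space0; rewrite -(subrr al); apply: root_space_br.
have -> : killing x y *: vsval (tdual al) = vsval (killing x y *: tdual al) by [].
apply/subr0_eq; set d := _ - _.
have dh : d \in root_space (0 : h^*) by apply/root_space0; rewrite rpredB // subvsP.
apply: (killing_root_nondeg dh) => u; rewrite oppr0 => /root_space0 uh.
rewrite /d killingDl killingNl killingZl.
rewrite (tdualP al (Subvs uh : lsub_of h)) killing_inv lie_antisym.
have /root_spaceE/(_ (Subvs uh : lsub_of h)) /= -> := ya.
by rewrite opp_lfunE scaleNr opprK killingZr mulrC subrr.
Qed.

Lemma rootP al : is_root al <-> al <> 0 /\ exists2 x, x \in root_space al & x != 0.
Proof.
rewrite /is_root; split=> [/andP[/eqP nz]|[/eqP-> [x xa nz]]].
  rewrite -vpick0 => nzv; split=> //; exists (vpick (root_space al)) => //.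
  exact: memv_pick.
apply: contraNneq nz => e0; by rewrite e0 memv0 in xa.
Qed.

Lemma root_opp al : is_root al -> is_root (- al).
Proof.
move=> /rootP[nz [x xa nzx]]; apply/rootP; split.
  by move=> /eqP; rewrite oppr_eq0 => /eqP.
apply: contrapT => none; case/eqP: nzx; apply: (killing_root_nondeg xa) => y ya.
have [->|nzy] := eqVneq y 0; first exact: killing0r.
by case: none; exists y.
Qed.

Lemma root_nz al : is_root al -> al != 0.
Proof. by case/andP. Qed.

Lemma root_pair al x : is_root al -> x \in root_space al -> x != 0 ->
  exists2 y, y \in root_space (- al) & killing x y = 1.
Proof.
move=> _ xa nzx; apply: contrapT => none; case/eqP: nzx.
apply: (killing_root_nondeg xa) => y ya.
have [//|nz] := eqVneq (killing x y) 0; case: none.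
exists ((killing x y)^-1 *: y); first by rewrite rpredZ.
by rewrite killingZr mulVf.
Qed.

(** If [al] vanished on its dual, a pair of opposite root vectors would span with it a solvable
    algebra of Heisenberg type. The dual, a bracket there, would be both nilpotent and
    diagonalizable, hence 0. *)
Lemma tdual_neq0 al : is_root al -> (al (tdual al) : k) != 0.
Proof.
move=> ral; have [nz [x xa nzx]] := (rootP al).1 ral.
have [y ya xy] := root_pair ral xa nzx.
apply/negP => /eqP at0.
pose tt := vsval (tdual al).
have xyt : [lie x, y] = tt by rewrite (root_br_opp xa ya) xy scale1r.
have tx : [lie tt, x] = 0 by have /root_spaceE-> := xa; rewrite at0 scale0r.
have ty : [lie tt, y] = 0.
  by have /root_spaceE-> := ya; rewrite opp_lfunE at0 oppr0 scale0r.
pose s := (<[tt]> + <[x]> + <[y]>)%VS.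
have brs : (lie_brv s s <= <[tt]>)%VS.
  apply/lie_brvP => u v /memv_addline[u' [a [/memv_addline[u'' [a' [/vlineP[a'' ->] ->]]] ->]]].
  move=> /memv_addline[v' [b [/memv_addline[v'' [b' [/vlineP[b'' ->] ->]]] ->]]].
  rewrite !(lieDl, lieDr, lieZl, lieZr) !lie_brxx tx ty xyt.
  rewrite (lie_antisym x tt) (lie_antisym y tt) (lie_antisym y x) tx ty xyt.
  rewrite oppr0 !scaler0 !(addr0, add0r).
  by rewrite rpredD ?rpredZ ?rpredN ?memv_line.
have ts : (<[tt]> <= s)%VS by rewrite /s -addvA addvSl.
have xs : x \in s by rewrite memvE; apply: subv_trans (addvSl _ _); apply: addvSr.
have ys : y \in s by rewrite memvE addvSr.
have cs : lie_closed s by apply/lie_closedP; apply: subv_trans ts.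
have sols : lie_solvable s.
  apply: lie_solvable_brv brs _; apply: lie_solvable_abelian => u v.
  by move=> /vlineP[a ->] /vlineP[b ->]; rewrite lieZl lieZr lie_brxx !scaler0.
have ntt : ad_nilp tt by rewrite -xyt; apply: (solvable_br_nilp char_k cs sols).
have tt0 : tt = 0.
  by apply: (ad_diag_nilp0 char_k ssg) => //; apply: sh.1.2; apply: subvsP.
apply: nz; apply/lfunP => u; rewrite -tdualP -/tt tt0 killing0l zero_lfunE //.
Qed.

(** The bracket of opposite root spaces lies in the line of [tdual al], so the choice made by [xget]
    in [coroot] is forced. *)
Lemma corootE al : is_root al -> coroot al = (2%:R / (al (tdual al) : k)) *: tdual al.
Proof.
move=> ral; have nzt := tdual_neq0 ral.
have [nz [x xa nzx]] := (rootP al).1 ral; have [y ya xy] := root_pair ral xa nzx.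
have sub t : vsval t \in lie_brv (root_space al) (root_space (- al)) ->
    exists c, t = c *: tdual al.
  move=> tin; suff /vlineP[c e] : vsval t \in <[vsval (tdual al)]>%VS.
    by exists c; apply: val_inj.
  move: tin; apply/subvP/lie_brvP => u v ua va; rewrite (root_br_opp ua va).
  by rewrite rpredZ ?memv_line.
have ex : (exists t, [set t : lsub_of h |
    vsval t \in lie_brv (root_space al) (root_space (- al)) /\ al t = 2%:R] t)%classic.
  exists ((2%:R / (al (tdual al) : k)) *: tdual al); split; last first.
    rewrite linearZ /=; exact: divfK.
  rewrite linearZ rpredZ //=.
  have -> : vsval (tdual al) = [lie x, y] by rewrite (root_br_opp xa ya) xy scale1r.
  exact: mem_lie_brv.
have := xgetPex 0 ex; rewrite -/(coroot al) => -[/sub[c cE] c2].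
rewrite cE; congr (_ *: _); rewrite cE linearZ in c2.
by rewrite -c2 /= -[_ *: _]/(c * (al (tdual al) : k)) mulfK.
Qed.

Lemma pairingE be al : is_root al ->
  pairing be al = 2%:R * (be (tdual al) : k) / (al (tdual al) : k).
Proof.
move=> ral; rewrite /pairing corootE // linearZ /=.
by rewrite -[_ *: _]/(_ * (be (tdual al) : k)) mulrAC.
Qed.

Lemma pairing_self al : is_root al -> pairing al al = 2%:R.
Proof. by move=> ral; rewrite pairingE // mulfK // tdual_neq0. Qed.

Lemma coroot_opp al : is_root al -> coroot (- al) = - coroot al.
Proof.
move=> ral; rewrite !corootE ?root_opp //.
have -> : tdual (- al) = - tdual al.
  apply/esym/val_inj; apply: tdual_eq; first exact: subvsP.
  by move=> u /=; rewrite killingNl tdualP opp_lfunE.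
by rewrite opp_lfunE (linearN al) opprK scalerN.
Qed.

Lemma pairingDl be ga al : pairing (be + ga) al = pairing be al + pairing ga al.
Proof. by rewrite /pairing add_lfunE. Qed.
Lemma pairingZl a be al : pairing (a *: be) al = a * pairing be al.
Proof. by rewrite /pairing scale_lfunE. Qed.
Lemma pairingNl be al : pairing (- be) al = - pairing be al.
Proof. by rewrite /pairing opp_lfunE. Qed.
Lemma pairingBl be ga al : pairing (be - ga) al = pairing be al - pairing ga al.
Proof. by rewrite pairingDl pairingNl. Qed.
Lemma pairing0l al : pairing 0 al = 0.
Proof. by rewrite /pairing zero_lfunE. Qed.
Lemma pairing_suml I (r : seq I) (P : pred I) F al :
  pairing (\sum_(i <- r | P i) F i) al = \sum_(i <- r | P i) pairing (F i) al.
Proof.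
by rewrite /pairing sum_lfunE.
Qed.
Lemma pairingNr be al : is_root al -> pairing be (- al) = - pairing be al.
Proof. by move=> ral; rewrite /pairing coroot_opp // linearN. Qed.

Lemma pairing_sym0 al be : is_root al -> is_root be ->
  pairing be al = 0 -> pairing al be = 0.
Proof.
move=> ral rbe; rewrite !pairingE // => /eqP.
rewrite !mulf_eq0 invr_eq0 (negPf (tdual_neq0 ral)) orbF => e.
rewrite tdualC; apply/eqP; rewrite !mulf_eq0; move: e => /orP[->//|->].
by rewrite orbT.
Qed.

Lemma sl2_triple al : is_root al -> exists e f,
  [/\ e \in root_space al, f \in root_space (- al), e != 0, f != 0 &
      [lie e, f] = vsval (coroot al)].
Proof.
move=> ral; have [nz [x xa nzx]] := (rootP al).1 ral.
have [y ya xy] := root_pair ral xa nzx; have nzt := tdual_neq0 ral.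
have nz2 : (2%:R : k) != 0 by apply: natr_neq0.
exists x, ((2%:R / (al (tdual al) : k)) *: y); split; [exact: xa| |exact: nzx| |].
- by rewrite rpredZ.
- rewrite scaler_eq0 mulf_eq0 invr_eq0 (negPf nzt) (negPf nz2) /=.
  by apply: contra_eq_neq xy => ->; rewrite killing0r eq_sym oner_eq0.
by rewrite lieZr (root_br_opp xa ya) xy scale1r corootE.
Qed.

Lemma root_space_iter al be e v n : e \in root_space al -> v \in root_space be ->
  iter n (lie_br e) v \in root_space (be + al *+ n).
Proof.
move=> ea vb; elim: n => [|n IHn] /=; first by rewrite addr0.
by rewrite mulrS addrCA; apply: root_space_br.
Qed.

Lemma root_mulrn_inj al : al != 0 -> injective (fun n => al *+ n).
Proof.
move=> nz m n; wlog mn : m n / (m <= n)%N => [H|].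
  by case/orP: (leq_total m n) => le e; [|apply/esym]; apply: H.
move=> /eqP; rewrite eq_sym -subr_eq0 -mulrnBr //.
case: (n - m)%N (subnKC mn) => [|d] <- //; first by rewrite addn0.
by rewrite -scaler_nat scaler_eq0 (negPf nz) orbF (negPf (natr_neq0 char_k d)).
Qed.

Lemma root_iter_nilp al be e v : al != 0 -> e \in root_space al ->
  v \in root_space be -> exists n, iter n (lie_br e) v = 0.
Proof.
move=> nz ea vb; apply: contrapT => none.
have [M ML] := root_space_weight.
pose s := map (fun n => be + al *+ n) (iota 0 (size M).+1).
have us : uniq s.
  rewrite map_inj_uniq ?iota_uniq // => m n /addrI.
  exact: root_mulrn_inj.
have: (size s <= size M)%N.
  apply: uniq_leq_size us _ => _ /mapP[n _ ->].
  apply: ML (root_space_iter n ea vb) _.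
  by apply/eqP => e0; apply: none; exists n.
by rewrite size_map size_iota ltnn.
Qed.

(** With m the pairing of [be] with [al], induction gives f e^(j+1) v = - (j + 1) (m + j) e^j v; at
    the last nonzero power of e the left side is 0, so m = - n. The hypothesis on [[lie e,
    [lie f, v]]] allows [[lie f, v]] to be a nonzero vector killed by [e], as in [root_double] and
    [root_br_neq0]. *)
Lemma sl2_chain al be e f v : is_root al ->
  e \in root_space al -> f \in root_space (- al) ->
  [lie e, f] = vsval (coroot al) -> v \in root_space be -> v != 0 ->
  [lie e, [lie f, v]] = 0 ->
  exists n, pairing be al = - n%:R /\
    (forall j, (j <= n)%N -> iter j (lie_br e) v != 0).
Proof.
move=> ral ea fa ef vb nzv efv.
set m := pairing be al.
have Hv j : [lie vsval (coroot al), iter j (lie_br e) v] =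
    (m + 2%:R *+ j) *: iter j (lie_br e) v.
  have /root_spaceE-> := root_space_iter j ea vb.
  rewrite -[fun_of_lfun _ _]/(pairing (be + al *+ j) al) pairingDl.
  by rewrite -scaler_nat pairingZl pairing_self // mulrC mulr_natr.
have fe j : [lie f, iter j.+1 (lie_br e) v] =
    - (j.+1%:R * (m + j%:R)) *: iter j (lie_br e) v.
  elim: j => [|j IHj].
    rewrite /= lie_jac (lie_antisym f e) ef lieNl efv addr0.
    by have /= -> := Hv 0%N; rewrite mulr0n !addr0 mul1r scaleNr.
  rewrite [iter j.+2 _ _]iterS lie_jac (lie_antisym f e) ef lieNl Hv IHj.
  rewrite lieZr -iterS -scaleNr -scalerDl; congr (_ *: _).
  by rewrite -[j.+2]addn1 -[j.+1]addn1 !natrD -mulr_natr natrD; ring.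
have exn : exists n, iter n.+1 (lie_br e) v == 0.
  have [[|n] n0] := root_iter_nilp (root_nz ral) ea vb.
    by rewrite /= in n0; rewrite n0 eqxx in nzv.
  by exists n; apply/eqP.
case: (ex_minnP exn) => n /eqP n0 minn.
have nzj j : (j <= n)%N -> iter j (lie_br e) v != 0.
  case: j => // j jn; apply/negP => /minn; by rewrite leqNgt jn.
exists n; split=> //; have := fe n; rewrite n0 lie0r => /esym/eqP.
rewrite scaler_eq0 (negPf (nzj n (leqnn n))) orbF oppr_eq0 mulf_eq0.
rewrite (negPf (natr_neq0 char_k n)) /= => /eqP/eqP.
by rewrite addr_eq0 => /eqP.
Qed.

Lemma sl2_chain_opp al be e f v : is_root al ->
  e \in root_space al -> f \in root_space (- al) ->
  [lie e, f] = vsval (coroot al) -> v \in root_space be -> v != 0 ->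
  [lie f, [lie e, v]] = 0 ->
  exists n, pairing be al = n%:R /\
    (forall j, (j <= n)%N -> iter j (lie_br f) v != 0).
Proof.
move=> ral ea fa ef vb nzv fev.
have fe : [lie f, e] = vsval (coroot (- al)).
  by rewrite coroot_opp // lie_antisym ef linearN.
have ea' : e \in root_space (- - al) by rewrite opprK.
have [n [e1 e2]] := sl2_chain (root_opp ral) fa ea' fe vb nzv fev.
exists n; split=> //; apply/eqP; rewrite -eqr_opp -e1.
by rewrite pairingNr.
Qed.

Lemma natr_addr_neq0 m n : (m.+1%:R + n%:R : k) != 0.
Proof. by rewrite -natrD addSn natr_neq0. Qed.

(** A root vector [y] orthogonal to [f] is killed by [f], and if nonzero [sl2_chain] would give [al]
    a nonpositive pairing with itself. *)
Lemma root_space_line al e : is_root al -> e \in root_space al -> e != 0 ->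
  forall x, x \in root_space al -> exists c, x = c *: e.
Proof.
move=> ral ea nze x xa.
have [e1 [f [e1a fa nze1 nzf ef]]] := sl2_triple ral.
have key y : y \in root_space al -> killing y f = 0 -> y = 0.
  move=> ya yf; apply/eqP; apply: contraT => nzy.
  have [|n [e2 _]] := sl2_chain ral e1a fa ef ya nzy.
    by rewrite (lie_antisym f y) (root_br_opp ya fa) yf scale0r oppr0 lie0r.
  by have := natr_addr_neq0 1 n; rewrite -(pairing_self ral) e2 addNr eqxx.
have nzef : killing e f != 0.
  by apply: contraNneq nze => /key; move/(_ ea) => ->.
exists (killing x f / killing e f); apply/subr0_eq/key.
  by rewrite rpredB ?rpredZ.
by rewrite killingDl killingNl killingZl divfK // subrr.
Qed.

(** For [v] in the root space of [al + al], [[lie f, v]] is a multiple of [e], so it is killed by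
    [e]; the pairing 4 then contradicts [sl2_chain]. *)
Lemma root_double al : is_root al -> ~~ is_root (al + al).
Proof.
move=> ral; apply/negP => /rootP[_ [v va nzv]].
have [e [f [ea fa nze nzf ef]]] := sl2_triple ral.
have fv : [lie f, v] \in root_space al.
  by have := root_space_br fa va; rewrite addrA addNr add0r.
have [c fve] := root_space_line ral ea nze fv.
have [|n [e2 _]] := sl2_chain ral ea fa ef va nzv.
  by rewrite fve lieZr lie_brxx scaler0.
have := natr_addr_neq0 3 n; rewrite (natrD _ 2 2) -{1 2}(pairing_self ral).
by rewrite -pairingDl e2 addNr eqxx.
Qed.

Lemma root_bottom al be f v : al != 0 -> f \in root_space (- al) ->
  v \in root_space be -> v != 0 ->
  exists m, [/\ iter m (lie_br f) v \in root_space (be - al *+ m),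
    iter m (lie_br f) v != 0 & [lie f, iter m (lie_br f) v] = 0].
Proof.
move=> nz fa vb nzv.
have exn : exists n, iter n.+1 (lie_br f) v == 0.
  have [|[|n] n0] := root_iter_nilp _ fa vb; first by rewrite oppr_eq0.
    by rewrite /= in n0; rewrite n0 eqxx in nzv.
  by exists n; apply/eqP.
case: (ex_minnP exn) => n /eqP n0 minn; exists n; split; last exact: n0.
  by rewrite -mulNrn; apply: root_space_iter.
case: n n0 minn => // n n0 minn; apply/negP => /minn; by rewrite ltnn.
Qed.

Lemma pairing_int al be : is_root al -> is_root be ->
  exists z : int, pairing be al = z%:~R.
Proof.
move=> ral rbe; have [e [f [ea fa nze nzf ef]]] := sl2_triple ral.
have [_ [v vb nzv]] := (rootP be).1 rbe.
have [m [wb nzw fw]] := root_bottom (root_nz ral) fa vb nzv.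
have [|n [e1 _]] := sl2_chain ral ea fa ef wb nzw.
  by rewrite fw lie0r.
exists ((m.*2)%:Z - n%:Z); rewrite rmorphB /= -!pmulrn -e1 pairingBl.
rewrite -scaler_nat pairingZl pairing_self // -natrM muln2.
by rewrite addrC addrNK.
Qed.

(** The chain from the bottom vector, [m] steps below [be], has [p + m.*2] steps, and the reflected
    root is only [p + m] steps up. *)
Lemma root_reflect_aux al be : is_root al -> is_root be ->
  (exists n : nat, pairing be al = - n%:R) -> is_root (be - pairing be al *: al).
Proof.
move=> ral rbe [p pE]; have [e [f [ea fa nze nzf ef]]] := sl2_triple ral.
have [_ [v vb nzv]] := (rootP be).1 rbe.
have [m [wb nzw fw]] := root_bottom (root_nz ral) fa vb nzv.
have [|n [e1 nzj]] := sl2_chain ral ea fa ef wb nzw.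
  by rewrite fw lie0r.
have nE : n = (p + m.*2)%N.
  apply/eqP; rewrite -(eqn_add2r 0) !addn0.
  have : (n%:R : k) = (p + m.*2)%:R.
    apply/eqP; rewrite -eqr_opp -e1 pairingBl pE -scaler_nat pairingZl.
    by rewrite pairing_self // -natrM muln2 natrD opprD.
  move=> e2; apply: contraT => ne; case: (ltngtP n (p + m.*2)) ne => // lt _.
    have := natr_neq0 char_k (p + m.*2 - n).-1.
    by rewrite prednK ?subn_gt0 // natrB ?(ltnW lt) // e2 subrr eqxx.
  have := natr_neq0 char_k (n - (p + m.*2)).-1.
  by rewrite prednK ?subn_gt0 // natrB ?(ltnW lt) // e2 subrr eqxx.
have := root_space_iter (p + m) ea wb.
have -> : be - al *+ m + al *+ (p + m) = be - pairing be al *: al.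
  rewrite pE scaleNr opprK scaler_nat mulrnDr addrA.
  by rewrite addrAC addrNK.
move=> ub; apply/rootP; split; last first.
  exists (iter (p + m) (lie_br e) (iter m (lie_br f) v)) => //.
  by apply: nzj; rewrite nE -addnn addnA leq_addr.
move=> /eqP; rewrite subr_eq0 => /eqP beE.
have := congr1 (fun ga => pairing ga al) beE; rewrite pairingZl pairing_self // => /eqP.
rewrite -subr_eq0 -{1}[pairing be al]mulr1 -mulrBr mulf_eq0.
have -> : (1 - 2%:R : k) = -1 by ring.
rewrite oppr_eq0 oner_eq0 orbF => /eqP p0; case/eqP: (root_nz rbe).
by rewrite beE p0 scale0r.
Qed.

Lemma root_reflect al be : is_root al -> is_root be ->
  is_root (be - pairing be al *: al).
Proof.
move=> ral rbe; have [z zE] := pairing_int ral rbe; case: z zE => n zE.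
  have := @root_reflect_aux (- al) be (root_opp ral) rbe.
  rewrite (pairingNr _ ral) scaleNr scalerN opprK; apply.
  by exists n; rewrite zE -pmulrn.
by apply: root_reflect_aux => //; exists n.+1; rewrite zE NegzE mulrNz -pmulrn.
Qed.

Lemma root_add al be n : is_root al -> is_root be ->
  pairing be al = - n.+1%:R -> be + al = 0 \/ is_root (be + al).
Proof.
move=> ral rbe pE; have [e [f [ea fa nze nzf ef]]] := sl2_triple ral.
have [_ [v vb nzv]] := (rootP be).1 rbe.
have [ev|nzev] := eqVneq [lie e, v] 0.
  have [|m [e1 _]] := sl2_chain_opp ral ea fa ef vb nzv.
    by rewrite ev lie0r.
  have := natr_addr_neq0 n m; rewrite -e1 pE addrN eqxx //.
have [->|nz] := eqVneq (be + al) 0; [by left|right].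
apply/rootP; split; first exact/eqP.
exists [lie e, v]; last exact: nzev.
by rewrite addrC; apply: root_space_br ea vb.
Qed.

Lemma root_sub al be n : is_root al -> is_root be ->
  pairing be al = n.+1%:R -> be - al = 0 \/ is_root (be - al).
Proof.
move=> ral rbe pE; apply: (@root_add _ _ n (root_opp ral) rbe).
by rewrite (pairingNr _ ral) pE.
Qed.

(** If the bracket vanished, [y] would be a top vector and [pairing be al] nonnegative, while a
    vector of weight [al + be] would start a chain, giving [2 + pairing be al] a nonpositive
    value. *)
Lemma root_br_neq0 al be x y : is_root al -> is_root be -> is_root (al + be) ->
  x \in root_space al -> y \in root_space be -> x != 0 -> y != 0 ->
  [lie x, y] != 0.
Proof.
move=> ral rbe rab xa yb nzx nzy; apply/negP => /eqP xy.
have [e [f [ea fa nze nzf ef]]] := sl2_triple ral.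
have [c eE] := root_space_line ral xa nzx ea.
have ey : [lie e, y] = 0 by rewrite eE lieZl xy scaler0.
have [|n [e1 _]] := sl2_chain_opp ral ea fa ef yb nzy.
  by rewrite ey lie0r.
have [_ [u uab nzu]] := (rootP _).1 rab.
have fu : [lie f, u] \in root_space be.
  by have := root_space_br fa uab; rewrite addrA addNr add0r.
have [d fuE] := root_space_line rbe yb nzy fu.
have [|m [e2 _]] := sl2_chain ral ea fa ef uab nzu.
  by rewrite fuE lieZr ey scaler0.
have := natr_addr_neq0 (1 + n) m; rewrite -addSn natrD -e1 -(pairing_self ral).
by rewrite -pairingDl e2 addNr eqxx.
Qed.

(** The two roots have pairings 2 c and 2 / c, integers with product 4; the ratios 2 and 1/2, up to
    sign, are excluded by [root_double]. *)
Lemma root_scale al c : is_root al -> is_root (c *: al) -> c = 1 \/ c = -1.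
Proof.
move=> ral rcal.
have nzc : c != 0.
  by apply: contraTneq rcal => ->; rewrite scale0r /is_root eqxx.
have [a aE] := pairing_int ral rcal; have [b bE] := pairing_int rcal ral.
rewrite pairingZl pairing_self // in aE.
have cb : c * b%:~R = 2%:R by rewrite -bE -pairingZl pairing_self.
have e4 : ((4 : int)%:~R : k) = 2%:R * 2%:R by rewrite -natrM.
have e4' : ((-4 : int)%:~R : k) = - (2%:R * 2%:R) by rewrite -natrM.
have ab : a * b = 4.
  have : ((a * b)%:~R : k) = (4 : int)%:~R.
    by rewrite intrM -aE mulrAC cb e4.
  move/eqP; rewrite -subr_eq0 -rmorphB /= (intr_eq0_char0 char_k) subr_eq0.
  by move/eqP.
have nd2 : ~ (c = 2%:R \/ c = - 2%:R).
  have nd := root_double ral.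
  case=> cE; move: rcal; rewrite cE.
    by rewrite scaler_nat mulr2n (negPf nd).
  by move/root_opp; rewrite scaleNr opprK scaler_nat mulr2n (negPf nd).
have ndh : ~ (c * 2%:R = 1 \/ c * 2%:R = -1).
  have nd := root_double rcal.
  case=> cE; have e : c *: al + c *: al = (c * 2%:R) *: al.
  - by rewrite -scalerDl -mulr2n -[c *+ 2]mulr_natr.
  - by move: nd; rewrite e cE scale1r ral.
  - by rewrite -scalerDl -mulr2n -[c *+ 2]mulr_natr.
  - by move: nd; rewrite e cE scaleN1r (root_opp ral).
have nz2 : (2%:R : k) != 0 by apply: natr_neq0.
have cE : c = a%:~R / 2%:R by rewrite -aE mulfK.
have : a \in [:: 1; -1; 2; -2; 4; -4].
  have : (`|a| * `|b| = 4)%N by rewrite -abszM ab.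
  move: (absz b) => b'.
  case aa: (absz a) => [|[|[|[|[|n]]]]] // eb.
  - by move: aa; case: (a) => [[|[|n]]|[|n]].
  - by move: aa; case: (a) => [[|[|[|n]]]|[|[|n]]].
  - by exfalso; lia.
  - by move: aa; case: (a) => [[|[|[|[|[|n]]]]]|[|[|[|[|n]]]]].
  - case: b' eb => [|b']; rewrite ?muln0 // mulnS => eb.
    by have := leq_addr (n.+1.+4 * b') n.+1.+4; rewrite eb.
rewrite !inE.
move=> /orP[/eqP a_|/orP[/eqP a_|/orP[/eqP a_|/orP[/eqP a_|/orP[/eqP a_|/eqP a_]]]]];
  rewrite a_ in cE.
- by case: ndh; left; rewrite cE divfK.
- by case: ndh; right; rewrite cE divfK.
- by left; rewrite cE divff.
- by right; rewrite cE -[-2]/(- (2%:Z)) mulrNz mulNr divff.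
- by case: nd2; left; rewrite cE e4 mulfK.
- by case: nd2; right; rewrite cE e4' mulNr mulfK.
Qed.

End Roots.

(** * Positive systems and cascades *)

Section PositiveSystems.
Variables (k : closedFieldType) (char_k : [pchar k] =i pred0).
Variables (g : lieAlgType k) (ssg : lie_semisimple g).
Variables (h : lieSubalg g) (sh : split_cartan h).
Local Notation "h^*" := (dualv (lsub_of h)).
Implicit Types (al be ga de ep : h^*) (s E : seq h^*).

Lemma roots_ex : exists s : seq h^*, uniq s /\ forall al, (al \in s) = is_root al.
Proof.
have [M ML] := root_space_weight sh.
exists (undup (filter (@is_root k g h) M)); split; first exact: undup_uniq.
move=> al; rewrite mem_undup mem_filter andb_idr // => /rootP[_ [x xa nz]].
exact: ML nz.
Qed.

Definition roots : seq h^* := sval (cid roots_ex).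
Lemma roots_uniq : uniq roots. Proof. exact: (svalP (cid roots_ex)).1. Qed.
Lemma mem_roots al : (al \in roots) = is_root al.
Proof. exact: (svalP (cid roots_ex)).2. Qed.

Lemma pairing_cases al be : is_root al -> is_root be ->
  (exists n : nat, pairing be al = n%:R) \/ (exists n : nat, pairing be al = - n.+1%:R).
Proof.
move=> ral rbe; have [z ->] := pairing_int char_k ssg sh ral rbe.
by case: z => n; [left; exists n|right; exists n; rewrite NegzE mulrNz].
Qed.

(** Stated by closure and without a base, so that the roots of a Borel subalgebra form a positive
    system directly. *)
Definition pos_system (P : h^* -> Prop) := [/\ forall al, P al -> is_root al,
  forall al, is_root al -> P al \/ P (- al),
  forall al, P al -> ~ P (- al) &
  forall al be, P al -> P be -> is_root (al + be) -> P (al + be)].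

Section OneSystem.
Variables (P : h^* -> Prop) (posP : pos_system P).

Lemma pos_root al : P al -> is_root al.
Proof. by have [H _ _ _] := posP; apply: H. Qed.

(** This stands in for a linear form positive on [P]. In a vanishing sum some term [b] pairs
    negatively with the first term [a], as [pairing a a] is 2; replacing both by the root [b + a]
    shortens the sum. *)
Lemma pos_sum_neq0 s : (forall al, al \in s -> P al) -> s != [::] ->
  \sum_(al <- s) al != 0.
Proof.
have [_ _ nP addP] := posP.
move: {2}(size s) (leqnn (size s)) => n; elim: n s => [|n IHn] [|a s] //= sn Ps _.
have Pa : P a by apply: Ps; rewrite mem_head.
have ra := pos_root Pa.
have rs b : b \in s -> is_root b.
  by move=> bs; apply/pos_root/Ps; rewrite inE bs orbT.
apply/negP => /eqP sum0.
have [b bs [m pba]] : exists2 b, b \in s & exists m : nat, pairing b a = - m.+1%:R.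
  apply: contrapT => none.
  have [m mE] : exists m : nat, \sum_(b <- s) pairing b a = m%:R.
    have H b : b \in s -> exists m : nat, pairing b a = m%:R.
      move=> bs; have [//|neg] := pairing_cases ra (rs b bs).
      by case: none; exists b.
    elim: (s) H => [|b s' IH] H; first by exists 0%N; rewrite big_nil.
    have [|m mE] := IH; first by move=> c cs; apply: H; rewrite inE cs orbT.
    have [m' m'E] := H b (mem_head _ _).
    by exists (m' + m)%N; rewrite big_cons mE m'E natrD.
  have := congr1 (fun ga => pairing ga a) sum0.
  rewrite pairing0l pairing_suml big_cons (pairing_self char_k ssg sh ra) mE.
  by move/eqP; rewrite (negPf (natr_addr_neq0 char_k 1 m)).
have Pb : P b by apply: Ps; rewrite inE bs orbT.
have [ba0|rba] := root_add char_k ssg sh ra (pos_root Pb) pba.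
  by apply: (nP a) => //; rewrite -(addr0_eq ba0) opprK.
have sumE : \sum_(al <- (b + a) :: rem b s) al = 0.
  transitivity (\sum_(al <- a :: s) al); last exact: sum0.
  rewrite !big_cons [in RHS](big_rem b) //=.
  by rewrite addrA (addrC a b).
have /eqP := sumE; apply/negP/IHn => //=.
  by rewrite size_rem // prednK //; case: (s) bs.
move=> c; rewrite inE => /predU1P[->|/mem_rem cs]; first exact: addP.
by apply: Ps; rewrite inE cs orbT.
Qed.

Definition below ga de := exists s, (forall al, al \in s -> P al) /\
  ga - de = \sum_(al <- s) al.

(** A substitute for the height that needs no base: by [ht_lt], adding a positive root raises it. *)
Definition ht ga := count (fun de => `[< below ga de >]) roots.

Lemma ht_lt ga be : P be -> is_root (ga + be) -> (ht ga < ht (ga + be)%R)%N.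
Proof.
move=> Pb rgb; rewrite /ht -!size_filter; set p := fun de => _; set q := fun de => _.
have: (size ((ga + be)%R :: filter p roots) <= size (filter q roots))%N.
  apply: uniq_leq_size => [|de].
    rewrite /= filter_uniq ?roots_uniq // andbT mem_filter negb_and.
    apply/orP; left; apply/negP => /asboolP[s [Ps e]].
    have Ps' al : al \in be :: s -> P al by rewrite inE => /predU1P[->|/Ps].
    case/eqP: (pos_sum_neq0 Ps' isT).
    by rewrite big_cons -e opprD !addrA addrK subrr.
  rewrite inE !mem_filter => /predU1P[->|/andP[/asboolP[s [Ps e]] ->]].
    rewrite mem_roots rgb andbT; apply/asboolP; exists [::].
    by rewrite subrr big_nil.
  rewrite andbT; apply/asboolP; exists (be :: s); split.
    by move=> al; rewrite inE => /predU1P[->|/Ps].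
  by rewrite big_cons -e addrAC addrC.
done.
Qed.

Lemma ht_max ga : (ht ga <= size roots)%N.
Proof. exact: count_size. Qed.

Lemma ex_ht_max (A : h^* -> Prop) al : P al -> A al ->
  exists ep, [/\ P ep, A ep & forall be, P be -> A be -> (ht be <= ht ep)%N].
Proof.
move=> Pal Aal.
pose Q n := `[< exists ep, [/\ P ep, A ep & ht ep = n] >].
have exQ : exists n, Q n by exists (ht al); apply/asboolP; exists al.
have ubQ n : Q n -> (n <= size roots)%N.
  by move=> /asboolP[ep [_ _ <-]]; apply: ht_max.
case: (ex_maxnP exQ ubQ) => n /asboolP[ep [Pe Ae <-]] maxn.
by exists ep; split=> // be Pb Ab; apply: maxn; apply/asboolP; exists be.
Qed.

Lemma ex_ht_min (A : h^* -> Prop) al : P al -> A al ->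
  exists ep, [/\ P ep, A ep & forall be, P be -> A be -> (ht ep <= ht be)%N].
Proof.
move=> Pal Aal.
pose Q n := `[< exists ep, [/\ P ep, A ep & ht ep = n] >].
have exQ : exists n, Q n by exists (ht al); apply/asboolP; exists al.
case: (ex_minnP exQ) => n /asboolP[ep [Pe Ae <-]] minn.
by exists ep; split=> // be Pb Ab; apply: minn; apply/asboolP; exists be.
Qed.

End OneSystem.

(* For the positive roots of a base Pi, the resulting sequence enumerates the
   highest roots of the members of K(Pi), see cascade_greedy. *)
Inductive greedy (P : h^* -> Prop) : (h^* -> Prop) -> seq h^* -> Prop :=
| Greedy_nil A : (forall be, is_root be -> ~ A be) -> greedy P A [::]
| Greedy_cons A ep E : P ep -> A ep ->
    (forall be, P be -> A be -> ~~ is_root (ep + be)) ->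
    greedy P (fun be => A be /\ pairing be ep = 0) E -> greedy P A (ep :: E).

Lemma greedy_ext P A A' E : greedy P A E ->
  (forall be, is_root be -> A be <-> A' be) -> (forall al, P al -> is_root al) ->
  greedy P A' E.
Proof.
move=> gA; elim: gA A' => {A E} [A A0|A ep E Pe Ae maxe _ IH] A' AA' rP.
  by apply: Greedy_nil => be rb /(AA' be rb).2; apply: A0.
apply: Greedy_cons => //; first exact: (AA' ep (rP _ Pe)).1.
  by move=> be Pb /(AA' be (rP _ Pb)).2; apply: maxe.
by apply: IH => // be rb; rewrite AA'.
Qed.

Definition add_closed (A : h^* -> Prop) :=
  (forall be ga, A be -> A ga -> A (be + ga)) /\ (forall be, A be -> A (- be)).

Lemma ex_greedy P A : pos_system P -> add_closed A -> exists E, greedy P A E.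
Proof.
move=> posP; have [_ totP _ addP] := posP.
pose c A := count (fun be => `[< A be >]) roots.
move: {2}(c A) (leqnn (c A)) => n; elim: n A => [|n IHn] A cn [addA oppA].
  exists [::]; apply: Greedy_nil => be rb Ab; move: cn.
  rewrite leqNgt; case/negP; rewrite -has_count; apply/hasP; exists be.
    by rewrite mem_roots.
  exact/asboolP.
have [none|] := pselect (forall be, is_root be -> ~ A be).
  by exists [::]; apply: Greedy_nil.
move=> /existsNP[be /not_implyP[rb /contrapT Ab]].
have [al Pal Aal] : exists2 al, P al & A al.
  by have [Pb|Pb] := totP be rb; [exists be|exists (- be) => //; apply: oppA].
(* A root of greatest height in [A] cannot be increased within [A]. It is not orthogonal to itself,
   so the next predicate holds for fewer roots. *)
have [ep [Pe Ae maxe]] := ex_ht_max Pal Aal.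
have re := pos_root posP Pe.
have [||E gE] := IHn (fun be => A be /\ pairing be ep = 0).
- rewrite -ltnS; apply: leq_trans cn; rewrite /c -!size_filter.
  set p := fun de => _; set q := fun de => _.
  suff: (size (ep :: filter p roots) <= size (filter q roots))%N by [].
  apply: uniq_leq_size => [|de].
    rewrite /= filter_uniq ?roots_uniq // andbT mem_filter negb_and.
    apply/orP; left; apply/negP => /asboolP[_].
    by rewrite (pairing_self char_k ssg sh re) => /eqP; rewrite (negPf (natr_neq0 char_k 1)).
  rewrite inE !mem_filter => /predU1P[->|/andP[/asboolP[Ad _] ->]].
    by rewrite mem_roots re andbT; apply/asboolP.
  by rewrite andbT; apply/asboolP.
- split=> [b c' [Ab' b0] [Ac c0]|b [Ab' b0]].
    by split; [apply: addA|rewrite pairingDl b0 c0 addr0].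
  by split; [apply: oppA|rewrite pairingNl b0 oppr0].
exists (ep :: E); apply: Greedy_cons => // b Pb Ab'; apply/negP => rs.
have := ht_lt posP Pb rs; rewrite ltnNge maxe //; first exact: addP.
exact: addA.
Qed.

Definition refl al be : h^* := be - pairing be al *: al.

Section Reflection.
Variables (al : h^*) (ral : is_root al).

Lemma reflK : involutive (refl al).
Proof.
move=> be; rewrite /refl pairingBl pairingZl (pairing_self char_k ssg sh ral).
rewrite -addrA -opprD -scalerDl.
have -> : forall p : k, p + (p - p * 2%:R) = 0 by move=> p; ring.
by rewrite scale0r subr0.
Qed.

Lemma refl_root be : is_root (refl al be) = is_root be.
Proof.
apply/idP/idP => rb; last exact: (root_reflect char_k ssg sh ral rb).
by rewrite -[be]reflK; apply: (root_reflect char_k ssg sh ral rb).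
Qed.

Lemma refl_pairing be ga : is_root ga ->
  pairing (refl al be) (refl al ga) = pairing be ga.
Proof.
move=> rga; have rga' : is_root (refl al ga) by rewrite refl_root.
rewrite !(pairingE char_k ssg sh) //.
pose B (x y : h^*) : k := x (tdual char_k ssg sh y).
have BC x y : B x y = B y x by apply: tdualC.
have BDl x y z : B (x - y) z = B x z - B y z by rewrite /B add_lfunE opp_lfunE.
have BZl a x y : B (a *: x) y = a * B x y by rewrite /B scale_lfunE.
have BDr x y z : B x (y - z) = B x y - B x z by rewrite BC BDl !(BC x).
have BZr a x y : B x (a *: y) = a * B x y by rewrite BC BZl (BC x).
have Brefl x y : B (refl al x) (refl al y) = B x y.
  rewrite /refl !(pairingE char_k ssg sh) // -!/(B _ _).
  have nz : B al al != 0 := tdual_neq0 char_k ssg sh ral.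
  rewrite !BDl !BZl !BDr !BZr (BC al y).
  by move: nz; move: (B al al) (B x y) (B x al) (B y al) => p q r t nz; field.
by rewrite -!/(B _ _) !Brefl.
Qed.

Lemma refl_greedy P A E : (forall al, P al -> is_root al) -> greedy P A E ->
  greedy (fun be => P (refl al be)) (fun be => A (refl al be)) (map (refl al) E).
Proof.
move=> rP; elim=> {A E} [A A0|A ep E Pe Ae maxe _ IH] /=.
  by apply: Greedy_nil => be rb; apply: A0; rewrite refl_root.
have re := rP _ Pe.
apply: Greedy_cons; rewrite ?reflK //.
  move=> be Pb Ab; rewrite -[be]reflK -refl_root.
  have -> : refl al (refl al ep + refl al (refl al be)) = ep + refl al be.
    rewrite reflK /refl pairingDl pairingBl pairingZl.
    rewrite (pairing_self char_k ssg sh ral) scalerDl opprD addrACA.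
    congr (_ + _); rewrite -addrA -opprD -scalerDl.
    have -> : forall p : k, p + (p - p * 2%:R) = 0 by move=> p; ring.
    by rewrite scale0r subr0.
  by apply: maxe.
apply: (greedy_ext IH) => [be rb|be Pb]; last first.
  by rewrite -refl_root; apply: rP.
by rewrite -{1}[be]reflK -(refl_pairing _ re) !reflK.
Qed.

End Reflection.

(** Subtracting [al] from a positive root cannot yield a negative root, because [al] would then
    decompose. For a positive pairing [al] is subtracted step by step; for a negative one
    [pos_sum_neq0] excludes a negative result. *)
Lemma indecomposable_refl P al be : pos_system P -> P al ->
  (forall b c, P b -> P c -> al <> b + c) ->
  P be -> be != al -> P (refl al be).
Proof.
move=> posP Pal ind Pbe ne; have [rP totP nP addP] := posP.
have ral := rP _ Pal.
have sub1 b : P b -> is_root (b - al) -> P (b - al).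
  move=> Pb rb; have [//|Pn] := totP _ rb.
  by case: (ind (- (b - al)) b) => //; rewrite opprB subrK.
have rbe := rP _ Pbe.
have [[n pE]|[n pE]] := pairing_cases ral rbe; last first.
  have rr : is_root (refl al be) by rewrite refl_root.
  have [//|Pn] := totP _ rr.
  have Ps x : x \in - refl al be :: be :: nseq n.+1 al -> P x.
    by rewrite !inE mem_nseq => /orP[/eqP->|/orP[/eqP->|/orP[/eqP->|/andP[_ /eqP->]]]].
  case/eqP: (pos_sum_neq0 posP Ps isT).
  rewrite !big_cons big_nseq iter_addr_0 /refl pE scaleNr scaler_nat opprK.
  by rewrite -mulrS addNr.
rewrite /refl pE scaler_nat; move: {2}n (leqnn n) => m.
elim: m n be Pbe ne rbe pE => [|m IHm] n be Pbe ne rbe pE.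
  by rewrite leqn0 => /eqP->; rewrite mulr0n subr0.
case: n pE => [|n] pE; first by rewrite mulr0n subr0.
move=> le.
have rba : is_root (be - al).
  have [e|//] := root_sub char_k ssg sh ral rbe pE.
  by case/eqP: ne; apply: (subr0_eq e).
have Pba := sub1 _ Pbe rba.
case: n pE le => [|n] pE le; first by rewrite mulr1n.
have rr : is_root (be - al *+ n.+2).
  by have := root_reflect char_k ssg sh ral rbe; rewrite pE scaler_nat.
(* The pairing drops by 2, so induction reaches [be - al *+ n.+1]; one more subtraction is allowed
   because the reflected element is known to be a root. *)
have pba : pairing (be - al) al = n%:R.
  rewrite pairingBl pE (pairing_self char_k ssg sh ral).
  by rewrite -natrB // !subSS subn0.
have nba : be - al != al.
  rewrite subr_eq; apply/eqP => e; have := root_double char_k ssg sh ral.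
  by rewrite -e rbe.
have := IHm n _ Pba nba rba pba (ltnW (le : (n.+1 < m.+1)%N)).
rewrite -addrA -opprD -mulrS => Pd.
have -> : be - al *+ n.+2 = be - al *+ n.+1 - al.
  by rewrite -addrA -opprD -mulrSr.
apply: (sub1 _ Pd); rewrite -addrA -opprD -mulrSr; exact: rr.
Qed.

Lemma refl_pos_system P al : pos_system P -> is_root al ->
  pos_system (fun be => P (refl al be)).
Proof.
move=> [rP totP nP addP] ral.
have reflN be : refl al (- be) = - refl al be.
  by rewrite /refl pairingNl scaleNr opprB opprK addrC.
have reflD be ga : refl al (be + ga) = refl al be + refl al ga.
  by rewrite /refl pairingDl scalerDl opprD addrACA.
split=> [be /rP|be rb|be Pb|be ga Pb Pg rbg].
- by rewrite refl_root.
- by rewrite reflN; apply: totP; rewrite refl_root.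
- by rewrite reflN; apply: nP.
rewrite reflD; apply: (addP _ _ Pb Pg); rewrite -reflD (refl_root ral); exact: rbg.
Qed.

(** Induction on the number of roots of [P] outside [Q]. One of least height is indecomposable,
    since both summands would be in [Q]; the reflection in it makes it negative, permutes the other
    roots of [P], and carries the greedy sequence along. *)
Lemma greedy_length P Q E : pos_system P -> pos_system Q ->
  greedy P (fun _ => True) E ->
  exists2 E', greedy Q (fun _ => True) E' & size E' = size E.
Proof.
move=> posP posQ gE; have [rQ totQ nQ addQ] := posQ.
pose c P := count (fun be => `[< P be /\ ~ Q be >]) roots.
move: {2}(c P) (leqnn (c P)) => n; elim: n P E posP gE => [|n IHn] P E posP gE cn.
  have PQ : P = Q.
    have [rP totP nP addP] := posP.
    have sPQ be : P be -> Q be.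
      move=> Pb; apply: contrapT => nQb; move: cn; rewrite leqNgt; case/negP.
      rewrite -has_count; apply/hasP; exists be; last exact/asboolP.
      by rewrite mem_roots; apply: rP.
    apply/funext => be; apply/propext; split=> [/sPQ//|Qb].
    have [//|Pn] := totP _ (rQ _ Qb).
    by case: (nQ _ Qb); apply: sPQ.
  by exists E; rewrite -?PQ.
have [rP totP nP addP] := posP.
have [[be [Pb nQb]]|none] := pselect (exists be, P be /\ ~ Q be); last first.
  apply: (IHn P E) => //; rewrite /c; apply: leq_trans (leq0n n).
  rewrite leqNgt -has_count; apply/negP.
  by move=> /hasP [be _ /asboolP bb]; apply: none; exists be.
have [al [Pal nQal minal]] := @ex_ht_min P (fun be => ~ Q be) be Pb nQb.
have ral := rP _ Pal.
have ind b ga : P b -> P ga -> al <> b + ga.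
  move=> Pb' Pg e; apply: nQal; have [Qb|nQb'] := pselect (Q b); last first.
    have := ht_lt posP Pg (_ : is_root (b + ga)); rewrite -e => /(_ ral).
    by rewrite ltnNge minal.
  have [Qg|nQg] := pselect (Q ga); last first.
    have := ht_lt posP Pb' (_ : is_root (ga + b)); rewrite addrC -e => /(_ ral).
    by rewrite ltnNge minal.
  rewrite e; apply: (addQ _ _ Qb Qg); rewrite -e; exact: ral.
have [E' gE' eE'] : exists2 E', greedy Q (fun _ => True) E' &
    size E' = size (map (refl al) E).
  apply: (IHn (fun be => P (refl al be))).
  - exact: refl_pos_system.
  - exact: refl_greedy gE.
  rewrite -ltnS; apply: leq_trans cn; rewrite /c -!size_filter.
  set p := fun de => _; set q := fun de => _.
  suff: (size (al :: filter p roots) <= size (filter q roots))%N by [].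
  have reflal : refl al al = - al.
    rewrite /refl (pairing_self char_k ssg sh ral) scaler_nat mulr2n opprD.
    by rewrite addrA subrr sub0r.
  apply: uniq_leq_size => [|de].
    rewrite /= filter_uniq ?roots_uniq // andbT mem_filter negb_and.
    apply/orP; left; apply/negP => /asboolP[]; rewrite reflal => Pn _.
    exact: (nP al).
  rewrite inE !mem_filter => /predU1P[->|/andP[/asboolP[Pd nQd] rd]].
    by rewrite mem_roots ral andbT; apply/asboolP.
  rewrite rd andbT; apply/asboolP; split=> //.
  have [e|nde] := eqVneq (refl al de) al.
    case: nQd; have -> : de = - al by rewrite -(reflK ral de) e reflal.
    by have [|//] := totQ _ ral.
  by rewrite -[de](reflK ral); apply: indecomposable_refl.
by exists E'; rewrite // eE' size_map.
Qed.

(** The indexed form of [greedy], suited to arguments about the first root of the sequence not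
    orthogonal to a given one. *)
Definition kostant (P : h^* -> Prop) E := forall i, (i < size E)%N ->
  [/\ P E`_i, forall j, (j < i)%N -> pairing E`_i E`_j = 0 &
     forall be, P be -> (forall j, (j < i)%N -> pairing be E`_j = 0) ->
       ~~ is_root (E`_i + be)].

Lemma greedy_kostant P E : greedy P (fun _ => True) E ->
  kostant P E /\ forall be, is_root be ->
    exists2 i, (i < size E)%N & pairing be E`_i != 0.
Proof.
suff H A : greedy P A E -> (forall i, (i < size E)%N ->
  [/\ P E`_i, A E`_i, forall j, (j < i)%N -> pairing E`_i E`_j = 0 &
     forall be, P be -> A be -> (forall j, (j < i)%N -> pairing be E`_j = 0) ->
       ~~ is_root (E`_i + be)]) /\ forall be, is_root be -> A be ->
    exists2 i, (i < size E)%N & pairing be E`_i != 0.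
  move=> /H[H1 H2]; split=> [i /H1[Pi _ oi maxi]|be rb]; last exact: H2.
  by split=> // be Pb; apply: maxi.
elim=> {A E} [A A0|A ep E Pe Ae maxe _ [IH1 IH2]].
  by split=> // be rb Ab; case: (A0 be).
split=> [[|i] /= iE|be rb Ab].
- by split=> // be Pb Ab _; apply: maxe.
- have [Pi [Ai pi0] oi maxi] := IH1 i iE; split=> // [[|j] //= ji|be Pb Ab b0].
    exact: oi.
  apply: maxi => // [|j ji]; last exact: (b0 j.+1).
  by split=> //; apply: (b0 0%N).
have [b0|nz] := eqVneq (pairing be ep) 0; last by exists 0%N.
by have [i iE nz] := IH2 be rb (conj Ab b0); exists i.+1.
Qed.

End PositiveSystems.

(** * Polynomial functions *)

Section Mpoly.
Variables (K : fieldType) (n : nat).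
Implicit Types (p q : {mpoly K[n]}).

Lemma mpoly_ring_ind (P : {mpoly K[n]} -> Prop) :
  (forall c, P c%:MP) -> (forall i, P 'X_i) ->
  (forall p q, P p -> P q -> P (p + q)) -> (forall p q, P p -> P q -> P (p * q)) ->
  forall p, P p.
Proof.
move=> PC PX PD PM p; rewrite (mpolyE p).
elim/big_ind: _ => [|x y|m _]; [by rewrite -mpolyC0|exact: PD|].
rewrite -mul_mpolyC; apply: (PM _ _) => //; rewrite mpolyXE_id.
elim/big_ind: _ => [|x y|i _]; [by rewrite -mpolyC1|exact: PM|].
by elim: (m i) => [|j IH]; rewrite ?expr0 -?mpolyC1 // exprS; apply: (PM _ _).
Qed.

Lemma mderiv_XU (i j : 'I_n) : ('X_i : {mpoly K[n]})^`M(j) = (i == j)%:R.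
Proof.
rewrite mderivX mnm1E; case: eqVneq => [->|_]; last by rewrite scale0r.
rewrite (_ : (U_(j) - U_(j))%MM = 0%MM) ?mpolyX0 ?scale1r //.
by apply/mnmP => l; rewrite mnmBE mnm0E subnn.
Qed.

Definition mcurve (c : 'I_n -> {poly K}) p : {poly K} := mmap (@polyC K) c p.

Lemma mcurveC c a : mcurve c a%:MP = a%:P. Proof. exact: mmapC. Qed.
Lemma mcurveX c i : mcurve c 'X_i = c i.
Proof. by rewrite /mcurve mmapX mmap1U. Qed.
Lemma mcurveD c p q : mcurve c (p + q) = mcurve c p + mcurve c q.
Proof. exact: mmapD. Qed.
Lemma mcurveM c p q : mcurve c (p * q) = mcurve c p * mcurve c q.
Proof. exact: rmorphM. Qed.

Lemma mcurve_horner c p t : (mcurve c p).[t] = p.@[fun i => (c i).[t]].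
Proof.
elim/mpoly_ring_ind: p => [a|i|p q IHp IHq|p q IHp IHq].
- by rewrite mcurveC hornerC mevalC.
- by rewrite mcurveX mevalXU.
- by rewrite mcurveD hornerD IHp IHq mevalD.
by rewrite mcurveM hornerM IHp IHq mevalM.
Qed.

Lemma mcurve_deriv c p :
  (mcurve c p)^`() = \sum_i mcurve c p^`M(i) * (c i)^`().
Proof.
elim/mpoly_ring_ind: p => [a|i|p q IHp IHq|p q IHp IHq].
- rewrite mcurveC derivC big1 // => i _.
  by rewrite mderivC -mpolyC0 mcurveC mul0r.
- rewrite mcurveX (bigD1 i) //= big1 => [|j ji].
    by rewrite mderiv_XU eqxx -mpolyC1 mcurveC mul1r addr0.
  by rewrite mderiv_XU eq_sym (negPf ji) mulr0n -mpolyC0 mcurveC mul0r.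
- rewrite mcurveD derivD IHp IHq -big_split; apply: eq_bigr => i _.
  by rewrite mderivD mcurveD mulrDl.
rewrite mcurveM derivM IHp IHq mulr_suml mulr_sumr -big_split.
apply: eq_bigr => i _; rewrite mderivM mcurveD !mcurveM /=; ring.
Qed.

End Mpoly.

Section PolyFun.
Variables (K : fieldType).
Implicit Types (V W : vectType K).

Definition polyfun V (F : V -> K) :=
  exists p : {mpoly K[\dim {:V}]}, forall v, F v = p.@[vcoord v].

Lemma polyfunC V c : polyfun (fun _ : V => c).
Proof. by exists c%:MP => v; rewrite mevalC. Qed.

Lemma polyfunD V (F G : V -> K) :
  polyfun F -> polyfun G -> polyfun (fun v => F v + G v).
Proof. by move=> [p Fp] [q Gq]; exists (p + q) => v; rewrite mevalD Fp Gq. Qed.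

Lemma polyfunM V (F G : V -> K) :
  polyfun F -> polyfun G -> polyfun (fun v => F v * G v).
Proof. by move=> [p Fp] [q Gq]; exists (p * q) => v; rewrite mevalM Fp Gq. Qed.

Lemma polyfun_coord V i : polyfun (fun v : V => vcoord v i).
Proof. by exists 'X_i => v; rewrite mevalXU. Qed.

Lemma polyfun_ext V (F G : V -> K) : F =1 G -> polyfun F -> polyfun G.
Proof. by move=> e [p Fp]; exists p => v; rewrite -e. Qed.

Lemma polyfun_sum V I (r : seq I) (F : I -> V -> K) :
  (forall i, polyfun (F i)) -> polyfun (fun v => \sum_(i <- r) F i v).
Proof.
move=> pF; elim: r => [|i r IHr].
  by apply: (polyfun_ext _ (polyfunC V 0)) => v; rewrite big_nil.
by apply: (polyfun_ext _ (polyfunD (pF i) IHr)) => v; rewrite big_cons.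
Qed.

Lemma polyfun_prod V I (r : seq I) (F : I -> V -> K) :
  (forall i, polyfun (F i)) -> polyfun (fun v => \prod_(i <- r) F i v).
Proof.
move=> pF; elim: r => [|i r IHr].
  by apply: (polyfun_ext _ (polyfunC V 1)) => v; rewrite big_nil.
by apply: (polyfun_ext _ (polyfunM (pF i) IHr)) => v; rewrite big_cons.
Qed.

Lemma polyfun_exp V (F : V -> K) m : polyfun F -> polyfun (fun v => F v ^+ m).
Proof.
move=> pF; elim: m => [|m IHm]; first exact: polyfunC.
by apply: (polyfun_ext _ (polyfunM pF IHm)) => v; rewrite exprS.
Qed.

Lemma vcoord_expand V (v : V) : v = \sum_i vcoord v i *: (vbasis {:V})`_i.
Proof. exact: coord_vbasis (memvf v). Qed.

Lemma vcoordD V (u v : V) i : vcoord (u + v) i = vcoord u i + vcoord v i.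
Proof. exact: linearD. Qed.
Lemma vcoordZ V a (v : V) i : vcoord (a *: v) i = a * vcoord v i.
Proof. exact: linearZ. Qed.
Lemma vcoord_sum V I (r : seq I) (F : I -> V) i :
  vcoord (\sum_(j <- r) F j) i = \sum_(j <- r) vcoord (F j) i.
Proof. exact: linear_sum. Qed.
Lemma polyfun_lin V (F : V -> K) :
  (forall a x y, F (a *: x + y) = a * F x + F y) -> polyfun F.
Proof.
move=> lF.
have F0 : F 0 = 0 by have := lF (-1) 0 0; rewrite scaler0 addr0 mulN1r addNr.
pose G (v : V) := \sum_i vcoord v i * F (vbasis {:V})`_i.
apply: (@polyfun_ext _ G).
  move=> v; rewrite /G [in RHS](vcoord_expand v).
  by apply/esym; elim/big_rec2: _ => [//|i a x _ <-]; apply: lF.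
apply: polyfun_sum => i; apply: polyfunM; first exact: polyfun_coord.
exact: polyfunC.
Qed.

Lemma polyfun_comp V W (T : V -> W) (F : W -> K) :
  (forall i, polyfun (fun v => vcoord (T v) i)) -> polyfun F ->
  polyfun (fun v => F (T v)).
Proof.
move=> pT [p Fp]; apply: (@polyfun_ext _ (fun v => p.@[vcoord (T v)])).
  by move=> v; rewrite Fp.
elim/mpoly_ring_ind: p {Fp} => [c|i|p q|p q].
- by apply: (polyfun_ext _ (polyfunC V c)) => v; rewrite mevalC.
- by apply: (polyfun_ext _ (pT i)) => v; rewrite mevalXU.
- by move=> pp pq; apply: (polyfun_ext _ (polyfunD pp pq)) => v; rewrite mevalD.
by move=> pp pq; apply: (polyfun_ext _ (polyfunM pp pq)) => v; rewrite mevalM.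
Qed.

(** Regular functions on the open set where [D] does not vanish; the values of [F] elsewhere are
    left free, which accommodates division by 0. *)
Definition ratfun V (D F : V -> K) := exists N (P : V -> K),
  polyfun P /\ forall v, D v != 0 -> D v ^+ N * F v = P v.

Section RatFun.
Variables (V : vectType K) (D : V -> K) (pD : polyfun D).

Lemma ratfun_poly F : polyfun F -> ratfun D F.
Proof. by exists 0%N, F; split=> // v _; rewrite expr0 mul1r. Qed.

Lemma ratfun_ext F G : (forall v, D v != 0 -> F v = G v) -> ratfun D F -> ratfun D G.
Proof. by move=> e [N [P [pP H]]]; exists N, P; split=> // v Dv; rewrite -e ?H. Qed.

Lemma ratfunD F G : ratfun D F -> ratfun D G -> ratfun D (fun v => F v + G v).
Proof.
move=> [N [P [pP FP]]] [M [Q [pQ GQ]]].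
exists (N + M)%N, (fun v => D v ^+ M * P v + D v ^+ N * Q v); split.
  by apply: polyfunD; apply: polyfunM => //; apply: polyfun_exp.
by move=> v Dv; rewrite -FP // -GQ // exprD; ring.
Qed.

Lemma ratfunM F G : ratfun D F -> ratfun D G -> ratfun D (fun v => F v * G v).
Proof.
move=> [N [P [pP FP]]] [M [Q [pQ GQ]]].
exists (N + M)%N, (fun v => P v * Q v); split; first exact: polyfunM.
by move=> v Dv; rewrite -FP // -GQ // exprD; ring.
Qed.

Lemma ratfun_sum I (r : seq I) (F : I -> V -> K) :
  (forall i, ratfun D (F i)) -> ratfun D (fun v => \sum_(i <- r) F i v).
Proof.
move=> rF; elim: r => [|i r IHr].
  by apply: (ratfun_ext _ (ratfun_poly (polyfunC V 0))) => v; rewrite big_nil.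
by apply: (ratfun_ext _ (ratfunD (rF i) IHr)) => v; rewrite big_cons.
Qed.

Lemma ratfun_exp F m : ratfun D F -> ratfun D (fun v => F v ^+ m).
Proof.
move=> rF; elim: m => [|m IHm]; first exact/ratfun_poly/polyfunC.
by apply: (ratfun_ext _ (ratfunM rF IHm)) => v; rewrite exprS.
Qed.

Lemma ratfun_div F : polyfun F -> ratfun D (fun v => F v / D v).
Proof. by move=> pF; exists 1%N, F; split=> // v Dv; rewrite expr1 mulrC divfK. Qed.

Lemma ratfun_comp W (T : V -> W) (F : W -> K) :
  (forall i, ratfun D (fun v => vcoord (T v) i)) -> polyfun F ->
  ratfun D (fun v => F (T v)).
Proof.
move=> rT [p Fp]; apply: (@ratfun_ext (fun v => p.@[vcoord (T v)])).
  by move=> v; rewrite Fp.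
elim/mpoly_ring_ind: p {Fp} => [c|i|p q|p q].
- by apply: (ratfun_ext _ (ratfun_poly (polyfunC V c))) => v; rewrite mevalC.
- by apply: (ratfun_ext _ (rT i)) => v; rewrite mevalXU.
- by move=> pp pq; apply: (ratfun_ext _ (ratfunD pp pq)) => v; rewrite mevalD.
by move=> pp pq; apply: (ratfun_ext _ (ratfunM pp pq)) => v; rewrite mevalM.
Qed.

End RatFun.

End PolyFun.

Section CharZero.
Variables (K : fieldType) (char_K : [pchar K] =i pred0).

Lemma natr_inj0 : injective (fun n : nat => n%:R : K).
Proof.
move=> m n; wlog mn : m n / (m <= n)%N => [H|].
  by case/orP: (leq_total m n) => le e; [|apply/esym]; apply: H.
move=> /eqP; rewrite eq_sym -subr_eq0 -natrB //.
by move/pcharf0P: char_K => ->; rewrite subn_eq0 => nm; apply/eqP; rewrite eqn_leq mn.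
Qed.

Lemma poly_ex_nonroot (p : {poly K}) : p != 0 -> exists t, p.[t] != 0.
Proof.
move=> nz_p; apply: contrapT => none.
pose r : seq K := map (fun n : nat => n%:R) (iota 0 (size p)).
have ur : uniq r by rewrite (map_inj_uniq natr_inj0) iota_uniq.
have rp : all (root p) r.
  by apply/allP => t _; apply: contrapT => /negP nt; apply: none; exists t.
by have := max_poly_roots nz_p rp ur; rewrite size_map size_iota ltnn.
Qed.

Lemma poly_eq_horner (p q : {poly K}) : (forall t, p.[t] = q.[t]) -> p = q.
Proof.
move=> e; apply/subr0_eq/eqP; apply: contraT => /poly_ex_nonroot[t].
by rewrite hornerD hornerN e subrr eqxx.
Qed.

Lemma poly_derivs_eq0 (p : {poly K}) : (forall n, p^`(n).[0] = 0) -> p = 0.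
Proof.
move=> p0; apply/polyP => n; have := p0 n; rewrite horner_coef0 coef_derivn addn0.
rewrite coef0 ffactnn -mulr_natr => /eqP; rewrite mulf_eq0.
by move/pcharf0P: char_K => ->; rewrite -leqn0 leqNgt fact_gt0 orbF => /eqP.
Qed.

Lemma polyfun_line (V : vectType K) (p : {mpoly K[\dim {:V}]}) (a b : V) :
  exists q : {poly K}, (forall t, q.[t] = p.@[vcoord (a + t *: b)]) /\
    q^`().[0] = \sum_i p^`M(i).@[vcoord a] * vcoord b i.
Proof.
pose c i : {poly K} := (vcoord a i)%:P + vcoord b i *: 'X.
have cE t : (fun i => (c i).[t]) =1 vcoord (a + t *: b).
  by move=> i; rewrite !hornerE vcoordD vcoordZ mulrC.
exists (mcurve c p); split=> [t|].
  by rewrite mcurve_horner; apply: meval_eq.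
rewrite mcurve_deriv horner_sum; apply: eq_bigr => i _; rewrite hornerM mcurve_horner.
congr (_ * _); first by apply: meval_eq => j; rewrite cE scale0r addr0.
by rewrite derivD derivC derivZ derivX add0r !hornerE.
Qed.

(** On the line through [a] and [b] both functions become nonzero polynomials in one variable, and
    in characteristic zero their product has a nonroot. *)
Lemma polyfun_neq0_meet (V : vectType K) (F G : V -> K) a b :
  polyfun F -> polyfun G -> F a != 0 -> G b != 0 -> exists v, F v != 0 /\ G v != 0.
Proof.
move=> [p Fp] [q Gq] Fa Gb.
have [f [fE _]] := polyfun_line p a (b - a).
have [f' [f'E _]] := polyfun_line q a (b - a).
have nzf : f != 0.
  by apply: contraNneq Fa => f0; rewrite Fp -[a]addr0 -(scale0r (b - a)) -fE f0 horner0.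
have nzf' : f' != 0.
  apply: contraNneq Gb => f0.
  have -> : b = a + 1 *: (b - a) by rewrite scale1r addrC subrK.
  by rewrite Gq -f'E f0 horner0.
have [t] := poly_ex_nonroot (mulf_neq0 nzf nzf').
rewrite hornerM mulf_eq0 negb_or fE f'E -Fp -Gq => /andP[? ?].
by exists (a + t *: (b - a)).
Qed.

End CharZero.

(** * Exponentials in the adjoint group *)

Section Exponential.
Variables (K : fieldType) (char_K : [pchar K] =i pred0).
Variables (V : vectType K) (N : 'End(V)) (m : nat).
Hypothesis Nm : forall v, iter m N v = 0.

Definition lexp t : 'End(V) := \sum_(i < m) (t ^+ i / i`!%:R) *: lpow N i.

Lemma fact_neq0 i : (i`!%:R : K) != 0.
Proof. by move/pcharf0P: char_K => ->; rewrite -lt0n fact_gt0. Qed.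

Lemma lpow0 i : (m <= i)%N -> lpow N i = 0.
Proof.
move=> mi; apply/lfunP => v; rewrite lpowE zero_lfunE -(subnKC mi) addnC iterD Nm.
by elim: (i - m)%N => //= j ->; rewrite linear0.
Qed.

Lemma lexp_widen t M : (m <= M)%N ->
  lexp t = \sum_(i < M) (t ^+ i / i`!%:R) *: lpow N i.
Proof.
move=> mM; rewrite /lexp (big_ord_widen M (fun i => (t ^+ i / i`!%:R) *: lpow N i)) //.
rewrite big_mkcond; apply: eq_bigr => i _; case: ltnP => // mi.
by rewrite lpow0 // scaler0.
Qed.

Lemma lexp0 : lexp 0 = \1%VF.
Proof.
rewrite (lexp_widen 0 (leqnSn m)) big_ord_recl big1 => [|i _].
  by rewrite expr0 fact0 divr1 scale1r addr0.
by rewrite exprS mul0r mul0r scale0r.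
Qed.

(** If [j.+1] is the least exponent killing [v], applying the [j]-th power of [N] to the exponential
    of [v] leaves only the constant term, so for [v] in the kernel [j] would already do. *)
Lemma lexp_inj t : lker (lexp t) = 0%VS.
Proof.
apply/eqP; rewrite -subv0; apply/subvP => v; rewrite memv_ker memv0 => /eqP Ev.
have exj : exists j, iter j N v == 0 by exists m; rewrite Nm.
case: (ex_minnP exj) => -[|j] /eqP j0 minj; first by rewrite /= in j0; rewrite j0.
have := congr1 (iter j N) Ev.
have -> : iter j N 0 = 0 :> V by elim: (j) => //= i ->; rewrite linear0.
rewrite (lexp_widen t (leqnSn m)) sum_lfunE big_ord_recl.
have linj : linear (iter j N).
  by elim: (j) => [//|i IHi] a x y /=; rewrite IHi linearP.
have -> : forall x y, iter j N (x + y) = iter j N x + iter j N y.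
  by move=> x y; rewrite -[x in LHS]scale1r linj scale1r.
rewrite expr0 fact0 divr1 scale1r id_lfunE.
have -> : iter j N (\sum_(i < m) (t ^+ lift ord0 i / (lift ord0 i)`!%:R *: lpow N (lift ord0 i)) v) = 0.
  elim/big_rec: _ => [|i x _ IH].
    by elim: (j) => //= i ->; rewrite linear0.
  rewrite scale_lfunE linj IH addr0 lpowE -iterD addnC iterD.
  have -> : iter (lift ord0 i) N (iter j N v) = iter i N (iter j.+1 N v).
    by rewrite lift0 iterSr.
  rewrite j0; have -> : iter i N 0 = 0 :> V; last by rewrite scaler0.
  by elim: (nat_of_ord i) => //= l ->; rewrite linear0.
rewrite addr0 => /eqP j0'; have := minj j j0'; by rewrite ltnn.
Qed.

Definition lexp_curve (i : 'I_(\dim {:'End(V)})) : {poly K} :=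
  \sum_(l < m) (vcoord (lpow N l) i / l`!%:R) *: 'X^l.

Lemma lexp_curveE i t : (lexp_curve i).[t] = vcoord (lexp t) i.
Proof.
rewrite /lexp_curve horner_sum /lexp vcoord_sum; apply: eq_bigr => l _.
by rewrite hornerZ hornerXn vcoordZ; ring.
Qed.

Lemma lexp_curve_deriv i t : (lexp_curve i)^`().[t] = vcoord (lexp t \o N)%VF i.
Proof.
have -> : (lexp t \o N)%VF = \sum_(l < m) (t ^+ l / l`!%:R) *: lpow N l.+1.
  apply/lfunP => v; rewrite comp_lfunE !sum_lfunE; apply: eq_bigr => l _.
  by rewrite !scale_lfunE !lpowE iterSr.
rewrite vcoord_sum /lexp_curve.
have -> : (\sum_(l < m) (vcoord (lpow N l) i / l`!%:R) *: 'X^l : {poly K}) =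
    \sum_(l < m.+1) (vcoord (lpow N l) i / l`!%:R) *: 'X^l.
  rewrite big_ord_recr /= lpow0 //.
  have -> : vcoord (0 : 'End(V)) i = 0 by rewrite -(scale0r 0) vcoordZ mul0r.
  by rewrite mul0r scale0r addr0.
rewrite (linear_sum (@deriv K)) /= horner_sum big_ord_recl derivZ derivXn mulr0n scaler0 horner0 add0r.
apply: eq_bigr => l _; rewrite derivZ derivXn /= vcoordZ hornerZ hornerMn hornerXn.
rewrite /bump /= add0n add1n factS natrM -(mulr_natr (t ^+ l)).
have := fact_neq0 l; have : (l.+1%:R : K) != 0 by move/pcharf0P: char_K => ->.
by move: (l.+1%:R) (l`!%:R) => a b na nb; field; rewrite na nb.
Qed.

End Exponential.

Section ExpAutomorphism.
Variables (K : fieldType) (char_K : [pchar K] =i pred0).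
Variables (a : lieAlgType K) (N : 'End(a)) (m : nat).
Hypothesis derN : derivation N.
Hypothesis Nm : forall v, iter m N v = 0.

Let d i (v : a) := (i`!%:R : K)^-1 *: lpow N i v.

Let dS i v : i.+1%:R *: d i.+1 v = N (d i v).
Proof.
rewrite /d scalerA factS natrM invfM mulrA divff; last first.
  by move/pcharf0P: char_K => ->.
by rewrite div1r linearZ /= comp_lfunE.
Qed.

Let d0 i v : (m <= i)%N -> d i v = 0.
Proof. by move=> mi; rewrite /d (lpow0 Nm) // zero_lfunE scaler0. Qed.

Let leibniz n y z : d n [lie y, z] = \sum_(i < n.+1) [lie d i y, d (n - i)%N z].
Proof.
elim: n => [|n IHn].
  by rewrite big_ord1 /d fact0 invr1 !scale1r !id_lfunE.
have nz : (n.+1%:R : K) != 0 by move/pcharf0P: char_K => ->.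
apply: (scalerI nz); rewrite dS IHn linear_sum scaler_sumr /=.
rewrite (eq_bigr (fun i : 'I_n.+1 => i.+1%:R *: [lie d i.+1 y, d (n - i)%N z] +
   (n - i).+1%:R *: [lie d i y, d (n - i).+1 z])); last first.
  move=> i _; by rewrite derN -!dS (lieZl i.+1%:R) (lieZr (n - i).+1%:R).
rewrite big_split /=.
rewrite [in RHS](eq_bigr (fun i : 'I_n.+2 => i%:R *: [lie d i y, d (n.+1 - i)%N z] +
   (n.+1 - i)%:R *: [lie d i y, d (n.+1 - i)%N z])); last first.
  by move=> i _; rewrite -scalerDl -natrD subnKC // -ltnS.
rewrite [in RHS]big_split /=; congr (_ + _).
  rewrite [in RHS]big_ord_recl scale0r add0r; apply: eq_bigr => i _.
  by rewrite lift0 subSS.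
rewrite [in RHS]big_ord_recr /= subnn scale0r addr0; apply: eq_bigr => i _ /=.
by rewrite subSn // -ltnS.
Qed.

Lemma lexp_br y z : lexp N m 1 [lie y, z] = [lie lexp N m 1 y, lexp N m 1 z].
Proof.
have eE v M : (m <= M)%N -> lexp N m 1 v = \sum_(i < M) d i v.
  move=> mM; rewrite (lexp_widen Nm 1 mM) sum_lfunE; apply: eq_bigr => i _.
  by rewrite scale_lfunE expr1n mul1r.
(* With [m + m] as common bound, the triangle of indices contains every pair with both indices below
   [m], and all other terms vanish. *)
pose M := (m + m)%N; have mM : (m <= M)%N by apply: leq_addr.
rewrite (eE [lie y, z] M mM) (eE y M mM) (eE z M mM).
rewrite (eq_bigr (fun n : 'I_M =>
  \sum_(i < M | (i < n.+1)%N) [lie d i y, d (n - i)%N z])); last first.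
  move=> n _; rewrite leibniz.
  by rewrite (big_ord_widen M (fun i => [lie d i y, d (n - i)%N z])) // ltn_ord.
rewrite (exchange_big_dep predT) //= lie_suml; apply: eq_bigr => i _.
rewrite lie_sumr (eq_bigl (fun n : 'I_M => (i <= n)%N)); last by move=> n; rewrite ltnS.
rewrite -(big_geq_mkord i M (fun _ => true) (fun n => [lie d i y, d (n - i)%N z])).
rewrite -{1}[nat_of_ord i]add0n big_addn big_mkord.
rewrite (eq_bigr (fun j : 'I_(M - i) => [lie d i y, d j z])); last first.
  by move=> j _; rewrite addnK.
have [im|mi] := ltnP i m; last first.
  by rewrite !big1 // => j _; rewrite d0 // lie0l.
rewrite (big_ord_widen M (fun j => [lie d i y, d j z])) ?leq_subr // big_mkcond.
apply: eq_bigr => j _; case: ltnP => // jM.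
rewrite (_ : d j z = 0) ?lie0r //; apply: d0; apply: leq_trans jM.
by rewrite /M -addnBA ?leq_addr // ltnW.
Qed.

Lemma lexp_automorphism : lie_automorphism (lexp N m 1).
Proof. by split; [apply: lexp_inj|apply: lexp_br]. Qed.

End ExpAutomorphism.

Section ExpGroup.
Variables (K : fieldType) (char_K : [pchar K] =i pred0).
Variables (a : lieAlgType K).

Local Open Scope classical_set_scope.

(* Left translates of the tangent condition show that p |-> (u |-> dp_u(u N))
   preserves the polynomials vanishing on G; hence p (exp (t N)) has vanishing
   Taylor coefficients. *)
Lemma lexp_in_group (G : set 'End(a)) (N : 'End(a)) m :
  algebraic_subgroup_aut G -> lie_algebra_of G N -> (forall v, iter m N v = 0) ->
  G (lexp N m 1).
Proof.
move=> [autG G1 GM GV [Z [I ZI] GZ]] tN Nm.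
pose J (p : {mpoly K[\dim {:'End(a)}]}) := forall u, G u -> p.@[vcoord u] = 0.
have exD p : exists q : {mpoly K[\dim {:'End(a)}]}, forall u,
    q.@[vcoord u] = \sum_i p^`M(i).@[vcoord u] * vcoord (u \o N)%VF i.
  have [q qE] : polyfun (fun u : 'End(a) =>
      \sum_i p^`M(i).@[vcoord u] * vcoord (u \o N)%VF i).
    apply: polyfun_sum => i; apply: polyfunM; first by exists p^`M(i).
    apply: polyfun_lin => c x y; rewrite comp_lfunDl -comp_lfunZl.
    by rewrite vcoordD vcoordZ.
  by exists q => u; rewrite -qE.
pose D p := sval (cid (exD p)).
have DE p u : (D p).@[vcoord u] =
    \sum_i p^`M(i).@[vcoord u] * vcoord (u \o N)%VF i := svalP (cid (exD p)) u.
have JD p : J p -> J (D p).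
  move=> Jp u Gu; rewrite DE.
  (* [q] is [p] translated by [u], so it still vanishes on [G]; the tangent condition for [q] at the
     identity is the wanted statement for [p] at [u]. *)
  have [q qE] : polyfun (fun v : 'End(a) => p.@[vcoord (u \o v)%VF]).
    apply: (@polyfun_comp _ _ _ (fun v : 'End(a) => (u \o v)%VF) (fun w => p.@[vcoord w])).
      move=> i; apply: polyfun_lin => c x y; rewrite comp_lfunDr -comp_lfunZr.
      by rewrite vcoordD vcoordZ.
    by exists p.
  have Jq : J q by move=> v Gv; rewrite -qE; apply/Jp/GM.
  have [r [rE r0]] := polyfun_line q (\1%VF : 'End(a)) N.
  have [r' [r'E r'0]] := polyfun_line p u (u \o N)%VF.
  rewrite -r'0; have -> : r' = r.
    apply: (poly_eq_horner char_K) => t; rewrite rE r'E -qE; congr (p.@[_]).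
    by congr (vcoord _); rewrite comp_lfunDr -comp_lfunZr comp_lfun1r.
  by rewrite r0; apply: tN.
have key p : J p -> p.@[vcoord (lexp N m 1)] = 0.
  move=> Jp.
  have cE q t : (mcurve (lexp_curve N m) q).[t] = q.@[vcoord (lexp N m t)].
    by rewrite mcurve_horner; apply: meval_eq => i; apply: lexp_curveE.
  have cD q : (mcurve (lexp_curve N m) q)^`() = mcurve (lexp_curve N m) (D q).
    apply: (poly_eq_horner char_K) => t; rewrite cE DE mcurve_deriv horner_sum.
    by apply: eq_bigr => i _; rewrite hornerM cE (lexp_curve_deriv char_K Nm).
  rewrite -cE.
  have -> : mcurve (lexp_curve N m) p = 0; last by rewrite horner0.
  apply: (poly_derivs_eq0 char_K) => n; elim: n p Jp => [|n IHn] p Jp.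
    by rewrite derivn0 cE lexp0 //; apply: Jp.
  by rewrite derivSn cD; apply: IHn; apply: JD.
rewrite GZ; split; first exact: lexp_inj.
rewrite ZI => p Ip; apply: key => u; rewrite GZ ZI => -[_]; exact.
Qed.

Lemma lexp_adjoint (x : a) m : (forall v, iter m (lie_br x) v = 0) ->
  @algebraic_adjoint_group K a (lexp (lie_ad x) m 1).
Proof.
move=> xm G algG adG; apply: (lexp_in_group algG (adG x)) => v.
by rewrite (eq_iter (lie_adE x)).
Qed.

Lemma adjoint_comp (u v : 'End(a)) : @algebraic_adjoint_group K a u ->
  @algebraic_adjoint_group K a v -> @algebraic_adjoint_group K a (u \o v)%VF.
Proof.
move=> Gu Gv G algG adG; have [_ _ GM _ _] := algG.
by apply: GM; [apply: Gu|apply: Gv].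
Qed.

Lemma adjoint1 : @algebraic_adjoint_group K a \1%VF.
Proof. by move=> G algG adG; have [_ G1 _ _ _] := algG. Qed.

Lemma lie_stab_automorphism (f : dualv a) (u : 'End(a)) : lie_automorphism u ->
  (u @: lie_stab (f \o u)%VF)%VS = lie_stab f.
Proof.
move=> [ku ubr]; have k0 : lker u == 0%VS by rewrite ku.
apply/vspaceP => x; apply/memv_imgP/idP => [[y /lie_stabP fy ->]|/lie_stabP fx].
  apply/lie_stabP => z; rewrite -[z](lker0_lfunVK k0) -ubr.
  by have := fy ((u^-1)%VF z); rewrite comp_lfunE.
exists ((u^-1)%VF x); last by rewrite (lker0_lfunVK k0).
by apply/lie_stabP => z; rewrite comp_lfunE ubr (lker0_lfunVK k0).
Qed.

End ExpGroup.

(** * Stabilizers of generic forms *)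

Section Semicontinuity.
Variables (K : fieldType) (V X Y : vectType K) (A : V -> 'Hom(X, Y)).
Hypothesis linA : forall a u v, A (a *: u + v) = a *: A u + A v.

(** [A v1] is injective on a complement [U] of its kernel. [G] is the determinant of [A v] on [U],
    read in coordinates on the image of [U] under [A v1]; where it is not 0, [A v] is injective on
    [U] as well. *)
Lemma ker_semicontinuous v1 : exists G : V -> K,
  [/\ polyfun G, G v1 != 0 &
   forall v, G v != 0 -> (\dim (lker (A v)) <= \dim (lker (A v1)))%N].
Proof.
pose U := (lker (A v1))^C%VS; pose r := \dim U.
pose xs (i : 'I_r) : X := (vbasis U)`_i.
pose ys : r.-tuple Y := [tuple A v1 (xs i) | i < r].
have ysE (i : 'I_r) : ys`_i = A v1 (xs i) by rewrite -tnth_nth tnth_mktuple.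
have fys : free ys.
  apply/freeP => c c0 i.
  have cU : \sum_j c j *: xs j \in U.
    by apply: rpred_sum => j _; rewrite rpredZ // vbasis_mem ?mem_nth ?size_tuple.
  have ck : \sum_j c j *: xs j \in lker (A v1).
    rewrite memv_ker linear_sum; apply/eqP; rewrite -[RHS]c0; apply: eq_bigr => j _.
    by rewrite linearZ ysE.
  have : \sum_j c j *: xs j \in (lker (A v1) :&: U)%VS by rewrite memv_cap ck.
  rewrite capv_compl memv0 => /eqP e.
  by have /freeP/(_ c e i) := basis_free (vbasisP U).
pose M v : 'M[K]_r := \matrix_(i, j) coord ys j (A v (xs i)).
exists (fun v => \det (M v)); split.
- rewrite /determinant; apply: polyfun_sum => s; apply: polyfunM.
    exact: polyfunC.
  apply: polyfun_prod => i; apply: polyfun_lin => a u v.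
  by rewrite !mxE linA add_lfunE scale_lfunE linearP.
- have -> : M v1 = 1%:M.
    by apply/matrixP => i j; rewrite !mxE -ysE coord_free.
  by rewrite det1 oner_neq0.
move=> v detM.
have disj : (lker (A v) :&: U)%VS = 0%VS.
  apply/eqP; rewrite -subv0; apply/subvP => x; rewrite memv_cap => /andP[xk xU].
  rewrite memv0; apply/eqP; rewrite (coord_vbasis xU); apply: big1 => i _.
  pose c : 'rV[K]_r := \row_i coord (vbasis U) i x.
  suff c0 : c = 0 by have /rowP/(_ i) := c0; rewrite !mxE => ->; rewrite scale0r.
  have cM : c *m M v = 0.
    apply/rowP => j; rewrite !mxE.
    transitivity (coord ys j (A v x)); last first.
      by move: xk; rewrite memv_ker => /eqP->; rewrite linear0.
    rewrite [in RHS](coord_vbasis xU) !linear_sum; apply: eq_bigr => l _.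
    by rewrite !mxE !linearZ.
  by rewrite -[c]mulmx1 -(mulmxV (_ : M v \in unitmx)) ?unitmxE ?unitfE // mulmxA cM mul0mx.
have dU : \dim U = (\dim {:X} - \dim (lker (A v1)))%N := dimv_compl _.
have dS := dimv_disjoint_sum disj.
have := dimvS (subvf (lker (A v) + U)%VS); have := dimvS (subvf (lker (A v1))).
move: dU dS; clear.
move: (\dim _) (\dim (lker (A v))) (\dim _) (\dim U) (\dim _) => x y z t u.
lia.
Qed.

End Semicontinuity.

Lemma iter_lfun0 (K : fieldType) (V : vectType K) (L : 'End(V)) n : iter n L 0 = 0.
Proof. by elim: n => //= n ->; rewrite linear0. Qed.

Lemma lfun_locally_nilp (K : fieldType) (V : vectType K) (L : 'End(V)) :
  (forall v, exists n, iter n L v = 0) -> exists n, forall v, iter n L v = 0.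
Proof.
move=> ln; have [n nP] := choice ln.
pose B (i : 'I_(\dim {:V})) : V := (vbasis {:V})`_i.
exists (\max_(i < \dim {:V}) n (B i))%N => v.
rewrite -lpowE (coord_vbasis (memvf v)) linear_sum big1 // => i _.
rewrite linearZ /= lpowE; set m := (\max_(j < _) _)%N.
have le : (n (B i) <= m)%N.
  exact: (leq_bigmax_cond (F := fun j => n (B j))).
rewrite -(subnK le) iterD nP; set q := (m - _)%N.
by rewrite -lpowE linear0 scaler0.
Qed.

(** * Elimination along the cascade, generic stabilizers and the index *)

Section Elimination.
Variables (k : closedFieldType) (char_k : [pchar k] =i pred0).
Variables (g : lieAlgType k) (ssg : lie_semisimple g).
Variables (h : lieSubalg g) (sh : split_cartan h).
Local Notation "h^*" := (dualv (lsub_of h)).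
Variables (P : h^* -> Prop) (posP : pos_system P).
Variables (E : seq h^*) (kE : kostant P E).
Hypothesis covE : forall be, is_root be -> exists2 i, (i < size E)%N & pairing be E`_i != 0.
Implicit Types (al be ga de ep mu : h^*).

Let rP al : P al -> is_root al := pos_root posP (al := al).

(** The step of the greedy choice at which [ga] is discarded; by [covE] the default value [size E]
    does not occur for positive roots. *)
Definition stage ga := find (fun ep => pairing ga ep != 0) E.

Lemma stage_lt ga : P ga -> (stage ga < size E)%N.
Proof.
move=> /rP/covE[i iE nz]; rewrite -has_find; apply/hasP; exists E`_i => //.
exact: mem_nth.
Qed.

Lemma stage_before ga i : (i < stage ga)%N -> pairing ga E`_i = 0.
Proof. by move=> /(before_find 0)/negbFE/eqP. Qed.

Lemma stage_neq0 ga : P ga -> pairing ga E`_(stage ga) != 0.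
Proof. by move=> /stage_lt; rewrite -has_find => /(nth_find 0). Qed.

Lemma stage_eq ga i : (i < size E)%N -> (forall j, (j < i)%N -> pairing ga E`_j = 0) ->
  pairing ga E`_i != 0 -> stage ga = i.
Proof.
move=> iE lt nz; apply/eqP; rewrite eqn_leq; apply/andP; split; rewrite leqNgt; apply/negP.
  by move=> /stage_before; apply/eqP.
move=> /[dup] li /lt; apply/eqP.
have: has (fun ep => pairing ga ep != 0) E.
  by rewrite has_find; apply: leq_trans li (ltnW iE).
by move=> /(nth_find 0).
Qed.

Lemma cascade_pos i : (i < size E)%N -> P E`_i.
Proof. by move=> /kE[]. Qed.

Lemma cascade_orth i j : (i < size E)%N -> (j < size E)%N -> i != j ->
  pairing E`_i E`_j = 0.
Proof.
move=> iE jE; rewrite neq_ltn => /orP[ij|ji]; last by case: (kE iE) => _ H _; apply: H.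
apply: (pairing_sym0 char_k ssg sh); try exact/rP/cascade_pos.
by case: (kE jE) => _ H _; apply: H.
Qed.

Lemma cascade_self i : (i < size E)%N -> pairing E`_i E`_i = 2%:R.
Proof. by move=> iE; apply/(pairing_self char_k ssg sh)/rP/cascade_pos. Qed.

Lemma two_neq0 : (2%:R : k) != 0. Proof. exact: natr_neq0 char_k 1. Qed.

Lemma two_neq1 : (2%:R : k) != 1.
Proof. by rewrite -subr_eq0 -[1]/(1%:R) -natrB // oner_neq0. Qed.

Lemma stage_cascade i : (i < size E)%N -> stage E`_i = i.
Proof.
move=> iE; apply: stage_eq => // [j ji|]; last by rewrite cascade_self // two_neq0.
by apply: cascade_orth => //; [apply: ltn_trans iE|rewrite gtn_eqF].
Qed.

Lemma pos_add_neq0 al be : P al -> P be -> al + be != 0.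
Proof.
move=> Pa Pb; have := pos_sum_neq0 char_k ssg sh posP (s := [:: al; be]).
rewrite !big_cons big_nil addr0; apply=> // ga.
by rewrite !inE => /orP[]/eqP->.
Qed.

Lemma pos_sub al be : P al -> is_root (al - be) -> ~ P (be - al) -> P (al - be).
Proof.
move=> Pa rs nP; have [_ tot _ _] := posP; have [//|] := tot _ rs.
by rewrite opprB.
Qed.

Lemma cascade_nonroot i de : (i < size E)%N -> P de ->
  (forall j, (j < i)%N -> pairing de E`_j = 0) -> ~~ is_root (E`_i + de).
Proof. by move=> /kE[_ _]; apply. Qed.

(** A negative pairing would make ga + ep_i a root, against the maximality of ep_i. *)
Lemma cascade_pairing i ga : (i < size E)%N -> P ga ->
  (forall j, (j < i)%N -> pairing ga E`_j = 0) -> exists n : nat, pairing ga E`_i = n%:R.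
Proof.
move=> iE Pg lt; have Pi := cascade_pos iE.
have [//|[n nE]] := pairing_cases char_k ssg sh (rP Pi) (rP Pg).
have [/eqP|] := root_add char_k ssg sh (rP Pi) (rP Pg) nE.
  by rewrite (negPf (pos_add_neq0 Pg Pi)).
by rewrite addrC (negPf (cascade_nonroot iE Pg lt)).
Qed.

(** Write ep for the root of the cascade at [stage ga]. The pairing of [ga] with ep is positive, so
    ep - ga is a root, and a positive one since otherwise ep plus the positive root ga - ep would be
    the root ga. Both pairings with ep are then nonnegative with sum 2; the value 2 for [ga] would
    make ga - 2 ep a root, hence ep + (ep - ga) one, against maximality. So both are 1. *)
Lemma stage_partner ga : P ga -> ga \notin E ->
  [/\ P (E`_(stage ga) - ga), stage (E`_(stage ga) - ga) = stage ga,
      pairing ga E`_(stage ga) = 1, pairing (E`_(stage ga) - ga) E`_(stage ga) = 1 &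
      E`_(stage ga) - ga \notin E].
Proof.
move=> Pg gE; set j := stage ga; have jE : (j < size E)%N := stage_lt Pg.
have Pj := cascade_pos jE; set ep := E`_j in Pj *.
have ne : ga != ep by apply: contraNneq gE => ->; apply: mem_nth.
have lt i : (i < j)%N -> pairing ga E`_i = 0 := @stage_before ga i.
have lte i : (i < j)%N -> pairing ep E`_i = 0.
  by move=> ij; apply: cascade_orth => //; [apply: ltn_trans jE|rewrite gtn_eqF].
have [[|n] nE] := cascade_pairing jE Pg lt.
  by have := stage_neq0 Pg; rewrite nE eqxx.
have rs : is_root (ep - ga).
  have [/eqP|] := root_sub char_k ssg sh (rP Pj) (rP Pg) nE.
    by rewrite subr_eq0 (negPf ne).
  by move/(root_opp char_k ssg sh); rewrite opprB.
have Pd : P (ep - ga).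
  apply: pos_sub => // Pn.
  have e : E`_j + (ga - ep) = ga by rewrite addrC subrK.
  have := cascade_nonroot jE Pn; rewrite e rP // => /(_ _)/negP; apply=> // i ij.
  by rewrite pairingBl lt ?lte // subrr.
have ltd i : (i < j)%N -> pairing (ep - ga) E`_i = 0.
  by move=> ij; rewrite pairingBl lt ?lte // subrr.
have dE : pairing (ep - ga) ep = 2%:R - n.+1%:R by rewrite pairingBl cascade_self // nE.
have [m mE] := cascade_pairing jE Pd ltd.
have nm : (n.+1 + m)%N = 2%N.
  apply: (natr_inj0 char_k); rewrite natrD -mE -/ep dE.
  by rewrite addrC subrK.
have m0 : m != 0%N.
  apply/eqP => m0; have n2 : n.+1 = 2%N by lia.
  have := root_reflect char_k ssg sh (rP Pj) (rP Pg).
  rewrite nE n2 scaler_nat mulr2n => /(root_opp char_k ssg sh).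
  by rewrite opprB -addrA (negPf (cascade_nonroot jE Pd ltd)).
have [n0 m1] : n = 0%N /\ m = 1%N by lia.
have nz : pairing (ep - ga) ep != 0 by rewrite mE m1 oner_neq0.
have st : stage (ep - ga) = j by apply: stage_eq.
split=> //; first by rewrite nE n0.
  by rewrite mE m1.
apply/negP => /(nthP 0)[i iE e].
have : stage E`_i = j by rewrite e.
rewrite stage_cascade // => ij; move: e; rewrite ij -/ep => /eqP.
rewrite eq_sym subr_eq -{1}[ep]addr0 (inj_eq (addrI ep)) eq_sym => /eqP g0.
by have := root_nz (rP Pg); rewrite g0 eqxx.
Qed.

Lemma stage_pairing2 ga : P ga -> pairing ga E`_(stage ga) = 2%:R -> ga = E`_(stage ga).
Proof.
move=> Pg p2; have [gE|gE] := boolP (ga \in E).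
  by have /(nthP 0)[i iE <-] := gE; rewrite stage_cascade.
have [_ _ p1 _ _] := stage_partner Pg gE.
by have := two_neq1; rewrite -p2 p1 eqxx.
Qed.

(** If [i] came before [stage de], reflecting [mu] would make ep_i + de a root; if after, [mu] would
    have pairing -1 with the root of the cascade at [stage de]. This is what decouples the linear
    system in [stab_cleared]. *)
Lemma partner_unique i mu de : (i < size E)%N -> P mu -> P de -> de \notin E ->
  mu + de = E`_i -> i = stage de.
Proof.
move=> iE Pm Pd dE sE; have jE := stage_lt Pd.
have [_ _ p1 _ _] := stage_partner Pd dE.
have mE : mu = E`_i - de by rewrite -sE addrK.
have [ij|ji|//] := ltngtP i (stage de).
  have lt j : (j < i.+1)%N -> pairing de E`_j = 0.
    by rewrite ltnS => ji; apply/stage_before/(leq_ltn_trans ji).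
  have := cascade_nonroot iE Pd (fun j ji => lt j (ltnW ji)).
  have := root_reflect char_k ssg sh (rP (cascade_pos iE)) (rP Pm).
  rewrite mE pairingBl cascade_self // (lt i (ltnSn i)) subr0 scaler_nat mulr2n.
  rewrite opprD addrA addrAC subrr sub0r addrC -opprD => /(root_opp char_k ssg sh).
  by rewrite opprK => ->.
have lt j : (j < stage de)%N -> pairing mu E`_j = 0.
  move=> jd; rewrite mE pairingBl (stage_before jd) subr0 cascade_orth //.
    exact: ltn_trans jE.
  by rewrite gtn_eqF // (ltn_trans jd).
have [n] := cascade_pairing jE Pm lt.
rewrite mE pairingBl p1 cascade_orth // ?gtn_eqF // sub0r => /eqP.
by rewrite eq_sym -addr_eq0 -[1]/(1%:R) -natrD; have /pcharf0P -> := char_k; rewrite addn1.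
Qed.

Definition rv al : g := vpick (root_space al).

Lemma rv_in al : rv al \in root_space al. Proof. exact: memv_pick. Qed.

Lemma rv_neq0 al : is_root al -> rv al != 0.
Proof. by move=> /andP[_ nz]; rewrite vpick0. Qed.

Lemma rv_span al x : is_root al -> x \in root_space al -> exists c, x = c *: rv al.
Proof. move=> ra; exact: (root_space_line char_k ssg sh ra (rv_in al) (rv_neq0 ra)). Qed.

Lemma br_nonroot al be x y : x \in root_space al -> y \in root_space be ->
  al + be != 0 -> ~~ is_root (al + be) -> [lie x, y] = 0.
Proof.
move=> xa yb nz; rewrite /is_root nz /= negbK => /eqP s0.
by have := root_space_br xa yb; rewrite s0 memv0 => /eqP.
Qed.

Variables (b : lieSubalg g) (hb : (h <= b)%VS).
Hypothesis rb : forall al, P al -> (root_space al <= b)%VS.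
(** The decomposition of [b] into [h] and root spaces, in the form of an induction principle. *)
Hypothesis bind : forall Q : g -> Prop,
  Q 0 -> (forall a x y, Q x -> Q y -> Q (a *: x + y)) ->
  (forall x, x \in lsub_vspace h -> Q x) ->
  (forall al x, P al -> x \in root_space al -> Q x) ->
  forall x, x \in lsub_vspace b -> Q x.
Local Notation "b^*" := (dualv (lsub_of b)).
Implicit Types (f : b^*).

Lemma rv_b al : P al -> rv al \in lsub_vspace b.
Proof. by move=> Pa; apply: (subvP (rb Pa)); apply: rv_in. Qed.

(** A projection that is the identity on [b]; it lets brackets and root vectors be computed in [g]
    while the forms live on [b]. *)
Definition tob (x : g) : lsub_of b := vsproj b x.
Lemma tobK x : x \in lsub_vspace b -> vsval (tob x) = x.
Proof. exact: vsprojK. Qed.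
Lemma valb_tob (u : lsub_of b) : tob (vsval u) = u.
Proof. exact: vsvalK. Qed.
Definition ev f (x : g) : k := f (tob x).

Lemma evD f x y : ev f (x + y) = ev f x + ev f y.
Proof. by rewrite /ev /tob !linearD. Qed.
Lemma evZ f a x : ev f (a *: x) = a * ev f x.
Proof. by rewrite /ev /tob !linearZ. Qed.
Lemma ev0 f : ev f 0 = 0. Proof. by rewrite -(scale0r 0) evZ mul0r. Qed.
Lemma ev_sum f I (r : seq I) (F : I -> g) :
  ev f (\sum_(i <- r) F i) = \sum_(i <- r) ev f (F i).
Proof. by elim: r => [|i r IHr]; rewrite ?big_nil ?ev0 // !big_cons evD IHr. Qed.

Lemma stab_ev f (x : lsub_of b) :
  x \in lie_stab f <-> forall y, y \in lsub_vspace b -> ev f [lie vsval x, y] = 0.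
Proof.
have brE (y : lsub_of b) : tob [lie vsval x, vsval y] = [lie x, y].
  by apply: val_inj; rewrite /= tobK // lsub_closed ?subvsP.
split=> [/lie_stabP fx y yb|fx]; first by rewrite -(tobK yb) /ev brE.
by apply/lie_stabP => y; rewrite -brE; apply: fx; apply: subvsP.
Qed.

Let toh (x : g) : lsub_of h := vsproj h x.
Let tohK x : x \in lsub_vspace h -> vsval (toh x) = x := @vsprojK _ _ _ x.

Lemma cartan_root_br x al y : x \in lsub_vspace h -> y \in root_space al ->
  [lie x, y] = (al (toh x) : k) *: y.
Proof. by move=> xh /root_spaceE/(_ (toh x)); rewrite tohK. Qed.

Definition Plist := [seq al <- roots sh | `[< P al >]].
Lemma mem_Plist al : (al \in Plist) <-> P al.
Proof.
rewrite mem_filter mem_roots; split=> [/andP[/asboolP]//|Pa].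
by rewrite rP // andbT; apply/asboolP.
Qed.
Lemma Plist_uniq : uniq Plist. Proof. exact/filter_uniq/roots_uniq. Qed.

Lemma b_expand x : x \in lsub_vspace b -> exists t (c : h^* -> k),
  t \in lsub_vspace h /\ x = t + \sum_(mu <- Plist) c mu *: rv mu.
Proof.
move: x; apply: bind => [|a x y [t [c [th ->]]] [t' [c' [th' ->]]]|x xh|al x Pa xa].
- exists 0, (fun => 0); split; first exact: rpred0.
  by rewrite big1 ?addr0 // => mu _; rewrite scale0r.
- exists (a *: t + t'), (fun mu => a * c mu + c' mu); split.
    by rewrite rpredD // rpredZ.
  rewrite scalerDr addrACA scaler_sumr -big_split; congr (_ + _).
  by apply: eq_bigr => mu _; rewrite scalerDl scalerA.
- exists x, (fun => 0); split=> //.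
  by rewrite big1 ?addr0 // => mu _; rewrite scale0r.
have [c ->] := rv_span (rP Pa) xa.
exists 0, (fun mu => if mu == al then c else 0); split; first exact: rpred0.
rewrite add0r (bigD1_seq al) ?Plist_uniq ?(mem_Plist al).2 //= eqxx big1 ?addr0 //.
by move=> mu /negPf->; rewrite scale0r.
Qed.

(** [L] lists the roots that are still to be cleared. *)
Definition clears f (L : seq h^*) :=
  forall mu, P mu -> mu \notin E -> mu \notin L -> ev f (rv mu) = 0.

Lemma tE_ex : exists U : {vspace lsub_of b}, forall x, x \in U <->
  vsval x \in lsub_vspace h /\ forall ep, ep \in E -> ep (toh (vsval x)) = 0.
Proof.
apply: vspace_of_pred => [|a x y [xh x0] [yh y0]].
  split; first by rewrite linear0 rpred0.
  by move=> ep _; rewrite /toh !linear0.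
split; first by rewrite linearP rpredD // rpredZ.
by move=> ep epE; rewrite /toh !linearP /= x0 // y0 // scaler0 addr0.
Qed.

Definition tE := sval (cid tE_ex).
Lemma tEP x : x \in tE <->
  vsval x \in lsub_vspace h /\ forall ep, ep \in E -> ep (toh (vsval x)) = 0.
Proof. exact: (svalP (cid tE_ex)). Qed.

Lemma clears_ev f mu x : clears f [::] -> P mu -> mu \notin E -> x \in root_space mu ->
  ev f x = 0.
Proof.
move=> cf Pm mE /(rv_span (rP Pm))[c ->].
by rewrite evZ cf // mulr0.
Qed.

(** An element of the stabilizer is tested against three kinds of vectors: e_(ep - ga), with ep the
    root of the cascade at [stage ga], isolates its coefficient on e_ga; the coroots of the ep_i
    isolate those on the e_(ep_i); the e_(ep_i) then force its part in [h] into the kernel of each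
    ep_i. *)
Lemma stab_cleared f : clears f [::] -> (forall ep, ep \in E -> ev f (rv ep) != 0) ->
  lie_stab f = tE.
Proof.
move=> cf nzE; apply/vspaceP => x; apply/idP/idP; last first.
  move=> /tEP[xh x0]; apply/stab_ev; apply: bind => [|a y z fy fz|y yh|al y Pa ya].
  - by rewrite lie0r ev0.
  - by rewrite lieDr lieZr evD evZ fy fz mulr0 addr0.
  - by rewrite (sh.1.1) ?ev0.
  rewrite (cartan_root_br xh ya) evZ.
  have [aE|aE] := boolP (al \in E); first by rewrite x0 ?mul0r.
  by rewrite (clears_ev cf Pa aE ya) mulr0.
move=> /stab_ev fx; have [t [c [th xE]]] := b_expand (subvsP x).
have phi y : y \in lsub_vspace b ->
    ev f [lie t, y] + \sum_(mu <- Plist) c mu * ev f [lie rv mu, y] = 0.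
  move=> yb; transitivity (ev f [lie vsval x, y]); last exact: fx.
  rewrite xE lieDl evD lie_suml ev_sum; congr (_ + _).
  by apply: eq_bigr => mu _; rewrite lieZl evZ.
have c0 ga : P ga -> ga \notin E -> c ga = 0.
  move=> Pg gE; have [Pd sd _ _ dE] := stage_partner Pg gE.
  set de := _ - ga in Pd sd dE; have := phi _ (rv_b Pd).
  rewrite (cartan_root_br th (rv_in de)) evZ cf // mulr0 add0r.
  have gd : ga + de = E`_(stage ga) by rewrite addrC subrK.
  have jE := stage_lt Pg.
  (* A term with [mu != ga] vanishes: either [mu + de] is not a root, or it is outside [E] and [f]
     is 0 there, or it is in [E] and [partner_unique] forces [mu = ga]. *)
  rewrite (bigD1_seq ga) ?Plist_uniq ?(mem_Plist ga).2 //= big_seq_cond big1 => [|mu]; last first.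
    move=> /andP[/mem_Plist Pm ne].
    have [rs|ns] := boolP (is_root (mu + de)); last first.
      by rewrite (br_nonroot (rv_in mu) (rv_in de)) ?pos_add_neq0 // ev0 mulr0.
    have Ps : P (mu + de) by case: posP => _ _ _; apply.
    have [/(nthP 0)[i iE /esym e]|sE] := boolP (mu + de \in E); last first.
      by rewrite (clears_ev cf Ps sE) ?mulr0 // root_space_br ?rv_in.
    have := partner_unique iE Pm Pd dE e; rewrite sd => ij.
    case/eqP: ne; apply: (addIr de); by rewrite e ij gd.
  have rE : is_root (ga + de) by rewrite gd; apply/rP/cascade_pos.
  have br_nz := root_br_neq0 char_k ssg sh (rP Pg) (rP Pd) rE (rv_in ga) (rv_in de)
    (rv_neq0 (rP Pg)) (rv_neq0 (rP Pd)).
  have [a aE] := rv_span rE (root_space_br (rv_in ga) (rv_in de)).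
  rewrite addr0 aE evZ => /eqP; rewrite !mulf_eq0 => /or3P[/eqP//|a0|].
    by rewrite aE (eqP a0) scale0r eqxx in br_nz.
  by rewrite gd (negPf (nzE _ _)) // mem_nth.
have cE i : (i < size E)%N -> c E`_i = 0.
  move=> iE; have yh : vsval (coroot E`_i) \in lsub_vspace h := subvsP _.
  have := phi _ (subvP hb _ yh); rewrite (sh.1.1 _ _ th yh) ev0 add0r.
  have Pi := cascade_pos iE.
  have term mu : [lie rv mu, vsval (coroot E`_i)] = - (pairing mu E`_i *: rv mu).
    by rewrite lie_antisym; congr (- _); apply: ((root_spaceE _ _).1 (rv_in mu)).
  rewrite (bigD1_seq E`_i) ?Plist_uniq ?(mem_Plist _).2 //= big_seq_cond big1 => [|mu].
    rewrite addr0 term -scaleNr evZ cascade_self // => /eqP; rewrite !mulf_eq0 oppr_eq0.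
    by rewrite (negPf two_neq0) (negPf (nzE _ _)) ?mem_nth // !orbF => /eqP.
  move=> /andP[/mem_Plist Pm ne].
  have [/(nthP 0)[j jE e]|mE] := boolP (mu \in E); last by rewrite c0 ?mul0r.
  rewrite term -e cascade_orth ?scale0r ?oppr0 ?ev0 ?mulr0 //.
  by apply: contraNneq ne => ij; rewrite -e ij.
have xt : vsval x = t.
  rewrite xE big_seq big1 ?addr0 // => mu /mem_Plist Pm.
  have [/(nthP 0)[j jE <-]|mE] := boolP (mu \in E); first by rewrite cE ?scale0r.
  by rewrite c0 ?scale0r.
apply/tEP; rewrite xt; split=> // ep epE.
have /(nthP 0)[i iE e] := epE; have Pe : P ep by rewrite -e; apply: cascade_pos.
have := fx _ (rv_b Pe); rewrite xt (cartan_root_br th (rv_in ep)) evZ => /eqP.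
by rewrite mulf_eq0 (negPf (nzE _ epE)) orbF => /eqP.
Qed.

Lemma rv_nilp al : is_root al -> exists m, forall v, iter m (lie_br (rv al)) v = 0.
Proof.
move=> ra.
have [m mP] : exists m, forall v, iter m (lie_ad (rv al)) v = 0.
  apply: lfun_locally_nilp; apply: (root_space_ind sh) => [|a x y [m mx] [n ny]|be v vb].
  - by exists 0%N.
  - exists (m + n)%N; rewrite -lpowE linearP /= !lpowE {1}addnC !iterD mx ny.
    by rewrite !iter_lfun0 scaler0 addr0.
  have [n nE] := root_iter_nilp char_k sh (root_nz ra) (rv_in al) vb.
  by exists n; rewrite (eq_iter (lie_adE (rv al))).
by exists m => v; rewrite -(eq_iter (lie_adE (rv al))).
Qed.

Section Shear.
Variables (e : g) (eb : e \in lsub_vspace b) (m : nat).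
Hypothesis em : forall v, iter m (lie_br e) v = 0.

Lemma iter_tob s i y : y \in lsub_vspace b ->
  iter i (lie_br (s *: tob e)) (tob y) = tob (s ^+ i *: iter i (lie_br e) y).
Proof.
move=> yb; elim: i => [|i IHi] /=; first by rewrite expr0 scale1r.
have ib : iter i (lie_br e) y \in lsub_vspace b.
  by elim: (i) => //= j IHj; apply: lsub_closed.
rewrite IHi; apply: val_inj; rewrite /= !tobK.
- by rewrite lieZl lieZr scalerA exprS.
- by apply: rpredZ; apply: lsub_closed.
- by apply: rpredZ.
exact: eb.
Qed.

Definition shear s : 'End(lsub_of b) := lexp (lie_ad (s *: tob e)) m 1.

Lemma shear_nilp s (v : lsub_of b) : iter m (lie_br (s *: tob e)) v = 0.
Proof.
by rewrite -(valb_tob v) iter_tob ?subvsP // em scaler0 /tob linear0.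
Qed.

Lemma shear_adjoint s : algebraic_adjoint_group (shear s).
Proof. by apply: (lexp_adjoint char_k) => v; apply: shear_nilp. Qed.

Lemma shear_automorphism s : lie_automorphism (shear s).
Proof.
apply: (lexp_automorphism char_k (lie_ad_derivation _)) => v.
by rewrite (eq_iter (lie_adE _)) shear_nilp.
Qed.

Lemma shear_ev f s y : y \in lsub_vspace b ->
  ev (f \o shear s)%VF y =
    \sum_(i < m) (s ^+ i / i`!%:R) * ev f (iter i (lie_br e) y).
Proof.
move=> yb; rewrite /ev comp_lfunE /shear /lexp sum_lfunE linear_sum.
apply: eq_bigr => i _; rewrite scale_lfunE linearZ /= lpowE.
rewrite (eq_iter (lie_adE _)) iter_tob // /tob !linearZ /= expr1n.
by rewrite /GRing.scale /=; ring.
Qed.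

(** The coordinates of f composed with exp (s ad e) are polynomials in s whose coefficients are
    linear in f, so s may depend rationally on f. *)
Lemma shear_ratfun (D S : b^* -> k) i : polyfun D -> ratfun D S ->
  ratfun D (fun f => vcoord (f \o shear (S f))%VF i).
Proof.
move=> pD rS.
pose T l f : b^* := (f \o lpow (lie_ad (tob e)) l)%VF.
have TE f s : (f \o shear s)%VF = \sum_(l < m) (s ^+ l / l`!%:R) *: T l f.
  apply/lfunP => v; rewrite sum_lfunE -(valb_tob v) -/(ev _ _) shear_ev ?subvsP //.
  apply: eq_bigr => l _; rewrite scale_lfunE /T comp_lfunE lpowE.
  rewrite (eq_iter (lie_adE _)) -[tob e]scale1r iter_tob ?subvsP //.
  by rewrite expr1n scale1r.
apply: (@ratfun_ext _ _ _ (fun f =>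
    \sum_(l < m) ((S f ^+ l * (l`!%:R)^-1) * vcoord (T l f) i))).
  by move=> f _; rewrite TE vcoord_sum; apply: eq_bigr => l _; rewrite vcoordZ.
apply: ratfun_sum => // l; apply: ratfunM => //.
  apply: ratfunM => //; first exact: ratfun_exp.
  exact/ratfun_poly/polyfunC.
apply: ratfun_poly; apply: polyfun_lin => a u v.
by rewrite /T comp_lfunDl -comp_lfunZl vcoordD vcoordZ.
Qed.

End Shear.

Lemma shear_scale0 e m f : (0 < m)%N -> (f \o shear e m 0)%VF = f.
Proof.
case: m => // m _; apply/lfunP => v; rewrite comp_lfunE; congr (f _).
rewrite /shear /lexp sum_lfunE big_ord_recl big1 => [|i _].
  by rewrite scale_lfunE expr0 fact0 divr1 scale1r lpowE /= addr0.
rewrite scale_lfunE lpowE lift0 iterSr lie_adE scale0r lie0l.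
by rewrite -lpowE linear0 scaler0.
Qed.

Lemma cascade_root ep : ep \in E -> P ep.
Proof. by move=> /(nthP 0)[i iE <-]; apply: cascade_pos. Qed.

Lemma cascade_uniq : uniq E.
Proof.
apply/(uniqP 0) => i j; rewrite !inE => iE jE e; apply/eqP; apply: contraT => ne.
have := cascade_orth iE jE ne; rewrite e cascade_self // => /eqP.
by rewrite (negPf two_neq0).
Qed.

(** The form is the Killing pairing with a sum of suitably normalised vectors in the root spaces of
    the -ep, for ep in [E]. *)
Lemma f0_ex : exists f, forall mu, P mu -> ev f (rv mu) = (mu \in E)%:R.
Proof.
have [y yP] : exists y : h^* -> g, forall ep, ep \in E ->
    y ep \in root_space (- ep) /\ killing (rv ep) (y ep) = 1.
  have exy ep : exists z, ep \in E ->
      z \in root_space (- ep) /\ killing (rv ep) z = 1.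
    have [epE|_] := boolP (ep \in E); last by exists 0.
    have Pe := cascade_root epE.
    have [z z1 z2] := root_pair char_k ssg sh (rP Pe) (rv_in ep) (rv_neq0 (rP Pe)).
    by exists z.
  by have [y yP] := choice exy; exists y.
pose F (x : lsub_of b) : k^o := \sum_(ep <- E) killing (vsval x) (y ep).
have lF : linear F.
  move=> a u v; rewrite /F scaler_sumr -big_split; apply: eq_bigr => ep _.
  by rewrite linearP /= killingDl killingZl.
exists (linfun F) => mu Pm; rewrite /ev (linfunE_of lF) /F tobK ?rv_b //.
have orth ep : ep \in E -> mu != ep -> killing (rv mu) (y ep) = 0.
  move=> epE ne; apply: (killing_root_orth _ (rv_in mu) (yP ep epE).1).
  by rewrite subr_eq0.
have [mE|mE] := boolP (mu \in E).
  rewrite (bigD1_seq mu) ?cascade_uniq //= (yP mu mE).2 big_seq_cond big1 ?addr0 //.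
  by move=> ep /andP[epE ne]; apply: orth => //; rewrite eq_sym.
rewrite big_seq big1 // => ep epE; apply: orth => //.
by apply: contraNneq mE => ->.
Qed.

Definition f0 : b^* := sval (cid f0_ex).
Lemma f0E mu : P mu -> ev f0 (rv mu) = (mu \in E)%:R.
Proof. exact: (svalP (cid f0_ex)). Qed.

Lemma polyfun_ev x : polyfun (fun f => ev f x).
Proof. by apply: polyfun_lin => a u v; rewrite /ev add_lfunE scale_lfunE. Qed.

Lemma pos_of_sum mu de l : P mu -> P de -> is_root (mu + de *+ l) -> P (mu + de *+ l).
Proof.
move=> Pm Pd rs; have [_ /(_ _ rs)[//|Pn] _ _] := posP.
have Ps al : al \in - (mu + de *+ l) :: mu :: nseq l de -> P al.
  by rewrite !inE mem_nseq => /or3P[/eqP->|/eqP->|/andP[_ /eqP->]].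
have := pos_sum_neq0 char_k ssg sh posP Ps isT.
by rewrite !big_cons big_nseq iter_addr_0 addNr eqxx.
Qed.

Definition staged (L : seq h^*) := forall mu ga, P mu -> mu \notin E -> mu \notin L ->
  ga \in L -> (stage mu <= stage ga)%N.

(* One step of the elimination: with [de = ep - ga], the automorphism
   exp (s ad e_de) with a suitable s annihilates f (e_ga) without disturbing
   the values already annihilated. *)
Lemma shear_clears f ga L s m : P ga -> ga \notin E -> staged (ga :: L) ->
  let j := stage ga in let de := E`_j - ga in
  (1 < m)%N -> (forall v, iter m (lie_br (rv de)) v = 0) ->
  (forall mu, mu \in L -> (j <= stage mu)%N) ->
  clears f (ga :: L) ->
  s * ev f [lie rv de, rv ga] = - ev f (rv ga) ->
  clears (f \o shear (rv de) m s)%VF L.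
Proof.
move=> Pg gE stL j de m1 em sortL cf sE mu Pm mE mL.
have [Pd sd p1 pd1 dE] := stage_partner Pg gE; rewrite -/j -/de in Pd sd p1 pd1 dE.
have jE : (j < size E)%N := stage_lt Pg.
have gd : de + ga = E`_j by rewrite /de subrK.
rewrite shear_ev ?rv_b //.
have trunc x : [lie rv de, x] = 0 -> forall n, iter n.+1 (lie_br (rv de)) x = 0.
  by move=> x0 n; rewrite iterSr x0; elim: n => //= n ->; rewrite lie0r.
case: m m1 em => [//|[//|m]] _ em.
rewrite big_ord_recl expr0 fact0 divr1 mul1r.
have tail x : [lie rv de, x] = 0 ->
    \sum_(i < m.+1) s ^+ lift ord0 i / (lift ord0 i)`!%:R *
      ev f (iter (lift ord0 i) (lie_br (rv de)) x) = 0.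
  by move=> x0; rewrite big1 // => i _; rewrite lift0 trunc // ev0 mulr0.
(* At [ga] itself the terms of degree 0 and 1 cancel by the choice of [s]; the others vanish because
   ep_j + de is not a root. *)
have [->|ne] := eqVneq mu ga.
  rewrite big_ord_recl big1 => [|i _].
    by rewrite addr0 lift0 /= factS fact0 muln1 expr1 divr1 sE subrr.
  rewrite !lift0 iterSr trunc ?ev0 ?mulr0 //.
  apply: (br_nonroot (rv_in de) (root_space_br (rv_in de) (rv_in ga))).
    rewrite gd; apply: pos_add_neq0 => //; exact: cascade_pos.
  rewrite gd addrC; apply: cascade_nonroot => // i' ij.
  by apply: stage_before; rewrite sd.
have f_mu : ev f (rv mu) = 0 by apply: cf => //; rewrite inE negb_or ne.
have smu : (stage mu <= j)%N.
  by apply: stL; rewrite ?mem_head // inE negb_or ne.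
rewrite /= f_mu add0r.
(* At equal stage, a root [de + mu] would have pairing 2 with ep_j, hence be ep_j itself, which
   would make [mu] equal to [ga]. *)
have [smj|smj] := eqVneq (stage mu) j.
  apply: tail; apply: (br_nonroot (rv_in de) (rv_in mu)); first exact: pos_add_neq0.
  apply/negP => rs; have [_ _ q1 _ _] := stage_partner Pm mE.
  have Ps : P (de + mu) by case: posP => _ _ _; apply.
  have ps : pairing (de + mu) E`_j = 2%:R.
    by rewrite pairingDl pd1 -{1}smj q1 -[1]/(1%:R) -natrD.
  have ss : stage (de + mu) = j.
    apply: stage_eq => // [i ij|]; last by rewrite ps two_neq0.
    by rewrite pairingDl !stage_before ?addr0 // ?smj ?sd.
  have := stage_pairing2 Ps; rewrite ss ps => /(_ erefl) e.
  by case/eqP: ne; apply: (addrI de); rewrite e gd.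
(* At a smaller stage, adding multiples of [de] changes neither the stage nor the pairing 1 found
   there, so the roots reached lie neither in [E] nor in [ga :: L], and [f] is already 0 on them. *)
have lt : (stage mu < j)%N by rewrite ltn_neqAle smj.
rewrite big1 // => l _; set n := nat_of_ord (lift ord0 l).
suff -> : ev f (iter n (lie_br (rv de)) (rv mu)) = 0 by rewrite mulr0.
have itn : iter n (lie_br (rv de)) (rv mu) \in root_space (mu + de *+ n).
  exact: root_space_iter (rv_in de) (rv_in mu).
have [->|nz] := eqVneq (iter n (lie_br (rv de)) (rv mu)) 0; first exact: ev0.
have pn i : (i < j)%N -> pairing (mu + de *+ n) E`_i = pairing mu E`_i.
  move=> ij; rewrite pairingDl -scaler_nat pairingZl (stage_before (ga := de)) ?sd //.
  by rewrite mulr0 addr0.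
have [_ _ q1 _ _] := stage_partner Pm mE.
have nu_nz : mu + de *+ n != 0.
  apply/eqP => e0; have := pn _ lt; rewrite e0 pairing0l q1 => /eqP.
  by rewrite eq_sym oner_eq0.
have rn : is_root (mu + de *+ n).
  by apply/rootP; split; [apply/eqP|exists (iter n (lie_br (rv de)) (rv mu))].
have Pn := pos_of_sum Pm Pd rn.
have sn : stage (mu + de *+ n) = stage mu.
  apply: stage_eq; first exact: stage_lt.
    by move=> i im; rewrite pn ?(ltn_trans im) // stage_before.
  by rewrite pn // q1 oner_neq0.
have nE : mu + de *+ n \notin E.
  apply/negP => /(nthP 0)[i iE e]; have := stage_cascade iE; rewrite e sn => mi.
  have := pn _ lt; rewrite -e q1 -mi cascade_self ?mi // => /eqP.
  by rewrite (negPf two_neq1).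
have [c ->] := rv_span rn itn; rewrite evZ cf ?mulr0 // inE negb_or.
apply/andP; split.
  by apply/eqP => e; move: lt; rewrite -sn e ltnn.
apply/negP => /sortL; rewrite sn leqNgt; by rewrite lt.
Qed.

(** Clearing [ga] replaces f by [T f], whose parameter [S f] has denominator [D f]; so the
    polynomial [Q] for the rest of the list, composed with [T], becomes a polynomial [R] after
    multiplication by a power of [D]. As [f0] is already cleared, [T f0 = f0], and the new
    polynomial is again nonzero at [f0]. *)
Lemma eliminate L : (forall ga, ga \in L -> P ga /\ ga \notin E) ->
  sorted (fun al be => stage al <= stage be)%N L -> staged L ->
  exists Q : b^* -> k, [/\ polyfun Q, Q f0 != 0 &
    forall f, Q f != 0 -> clears f L -> exists u : 'End(lsub_of b),
      [/\ algebraic_adjoint_group u, lie_automorphism u &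
          lie_stab f = (u @: tE)%VS]].
Proof.
elim: L => [|ga L IHL] LP sL stL.
  exists (fun f => \prod_(ep <- E) ev f (rv ep)); split.
  - by apply: polyfun_prod => ep; apply: polyfun_ev.
  - rewrite big_seq prodf_seq_neq0; apply/allP => ep epE; apply/implyP => _.
    by rewrite f0E ?epE ?oner_neq0 //; apply: cascade_root.
  move=> f nz cf; exists \1%VF; split; first exact: adjoint1.
    split=> [|x y]; last by rewrite !id_lfunE.
    by apply/eqP/lker0P => x y; rewrite !id_lfunE.
  rewrite lim1g; apply: stab_cleared => // ep epE.
  by move: nz; rewrite prodf_seq_neq0 => /allP/(_ ep epE).
have [Pg gE] := LP ga (mem_head _ _).
have tr : transitive (fun al be => (stage al <= stage be)%N).
  by move=> y x z; apply: leq_trans.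
have sortL mu : mu \in L -> (stage ga <= stage mu)%N.
  by move=> muL; have /allP := order_path_min tr sL; apply.
have stL' : staged L.
  move=> mu de Pm mE mL dL; have [->|ne] := eqVneq mu ga; first exact: sortL.
  apply: leq_trans (sortL _ dL).
  by apply: stL => //; rewrite ?mem_head // inE negb_or ne.
have [||Q [pQ Q0 QP]] := IHL _ _ stL'.
- by move=> de dL; apply: LP; rewrite inE dL orbT.
- exact: path_sorted sL.
pose j := stage ga; pose de := E`_j - ga.
have [Pd _ _ _ dE] := stage_partner Pg gE; rewrite -/j -/de in Pd dE.
have jE : (j < size E)%N := stage_lt Pg.
have gd : de + ga = E`_j by rewrite /de subrK.
have Pj := cascade_pos jE.
have [m1 em1] := rv_nilp (rP Pd).
(* The terms of degree 0 and 1 must be present in the truncated exponential, even if [m1] is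
   small. *)
pose m := (m1 + 2)%N.
have em v : iter m (lie_br (rv de)) v = 0 by rewrite /m iterD em1.
have rE : is_root (de + ga) by rewrite gd; apply: rP.
have [N NE] := rv_span rE (root_space_br (rv_in de) (rv_in ga)).
have N0 : N != 0.
  have := root_br_neq0 char_k ssg sh (rP Pd) (rP Pg) rE (rv_in de) (rv_in ga)
    (rv_neq0 (rP Pd)) (rv_neq0 (rP Pg)).
  by apply: contraNneq => N0; rewrite NE N0 scale0r.
rewrite gd in NE.
pose D f := ev f (rv E`_j); have pD : polyfun D by apply: polyfun_ev.
pose S f := (- (N^-1) * ev f (rv ga)) / D f.
have rS : ratfun D S.
  by apply: ratfun_div; apply: polyfunM; [apply: polyfunC|apply: polyfun_ev].
pose T f := (f \o shear (rv de) m (S f))%VF : b^*.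
have [M [R [pR RE]]] : ratfun D (fun f => Q (T f)).
  by apply: ratfun_comp => // i; by apply: shear_ratfun => //; apply: rv_b.
have D0 : D f0 != 0 by rewrite /D f0E // mem_nth // oner_neq0.
have T0 : T f0 = f0.
  have S0 : S f0 = 0 by rewrite /S f0E // (negPf gE) mulr0 mul0r.
  by rewrite /T S0 shear_scale0 // /m addn2.
exists (fun f => D f * R f); split.
- exact: polyfunM.
- by rewrite mulf_neq0 // -RE // T0 mulf_neq0 // expf_neq0.
move=> f; rewrite mulf_eq0 negb_or => /andP[Df Rf] cf.
have Qf : Q (T f) != 0 by move: Rf; rewrite -RE // mulf_eq0 negb_or => /andP[].
have cTf : clears (T f) L.
  apply: (shear_clears (L := L)) => //; first by rewrite /m addn2.
  by rewrite -/j -/de NE evZ -/(D f) /S; field; rewrite Df N0.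
have [u [Gu au uE]] := QP _ Qf cTf.
pose v := shear (rv de) m (S f).
have Gv : algebraic_adjoint_group v by apply: shear_adjoint => //; apply: rv_b.
have av : lie_automorphism v by apply: shear_automorphism => //; apply: rv_b.
exists (v \o u)%VF; split; first exact: adjoint_comp.
  have [ku ubr] := au; have [kv vbr] := av; split=> [|x y]; last first.
    by rewrite !comp_lfunE ubr vbr.
  apply/eqP/lker0P => x y; rewrite !comp_lfunE.
  by move=> /(elimT lker0P (introT eqP kv))/(elimT lker0P (introT eqP ku)).
by rewrite limg_comp -uE; apply/esym/lie_stab_automorphism.
Qed.

Lemma generic_stab : exists Q : b^* -> k, [/\ polyfun Q, Q f0 != 0 &
  forall f, Q f != 0 -> exists u : 'End(lsub_of b),
    [/\ algebraic_adjoint_group u, lie_automorphism u & lie_stab f = (u @: tE)%VS]].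
Proof.
pose L := sort (fun al be => stage al <= stage be)%N [seq al <- Plist | al \notin E].
have LP ga : ga \in L <-> P ga /\ ga \notin E.
  rewrite mem_sort mem_filter; split=> [/andP[-> /mem_Plist]//|[Pg ->]].
  exact/mem_Plist.
have [|||Q [pQ Q0 QP]] := @eliminate L.
- by move=> ga /LP.
- by apply: sort_sorted => x y; apply: leq_total.
- by move=> mu ga Pm mE /negP[]; apply/LP.
exists Q; split=> // f /QP; apply=> mu Pm mE /negP[]; exact/LP.
Qed.

Lemma stab_f0 : lie_stab f0 = tE.
Proof.
apply: stab_cleared => [mu Pm mE _|ep epE]; first by rewrite f0E // (negPf mE).
by rewrite f0E ?epE ?oner_neq0 //; apply: cascade_root.
Qed.

Lemma f0_stable : stable_form f0.
Proof.
have [Q [[p pE] Q0 QP]] := generic_stab.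
exists [set f | Q f != 0]%classic.
  exists [set f | Q f != 0]%classic; split=> //.
  exists [set p]%classic; apply/seteqP; split=> f /=.
    by move=> /negP; rewrite negbK => /eqP Qf q ->; rewrite -pE.
  by move=> /(_ p erefl) pf; apply/negP; rewrite negbK pE pf.
by move=> f /QP[u [Gu _ uE]]; exists u; rewrite // stab_f0.
Qed.

(** The ep_i take on their coroots the values of twice the identity matrix, so the coroots are
    independent and span a complement in [h] of the common kernel. *)
Lemma dim_tE : (\dim tE + size E)%N = \dim h.
Proof.
pose Z := (\bigcap_(ep <- E) lker ep)%VS : {vspace lsub_of h}.
have ZP (t : lsub_of h) : t \in Z <-> forall ep, ep \in E -> ep t = 0.
  split=> [tZ ep epE|t0].
    apply/eqP; rewrite -memv_ker; apply: (subvP _ _ tZ).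
    by rewrite /Z (big_rem ep) //= capvSl.
  rewrite /Z big_seq; elim/big_ind: _ => [|U U' tU tU'|ep epE].
  - exact: memvf.
  - by rewrite memv_cap tU.
  by rewrite memv_ker t0.
pose co := [seq coroot ep | ep <- E].
have sco : size co = size E by rewrite size_map.
have ep_co i j : (i < size E)%N -> (j < size E)%N -> E`_i co`_j = (2 * (i == j))%:R :> k.
  move=> iE jE; rewrite (nth_map 0) // -/(pairing _ _).
  by case: eqVneq => [->|ne]; rewrite ?muln1 ?muln0 ?cascade_self // cascade_orth.
have fco : free (in_tuple co).
  apply/freeP => c c0 i.
  have iE : (i < size E)%N by rewrite -sco.
  have := congr1 E`_i c0; rewrite linear0 linear_sum (bigD1 i) //= big1 => [|j ji].
    rewrite linearZ /= ep_co // eqxx muln1 addr0 => /eqP.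
    by rewrite mulf_eq0 (negPf two_neq0) orbF => /eqP.
  have jE : (j < size E)%N by rewrite -sco.
  rewrite linearZ /= ep_co //; have /negPf-> : (i != j :> nat) by rewrite eq_sym.
  by rewrite muln0 scaler0.
have disj : (Z :&: <<co>> = 0)%VS.
  apply/eqP; rewrite -subv0; apply/subvP => t; rewrite memv_cap => /andP[/ZP t0 tc].
  rewrite memv0; apply/eqP; move: t0; rewrite (coord_span (X := in_tuple co) tc) => t0.
  apply: big1 => i _; have iE : (i < size E)%N by rewrite -sco.
  have := t0 _ (mem_nth 0 iE); rewrite linear_sum (bigD1 i) //= big1 => [|j ji].
    rewrite linearZ /= ep_co // eqxx muln1 addr0 => /eqP.
    by rewrite mulf_eq0 (negPf two_neq0) orbF => /eqP->; rewrite scale0r.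
  have jE : (j < size E)%N by rewrite -sco.
  rewrite linearZ /= ep_co //; have /negPf-> : (i != j :> nat) by rewrite eq_sym.
  by rewrite muln0 scaler0.
have sum : (Z + <<co>> = fullv)%VS.
  apply/eqP; rewrite eqEsubv subvf /=; apply/subvP => t _.
  pose t' := \sum_(i < size E) (2%:R^-1 * (E`_i t : k)) *: co`_i.
  rewrite -[t](subrK t'); apply: memv_add; last first.
    by apply: rpred_sum => i _; rewrite rpredZ // memv_span // mem_nth // sco.
  apply/ZP => _ /(nthP 0)[i iE <-].
  rewrite linearB linear_sum /= (bigD1 (Ordinal iE)) //= big1 => [|j ji].
    rewrite linearZ /= ep_co // eqxx muln1 addr0 /GRing.scale /= mulrAC mulVf ?two_neq0 //.
    by rewrite mul1r subrr.
  rewrite linearZ /= ep_co //; have /negPf-> : (i != j :> nat) by rewrite eq_sym.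
  by rewrite muln0 scaler0.
have dimZ : (\dim Z + size E)%N = \dim h.
  have := dimv_disjoint_sum disj; rewrite sum dimvf.
  have dco : \dim <<co>> = size E by rewrite -sco; apply/eqP.
  by rewrite dco => <-.
rewrite -dimZ; congr (_ + _)%N.
pose io (t : lsub_of h) : lsub_of b := tob (vsval t).
have lio : linear io by move=> a u v; rewrite /io /tob !linearP.
have val_io t : vsval (io t) = vsval t.
  by rewrite /io tobK //; apply: (subvP hb); apply: subvsP.
have <- : (linfun io @: Z)%VS = tE.
  apply/vspaceP => x; apply/memv_imgP/idP => [[t /ZP t0 ->]|/tEP[xh x0]].
    apply/tEP; rewrite (linfunE_of lio) val_io; split; first exact: subvsP.
    by move=> ep epE; rewrite /toh vsvalK t0.
  exists (toh (vsval x)); first exact/ZP.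
  by rewrite (linfunE_of lio) /io tohK // valb_tob.
apply: limg_dim_eq; apply/eqP; rewrite -subv0; apply/subvP => t.
rewrite memv_cap memv_ker (linfunE_of lio) memv0 => /andP[_ /eqP e].
apply/eqP/val_inj; transitivity (vsval (io t)); first by rewrite val_io.
by rewrite e !linear0.
Qed.

(** [f0] bounds the index from above. From below, the open set where the stabilizer is no larger
    than at a minimising form meets the set of generic forms, whose stabilizers have the dimension
    of [tE]. *)
Lemma lie_index_dim : (lie_index (lsub_of b) + size E)%N = \dim h.
Proof.
rewrite -dim_tE; congr (_ + _)%N.
rewrite /lie_index; case: ex_minnP => n /asboolP[f1 f1n] minn.
apply/eqP; rewrite eqn_leq; apply/andP; split.
  by apply: minn; apply/asboolP; exists f0; rewrite stab_f0.
have [Q [pQ Q0 QP]] := generic_stab.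
have lA (f : b^*) : linear (fun x => (f \o lie_ad x)%VF : b^*).
  move=> a x y; apply/lfunP => z.
  by rewrite add_lfunE scale_lfunE !comp_lfunE !lie_adE lieDl lieZl linearP.
have [|G [pG G1 GP]] := @ker_semicontinuous k _ _ _
    (fun f : b^* => linfun (fun x => (f \o lie_ad x)%VF : b^*)) _ f1.
  move=> a u v; apply/lfunP => x; rewrite add_lfunE scale_lfunE !(linfunE_of (lA _)).
  by rewrite comp_lfunDl -comp_lfunZl.
have [f [Qf Gf]] := polyfun_neq0_meet char_k pQ pG Q0 G1.
have [u [_ [ku _] uE]] := QP f Qf.
rewrite -f1n; apply: leq_trans (GP f Gf).
by rewrite -/(lie_stab f) uE limg_dim_eq // ku capv0.
Qed.

End Elimination.

(** * The cascade of a base *)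

Section NatScalars.
Variables (k : fieldType) (char_k : [pchar k] =i pred0).
Implicit Types x y : k.

(** Sign conditions on coefficients become membership in the natural numbers, as [k] carries no
    order. *)
Definition natc x := exists n : nat, x = n%:R.

Lemma natc_nat n : natc n%:R. Proof. by exists n. Qed.
Lemma natc0 : natc 0. Proof. by exists 0%N. Qed.

Lemma natcD x y : natc x -> natc y -> natc (x + y).
Proof. by move=> [m ->] [n ->]; exists (m + n)%N; rewrite natrD. Qed.

Lemma natcM x y : natc x -> natc y -> natc (x * y).
Proof. by move=> [m ->] [n ->]; exists (m * n)%N; rewrite natrM. Qed.

Lemma natcMn x n : natc x -> natc (x *+ n).
Proof. by move=> [m ->]; exists (m * n)%N; rewrite natrM mulr_natr. Qed.

Lemma natc_sum (I : eqType) (r : seq I) (F : I -> k) :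
  (forall i, i \in r -> natc (F i)) -> natc (\sum_(i <- r) F i).
Proof.
move=> nF; rewrite big_seq; elim/big_ind: _ => // [|x y]; first exact: natc0.
exact: natcD.
Qed.

Lemma natc_add0 x y : natc x -> natc y -> x + y = 0 -> x = 0.
Proof.
move=> [m ->] [n ->]; rewrite -natrD => /eqP.
by move/pcharf0P: char_k => ->; rewrite addn_eq0 => /andP[/eqP-> _].
Qed.

Lemma natc_opp x : natc x -> natc (- x) -> x = 0.
Proof. by move=> nx nx'; apply: (natc_add0 nx nx'); rewrite subrr. Qed.

Lemma natc_sum0 (I : eqType) (r : seq I) (F : I -> k) :
  (forall i, i \in r -> natc (F i)) -> \sum_(i <- r) F i = 0 ->
  forall i, i \in r -> F i = 0.
Proof.
elim: r => [//|j r IHr] nF; rewrite big_cons => s0 i.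
have nj : natc (F j) by apply: nF; rewrite mem_head.
have nr i' : i' \in r -> natc (F i') by move=> ir; apply: nF; rewrite inE ir orbT.
have nS := natc_sum nr.
rewrite inE => /predU1P[->|]; first exact: (natc_add0 nj nS).
by apply: IHr => //; apply: (natc_add0 nS nj); rewrite addrC.
Qed.

End NatScalars.

Section Dynkin.
Variables (k : fieldType) (g : lieAlgType k) (h : lieSubalg g).
Local Notation "h^*" := (dualv (lsub_of h)).
Implicit Types (al be : h^*) (S T C D : {fset h^*}).

(** For [D] inside [S], these are the unions of connected components of [S]. *)
Definition adj_closed S D := forall x y, x \in D -> y \in S -> dynkin_adj x y -> y \in D.

Lemma dynkin_adj_sym al be : dynkin_adj al be = dynkin_adj be al.
Proof. by rewrite /dynkin_adj eq_sym orbC. Qed.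

Lemma component_sub S (s : S) : dynkin_component s `<=` S.
Proof. by apply/fsubsetP => al /imfsetP[t _ ->]; apply: valP. Qed.

Lemma mem_component S (s t : S) : (val t \in dynkin_component s) = dynkin_connect s t.
Proof.
apply/imfsetP/idP => [[u su /val_inj->]//|st]; by exists t.
Qed.

Lemma component_self S (s : S) : val s \in dynkin_component s.
Proof. by rewrite mem_component; apply: connect0. Qed.

Lemma component_closed S (s : S) : adj_closed S (dynkin_component s).
Proof.
move=> x y /imfsetP[t st ->] yS ady.
have -> : y = val [` yS] by [].
rewrite mem_component; apply: (connect_trans st); apply: connect1; exact: ady.
Qed.

Lemma component_min S (s : S) D : adj_closed S D -> val s \in D ->
  dynkin_component s `<=` D.
Proof.
move=> clD sD; apply/fsubsetP => x /imfsetP[t /connectP[p ps ->] ->].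
elim: p s sD ps => [//|u p IHp] s sD /= /andP[su pu].
by apply: IHp => //; apply: (clD (val s)) => //; apply: valP.
Qed.

Lemma component_sym S (s t : S) :
  (val t \in dynkin_component s) = (val s \in dynkin_component t).
Proof.
rewrite !mem_component; apply: sym_connect_sym => x y /=.
exact: dynkin_adj_sym.
Qed.

Lemma component_is_connected S (s : S) : dynkin_connected (dynkin_component s).
Proof.
set C := dynkin_component s; apply/forallP => t; apply/forallP => u.
have tS : val t \in S by apply: (fsubsetP (component_sub s)); apply: valP.
have clt : adj_closed S (dynkin_component t).
  move=> x y xt yS axy; apply: (component_closed xt) => //.
  apply: (component_closed _ yS axy).
  exact: (fsubsetP (component_sub t)) xt.
have st : val s \in dynkin_component ([` tS] : S).
  by rewrite -component_sym; apply: (valP t).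
have sub1 : dynkin_component ([` tS] : S) `<=` dynkin_component t.
  by apply: component_min => //; apply: component_self.
have st' := fsubsetP sub1 _ st.
have sub2 : C `<=` dynkin_component t by apply: component_min.
by rewrite -mem_component; apply: (fsubsetP sub2); apply: valP.
Qed.

Lemma component_restrict S D (s : S) (t : D) : D `<=` S -> adj_closed S D ->
  val s = val t -> dynkin_component s = dynkin_component t.
Proof.
move=> DS clD st; apply/eqP; rewrite eqEfsubset; apply/andP; split.
  apply: component_min; last by rewrite st component_self.
  move=> x y xt yS axy; apply: (component_closed xt) => //.
  by apply: (clD x) => //; apply: (fsubsetP (component_sub t)).
apply: component_min; last by rewrite -st component_self.
move=> x y xs yD axy; apply: (component_closed xs) => //.
exact: (fsubsetP DS).
Qed.

Lemma adj_closedD S D : adj_closed S D -> D `<=` S -> adj_closed S (S `\` D).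
Proof.
move=> clD DS x y; rewrite !in_fsetD => /andP[xD xS] yS axy; rewrite yS andbT.
by apply: contra xD => yD; apply: (clD y) => //; rewrite dynkin_adj_sym.
Qed.

(** By [component_restrict], a vertex has the same component in [S] as in the closed part, [D] or
    its complement, that contains it. *)
Lemma cascade_split S D : D `<=` S -> adj_closed S D ->
  cascade S = cascade D `|` cascade (S `\` D).
Proof.
move=> DS clD; have DS' : S `\` D `<=` S by apply: fsubsetDl.
have clD' := adj_closedD clD DS.
apply/fsetP => T; rewrite in_fsetU !cascade_components.
apply/existsP/orP => [[s Ts]|[] /existsP[t Tt]].
- have [sD|sD] := boolP (val s \in D).
    left; apply/existsP; exists [` sD].
    by rewrite -(component_restrict (s := s)).
  have sD' : val s \in S `\` D by rewrite in_fsetD sD; apply: valP.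
  right; apply/existsP; exists [` sD'].
  by rewrite -(component_restrict (s := s)).
- have tS : val t \in S by apply: (fsubsetP DS); apply: valP.
  by exists [` tS]; rewrite (component_restrict (t := t)).
have tS : val t \in S by apply: (fsubsetP DS'); apply: valP.
by exists [` tS]; rewrite (component_restrict (t := t)).
Qed.

Lemma connected_min S D : dynkin_connected S -> adj_closed S D -> D `<=` S ->
  D != fset0 -> D = S.
Proof.
move=> cS clD DS /fset0Pn[x xD]; apply/eqP; rewrite eqEfsubset DS /=.
have xS := fsubsetP DS _ xD.
by rewrite -(component_connected ([` xS] : S) cS); apply: component_min.
Qed.

End Dynkin.

Section Base.
Variables (k : closedFieldType) (char_k : [pchar k] =i pred0).
Variables (g : lieAlgType k) (ssg : lie_semisimple g).
Variables (h : lieSubalg g) (sh : split_cartan h).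
Local Notation "h^*" := (dualv (lsub_of h)).
Variables (Pi : {fset h^*}) (basePi : root_base Pi).
Implicit Types (al be ga de ep : h^*) (S T C D : {fset h^*}).

(** Coefficients are indexed by elements of the base instead of positions in its enumeration, and
    are 0 outside [Pi]; this suits passing to subsets of the base. *)
Definition cf al be : k :=
  \sum_(i < size Pi) (Pi`_i == al)%:R * coord (in_tuple Pi) i be.

Lemma cfD al be ga : cf al (be + ga) = cf al be + cf al ga.
Proof. by rewrite /cf -big_split; apply: eq_bigr => i _; rewrite linearD mulrDr. Qed.
Lemma cfZ al c be : cf al (c *: be) = c * cf al be.
Proof.
by rewrite /cf mulr_sumr; apply: eq_bigr => i _; rewrite linearZ /= mulrCA.
Qed.
Lemma cf0 al : cf al 0 = 0.
Proof. by rewrite -(scale0r 0) cfZ mul0r. Qed.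
Lemma cfN al be : cf al (- be) = - cf al be.
Proof. by rewrite -scaleN1r cfZ mulN1r. Qed.
Lemma cfMn al be n : cf al (be *+ n) = cf al be *+ n.
Proof. by rewrite -scaler_nat cfZ mulr_natl. Qed.
Lemma cfMz al be z : cf al (be *~ z) = cf al be *~ z.
Proof. by rewrite -scaler_int cfZ mulrzl. Qed.
Lemma cf_sum al (r : seq h^*) (F : h^* -> h^*) :
  cf al (\sum_(i <- r) F i) = \sum_(i <- r) cf al (F i).
Proof. by elim: r => [|i r IHr]; rewrite ?big_nil ?cf0 // !big_cons cfD IHr. Qed.

Lemma cf_notin al be : al \notin Pi -> cf al be = 0.
Proof.
move=> nal; rewrite /cf big1 // => i _; case: eqP => [e|]; rewrite ?mul0r //.
by case/negP: nal; rewrite -e mem_nth.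
Qed.

Lemma cf_base al be : be \in Pi -> cf al be = (al == be)%:R.
Proof.
have [bPi _ _] := basePi; move=> bP.
have fPi : free (in_tuple Pi) := basis_free bPi.
have [j ->] : exists j : 'I_(size Pi), be = (in_tuple Pi)`_j.
  have lb : (index be Pi < size Pi)%N by rewrite index_mem.
  by exists (Ordinal lb); rewrite /= nth_index.
rewrite /cf (bigD1 j) //= big1 => [|i ni].
  by rewrite (coord_free _ _ fPi) eqxx mulr1 addr0 eq_sym.
by rewrite (coord_free _ _ fPi) (eq_sym j) (negPf ni) mulr0.
Qed.

Lemma base_expand be : be = \sum_(al <- Pi) cf al be *: al.
Proof.
have [bPi _ _] := basePi.
have [c ->] : exists c : h^* -> k, be = \sum_(al <- Pi) c al *: al.
  have bs : be \in <<in_tuple Pi>>%VS by rewrite (span_basis bPi) memvf.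
  rewrite (coord_span bs).
  exists (fun al => \sum_(i < size Pi) (Pi`_i == al)%:R * coord (in_tuple Pi) i be).
  rewrite [RHS](big_nth 0) big_mkord; apply: eq_bigr => i _; congr (_ *: _).
  rewrite (bigD1 i) //= eqxx mul1r big1 ?addr0 // => j ji.
  by rewrite nth_uniq ?fset_uniq // -val_eqE in ji *; rewrite (negPf ji) mul0r.
apply: eq_big_seq => al alP; congr (_ *: _); rewrite cf_sum.
rewrite (eq_big_seq (fun i => (al == i)%:R * c i)); last first.
  by move=> i iP; rewrite cfZ cf_base // mulrC.
rewrite (bigD1_seq al) ?fset_uniq //= eqxx mul1r big1 ?addr0 // => i ni.
by rewrite eq_sym (negPf ni) mul0r.
Qed.

Lemma cf_eq0 be : (forall al, al \in Pi -> cf al be = 0) -> be = 0.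
Proof.
by move=> b0; rewrite (base_expand be) big_seq big1 // => al /b0->; rewrite scale0r.
Qed.

Lemma pairing_expand be ga :
  pairing be ga = \sum_(al <- Pi) cf al be * pairing al ga.
Proof.
rewrite [in LHS](base_expand be) pairing_suml; apply: eq_bigr => al _.
exact: pairingZl.
Qed.

Lemma base_root al : al \in Pi -> is_root al.
Proof. by have [_ rPi _] := basePi; apply: rPi. Qed.

Definition pos_of_base be := is_root be /\ forall al, natc (cf al be).
Local Notation P := pos_of_base.

Lemma pos_of_base_total be : is_root be -> P be \/ P (- be).
Proof.
move=> rb; have [_ _ /(_ be rb)[n nE]] := basePi.
have nn al : natc (cf al (\sum_(i <- Pi) i *+ n i)).
  rewrite cf_sum; apply: natc_sum => i iP; rewrite cfMn cf_base //.
  exact/natcMn/natc_nat.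
by case: nE => e; [left|right]; split; rewrite ?root_opp // => al; rewrite e ?opprK.
Qed.

Lemma pos_of_base_system : pos_system P.
Proof.
split=> [al []//|al|al [ral nal] [_ nal']|al be [_ nal] [_ nbe] rs].
- exact: pos_of_base_total.
- case/negP: (root_nz ral); apply/eqP/cf_eq0 => be _.
  by apply: (natc_opp char_k) => //; rewrite -cfN.
by split=> // ga; rewrite cfD; apply: natcD.
Qed.

Lemma base_pos al : al \in Pi -> P al.
Proof.
by move=> alP; split=> [|be]; rewrite ?base_root // cf_base //; apply: natc_nat.
Qed.

Lemma root_sign be al de : is_root be -> natc (cf al be) -> natc (- cf de be) ->
  cf al be = 0 \/ cf de be = 0.
Proof.
move=> rb na nd; have [[_ nb]|[_ nb]] := pos_of_base_total rb; [right|left].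
  exact: (natc_opp char_k).
by apply: (natc_opp char_k) => //; rewrite -cfN.
Qed.

(* The roots in the span of a subset S of the base are those of R^S. *)
Definition in_span S be := forall al, al \notin S -> cf al be = 0.

Lemma in_spanS S T be : S `<=` T -> in_span S be -> in_span T be.
Proof. by move=> ST Sb al nT; apply: Sb; apply: contra nT; apply: (fsubsetP ST). Qed.

Lemma in_spanN S be : in_span S be -> in_span S (- be).
Proof. by move=> Sb al nS; rewrite cfN Sb ?oppr0. Qed.

Lemma in_spanD S be ga : in_span S be -> in_span S ga -> in_span S (be + ga).
Proof. by move=> Sb Sc al nS; rewrite cfD Sb ?Sc ?addr0. Qed.

Lemma in_span_base S al : al \in S -> al \in Pi -> in_span S al.
Proof.
move=> aS aP be nb; rewrite cf_base //; case: eqP => // e.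
by rewrite e aS in nb.
Qed.

Lemma in_spanPi be : in_span Pi be.
Proof. by move=> al; apply: cf_notin. Qed.

Lemma in_span_sum S be : S `<=` Pi -> in_span S be ->
  be = \sum_(al <- S) cf al be *: al.
Proof.
move=> SP Sb; rewrite {1}(base_expand be) (big_fset_incl _ SP) // => al _ nS.
by rewrite Sb ?scale0r.
Qed.

Lemma natc_span S be : S `<=` Pi -> in_span S be -> (forall al, natc (cf al be)) ->
  exists n : h^* -> nat, be = \sum_(al <- S) al *+ n al.
Proof.
move=> SP Sb nb; have [n nE] := choice nb.
exists n; rewrite {1}(in_span_sum SP Sb); apply: eq_bigr => al _.
by rewrite nE scaler_nat.
Qed.

Lemma span_natc S be n al : S `<=` Pi -> be = \sum_(al <- S) al *+ n al ->
  natc (cf al be).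
Proof.
move=> SP ->; rewrite cf_sum; apply: natc_sum => i iS.
rewrite cfMn cf_base ?(fsubsetP SP) //.
exact/natcMn/natc_nat.
Qed.

Lemma sub_rootsP S be : S `<=` Pi -> sub_roots S be <-> is_root be /\ in_span S be.
Proof.
move=> SP; split=> [[rb [z zE]]|[rb Sb]].
  split=> // al nS; rewrite zE cf_sum big_seq big1 // => i iS.
  rewrite cfMz cf_base ?(fsubsetP SP) //; case: eqP => [e|_]; last exact: mul0rz.
  by rewrite -e (negPf nS) in iS.
split=> //; have [[_ nb]|[_ nb]] := pos_of_base_total rb.
  have [n ->] := natc_span SP Sb nb; exists (fun al => n al : int).
  by apply: eq_bigr => al _; rewrite pmulrn.
have [n nE] := natc_span SP (in_spanN Sb) nb; exists (fun al => - (n al : int)).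
rewrite -[be]opprK nE -sumrN; apply: eq_bigr => al _.
by rewrite mulrNz pmulrn.
Qed.

(** A positive pairing would make [al - be] a root with coefficients 1 and -1. *)
Lemma base_pairing_le0 al be : al \in Pi -> be \in Pi -> al != be ->
  natc (- pairing al be).
Proof.
move=> aP bP ne.
have [[[|n] nE]|[n nE]] := pairing_cases char_k ssg sh (base_root bP) (base_root aP).
- by rewrite nE oppr0; apply: natc0.
- have [/eqP|rs] := root_sub char_k ssg sh (base_root bP) (base_root aP) nE.
    by rewrite subr_eq0 (negPf ne).
  have ca : cf al (al - be) = 1.
    by rewrite cfD cfN !cf_base // eqxx (negPf ne) subr0.
  have cb : cf be (al - be) = -1.
    by rewrite cfD cfN !cf_base // eqxx eq_sym (negPf ne) sub0r.
  have [] := root_sign (al := al) (de := be) rs; rewrite ?ca ?cb ?opprK.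
  + exact: (natc_nat k 1).
  + exact: (natc_nat k 1).
  + by move=> /eqP; rewrite oner_eq0.
  by move=> /eqP; rewrite oppr_eq0 oner_eq0.
by rewrite nE opprK; apply: natc_nat.
Qed.

Lemma nonadj_pairing al be : al \in Pi -> be \in Pi -> al != be ->
  ~~ dynkin_adj al be -> pairing al be = 0.
Proof.
by move=> aP bP ne; rewrite /dynkin_adj ne /= negb_or !negbK => /andP[/eqP].
Qed.

Lemma span_pairing0 S D be ga : S `<=` Pi -> D `<=` S -> adj_closed S D ->
  in_span D be -> in_span (S `\` D) ga -> is_root ga -> pairing be ga = 0.
Proof.
move=> SP DS clD Db Dg rg; rewrite pairing_expand big_seq big1 // => al aP.
have [aD|aD] := boolP (al \in D); last by rewrite Db ?mul0r.
have ral := base_root aP.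
rewrite (pairing_sym0 char_k ssg sh ral rg) ?mulr0 //.
rewrite pairing_expand big_seq big1 // => de dP.
have [|dS] := boolP (de \in S `\` D); last by rewrite Dg ?mul0r.
rewrite in_fsetD => /andP[dD dS].
rewrite nonadj_pairing ?mulr0 //; first by apply: contraNneq dD => ->.
by rewrite dynkin_adj_sym; apply: contra dD => /(clD _ _ aD dS).
Qed.

(** Induction on the height removes a base element [al] of positive pairing. If [al] and the
    remaining root [ga] lay in different parts, they would be orthogonal, and the reflection of [be]
    in [al] would be [ga - al], with coefficients of both signs. *)
Lemma support_split S D be : S `<=` Pi -> D `<=` S -> adj_closed S D ->
  is_root be -> in_span S be -> in_span D be \/ in_span (S `\` D) be.
Proof.
move=> SP DS clD.
have key n : forall be, P be -> in_span S be -> (ht sh P be < n)%N ->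
    in_span D be \/ in_span (S `\` D) be.
  elim: n => [//|n IHn] {}be Pb Sb hb.
  have rb := Pb.1.
  (* Such an [al] exists because [pairing be be] is 2 and is a combination with nonnegative
     coefficients of the pairings of base elements with [be]. *)
  have [al [aP ca [m mE]]] : exists al, [/\ al \in Pi, cf al be != 0 &
      exists m : nat, pairing al be = m.+1%:R].
    apply: contrapT => none.
    have : natc (- pairing be be).
      rewrite pairing_expand -sumrN; apply: natc_sum => al aP; rewrite -mulrN.
      have [->|ca] := eqVneq (cf al be) 0; first by rewrite mul0r; apply: natc0.
      apply: natcM; first exact: Pb.2.
      have [[[|m] mE]|[m mE]] := pairing_cases char_k ssg sh rb (base_root aP).
      - by rewrite mE oppr0; apply: natc0.
      - by case: none; exists al; split=> //; exists m.
      by rewrite mE opprK; apply: natc_nat.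
    rewrite (pairing_self char_k ssg sh rb) => /(natc_opp char_k (natc_nat k 2)).
    by move/eqP; rewrite (negPf (natr_neq0 char_k 1)).
  have aS : al \in S by apply: contraNT ca => nS; rewrite Sb.
  have spa D' : al \in D' -> in_span D' al by move=> ?; apply: in_span_base.
  have [ab|rab] := root_sub char_k ssg sh rb (base_root aP) mE.
    rewrite -(subr0_eq ab).
    have [aD|aD] := boolP (al \in D); [left|right]; apply: spa => //.
    by rewrite in_fsetD aD.
  pose ga := be - al.
  have rg : is_root ga by rewrite /ga -opprB root_opp.
  have Sg : in_span S ga by apply: in_spanD => //; apply/in_spanN/spa.
  have Pg : P ga.
    have [//|[_ ng]] := pos_of_base_total rg.
    have nal de : de != al -> cf de be = 0.
      move=> ne; apply: (natc_opp char_k); first exact: Pb.2.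
      by have := ng de; rewrite /ga cfN cfD cfN (cf_base de aP) (negPf ne) subr0.
    have be_al : be = cf al be *: al.
      rewrite {1}(base_expand be) (bigD1_seq al) ?fset_uniq //= big1 ?addr0 // => de ne.
      by rewrite nal ?scale0r.
    move: (rb); rewrite be_al => /(root_scale char_k ssg sh (base_root aP))[c1|c1].
      by case/negP: (root_nz rg); rewrite /ga be_al c1 scale1r subrr.
    have := Pb.2 al; rewrite c1 => /(natc_opp char_k (natc_nat k 1))/eqP.
    by rewrite oner_eq0.
  have bE : be = ga + al by rewrite /ga subrK.
  have hg : (ht sh P ga < n)%N.
    have := ht_lt char_k ssg sh pos_of_base_system (base_pos aP) (ga := ga).
    by rewrite -bE => /(_ rb) lt; apply: leq_trans lt hb.
  have mixed D1 : in_span D1 ga -> al \notin D1 -> pairing ga al = 0 -> False.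
    move=> Dg nal pg0.
    have rr := root_reflect char_k ssg sh (base_root aP) rb.
    have rE : be - pairing be al *: al = ga - al.
      rewrite [in pairing _ _]bE pairingDl pg0 add0r.
      rewrite (pairing_self char_k ssg sh (base_root aP)) /ga scaler_nat mulr2n.
      by rewrite opprD addrA.
    rewrite rE in rr.
    have ca1 : cf al (ga - al) = -1.
      by rewrite cfD cfN Dg // (cf_base al aP) eqxx sub0r.
    case/negP: (root_nz rg); apply/eqP/cf_eq0 => de _.
    have [e|ne] := eqVneq de al; first by rewrite e Dg.
    have cd : cf de (ga - al) = cf de ga by rewrite cfD cfN (cf_base de aP) (negPf ne) subr0.
    have [|||] := root_sign (al := de) (de := al) rr.
    + by rewrite cd; apply: Pg.2.
    + by rewrite ca1 opprK; apply: (natc_nat k 1).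
    + by rewrite cd.
    by rewrite ca1 => /eqP; rewrite oppr_eq0 oner_eq0.
  have [aD|aD] := boolP (al \in D); have [Dg|Dg] := IHn ga Pg Sg hg.
  - by left; rewrite bE; apply: in_spanD => //; apply: spa.
  - case: (mixed (S `\` D)) => //; first by rewrite in_fsetD aD.
    apply: (pairing_sym0 char_k ssg sh rg (base_root aP)) .
    by apply: (span_pairing0 SP DS clD) => //; apply: spa.
  - exfalso; apply: (mixed D Dg aD).
    apply: (span_pairing0 SP DS clD Dg); last exact: base_root.
    by apply: spa; rewrite in_fsetD aD.
  right; rewrite bE; apply: in_spanD => //; apply: spa.
  by rewrite in_fsetD aD.
move=> rb Sb; have [Pb|Pb] := pos_of_base_total rb; first exact: (key _ _ Pb Sb (ltnSn _)).
have [H|H] := key _ _ Pb (in_spanN Sb) (ltnSn _); [left|right];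
  by rewrite -[be]opprK; apply: in_spanN.
Qed.

(** * Highest roots of connected subsets of the base *)

Section HighestRoot.
Variables (C : {fset h^*}) (CP : C `<=` Pi) (C0 : C != fset0).
Hypothesis cC : dynkin_connected C.

Definition maximal_in ep := [/\ P ep, in_span C ep &
  forall be, P be -> in_span C be -> ~~ is_root (ep + be)].

Lemma maximal_ge0 ep be : maximal_in ep -> P be -> in_span C be ->
  natc (pairing ep be) /\ natc (pairing be ep).
Proof.
move=> [Pe Ce maxe] Pb Cb; have [re rb] := (Pe.1, Pb.1).
have ne : be + ep <> 0.
  move=> /eqP; rewrite addr_eq0 => /eqP e.
  case: pos_of_base_system => _ _ /(_ ep Pe) nP _; apply: nP; rewrite -e; exact: Pb.
split.
  have [//|[n nE]] := pairing_cases char_k ssg sh rb re.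
  have [/esym/eqP|] := root_add char_k ssg sh rb re nE.
    by rewrite addrC eq_sym => /eqP.
  by rewrite (negPf (maxe be Pb Cb)).
have [//|[n nE]] := pairing_cases char_k ssg sh re rb.
have [//|] := root_add char_k ssg sh re rb nE.
by rewrite addrC (negPf (maxe be Pb Cb)).
Qed.

(** If [y] in [C] were adjacent to the support but outside it, all terms of [pairing ep y] would be
    nonpositive while maximality makes their sum nonnegative. Each term is then 0, which contradicts
    the adjacency. *)
Lemma maximal_support ep al : maximal_in ep -> al \in C -> cf al ep != 0.
Proof.
move=> me; have [Pe Ce maxe] := me; move: al.
pose D := [fset al in C | cf al ep != 0].
have memD al : (al \in D) = (al \in C) && (cf al ep != 0) by rewrite !inE.
suff DC : D = C by move=> al; rewrite -DC memD => /andP[].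
apply: connected_min => //; last 2 first.
- by apply/fsubsetP => al; rewrite memD => /andP[].
- apply: contraT; rewrite negbK => /eqP D0; case/negP: (root_nz Pe.1).
  apply/eqP/cf_eq0 => al _; have [aC|aC] := boolP (al \in C); last exact: Ce.
  by apply/eqP; apply: contraT => ca; rewrite -(in_fset0 al) -D0 memD aC.
move=> x y; rewrite !memD => /andP[xC cx] yC axy; rewrite yC /=.
apply/eqP => cy; have yP := fsubsetP CP _ yC; have xP := fsubsetP CP _ xC.
have [nE _] := maximal_ge0 me (base_pos yP) (in_span_base yC yP).
have nxy : x != y by case/andP: axy.
have terms al : al \in Pi -> natc (- (cf al ep * pairing al y)).
  move=> aP; have [->|ne] := eqVneq al y.
    by rewrite cy mul0r oppr0; apply: natc0.
  by rewrite -mulrN; apply: natcM; [apply: Pe.2|apply: base_pairing_le0].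
have p0 : pairing ep y = 0.
  apply: (natc_opp char_k) => //; rewrite pairing_expand -sumrN.
  exact: natc_sum.
have := natc_sum0 char_k terms; rewrite sumrN -pairing_expand p0 oppr0.
move=> /(_ erefl x xP)/eqP; rewrite oppr_eq0 mulf_eq0 (negPf cx) /= => /eqP pxy.
move: axy; rewrite /dynkin_adj pxy eqxx /=.
by rewrite (pairing_sym0 char_k ssg sh (base_root yP) (base_root xP) pxy) eqxx andbF.
Qed.

(** The two roots pair positively: otherwise every term of [pairing be ep] is 0, and the full
    support of [be] makes [ep] orthogonal to [C], hence to itself. Their difference is then 0 or a
    root, and a root of either sign contradicts the maximality of one of them. *)
Lemma maximal_unique ep be : maximal_in ep -> maximal_in be -> be = ep.
Proof.
move=> me mb; have [Pe Ce maxe] := me; have [Pb Cb maxb] := mb.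
have terms al : al \in C -> natc (pairing al ep).
  move=> aC; have aP := fsubsetP CP _ aC.
  by have [] := maximal_ge0 me (base_pos aP) (in_span_base aC aP).
have terms' ga : P ga -> in_span C ga ->
    forall al, al \in Pi -> natc (cf al ga * pairing al ep).
  move=> Pg Cg al _; have [aC|aC] := boolP (al \in C).
    by apply: natcM; [apply: Pg.2|apply: terms].
  by rewrite Cg // mul0r; apply: natc0.
have [[|n] pE] : natc (pairing be ep).
- by rewrite pairing_expand; apply: natc_sum; apply: terms'.
- rewrite pairing_expand in pE.
  have z al := natc_sum0 char_k (terms' _ Pb Cb) pE (i := al).
  have : pairing ep ep = 0.
    rewrite pairing_expand big_seq big1 // => al aP.
    have [aC|aC] := boolP (al \in C); last by rewrite Ce ?mul0r.
    have /eqP := z al aP; rewrite mulf_eq0 (negPf (maximal_support mb aC)) => /eqP->.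
    by rewrite mulr0.
  by rewrite (pairing_self char_k ssg sh Pe.1) => /eqP; rewrite (negPf (natr_neq0 char_k 1)).
have [/subr0_eq//|rs] := root_sub char_k ssg sh Pe.1 Pb.1 pE.
have Cs : in_span C (be - ep) by apply: in_spanD => //; apply: in_spanN.
have [Ps|Ps] := pos_of_base_total rs.
  by have := maxe _ Ps Cs; rewrite addrC subrK Pb.1.
have := maxb _ Ps (in_spanN Cs).
by rewrite opprB addrC subrK Pe.1.
Qed.

Lemma ex_maximal_above be : P be -> in_span C be ->
  exists ep, maximal_in ep /\ forall al, natc (cf al (ep - be)).
Proof.
move=> Pb Cb.
have Ab : in_span C be /\ forall al, natc (cf al (be - be)).
  by split=> // al; rewrite subrr cf0; apply: natc0.
have [ep [Pe [Ce ge] maxe]] := ex_ht_max sh (P := P)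
  (A := fun ep => in_span C ep /\ forall al, natc (cf al (ep - be))) Pb Ab.
exists ep; split=> //; split=> // ga Pg Cg; apply/negP => rs.
have := ht_lt char_k ssg sh pos_of_base_system Pg rs.
rewrite ltnNge maxe //.
  by case: pos_of_base_system => _ _ _; apply.
split=> [|al]; first exact: in_spanD.
by rewrite addrAC cfD; apply: natcD; [apply: ge|apply: Pg.2].
Qed.

(** Above every positive root in the span of [C] there is a maximal one, and it is unique; so it is
    greatest and is the element that [xget] picks. *)
Lemma highest_rootP : maximal_in (highest_root C).
Proof.
have [al aC] := fset0Pn _ C0; have aP := fsubsetP CP _ aC.
have [ep [me _]] := ex_maximal_above (base_pos aP) (in_span_base aC aP).
have [Pe Ce _] := me.
have ge be : is_root be -> in_span C be -> forall al, natc (cf al (ep - be)).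
  move=> rb Cb; have [Pb|Pb] := pos_of_base_total rb.
    have [ep' [me' ge']] := ex_maximal_above Pb Cb.
    by rewrite -(maximal_unique me me').
  by move=> de; rewrite cfD; apply: natcD; [apply: Pe.2|apply: Pb.2].
have [sr' ge'] : ([set ep | sub_roots C ep /\
    forall be, sub_roots C be ->
      exists n : h^* -> nat, ep - be = \sum_(al <- C) al *+ n al])%classic (highest_root C).
  apply: xgetPex; exists ep; split; first exact: (sub_rootsP _ CP).2 (conj Pe.1 Ce).
  move=> be sb; have [rb Cb] := (sub_rootsP _ CP).1 sb; apply: natc_span => //; last exact: ge.
  by apply: in_spanD => //; apply: in_spanN.
have [re' Ce'] := (sub_rootsP _ CP).1 sr'.
suff -> : highest_root C = ep by [].
apply/subr0_eq/cf_eq0 => de _.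
apply: (natc_opp char_k).
  have [n nE] := ge' ep ((sub_rootsP _ CP).2 (conj Pe.1 Ce)).
  exact: (span_natc _ CP nE).
by rewrite -cfN opprB; apply: ge.
Qed.

End HighestRoot.

(** K recurses on components while [greedy] takes one root at a time. Both pass to the set [S']
    obtained from [S] by replacing one component [C] with [highest_orth C]: K(S) is C together with
    K(S'), and the roots in the span of [S] orthogonal to the highest root of [C] are those in the
    span of [S']. *)
Lemma cascade_greedy S : S `<=` Pi ->
  exists2 E, greedy P (in_span S) E & size E = #|` cascade S|.
Proof.
move: {2}#|` S| (leqnn #|` S|) => n; elim: n S => [|n IHn] S Sn SP.
  have -> : S = fset0 by apply: cardfs0_eq; apply/eqP; rewrite -leqn0.
  exists [::]; last by rewrite cascade0 cardfs0.
  apply: Greedy_nil => be rb b0; case/negP: (root_nz rb); apply/eqP/cf_eq0 => al _.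
  by apply: b0; rewrite in_fset0.
have [->|[s0 sS]] := fset_0Vmem S; first by apply: IHn; rewrite ?cardfs0 ?fsub0set.
pose s : S := [` sS]; pose C := dynkin_component s.
have sC : s0 \in C by exact: (component_self s).
have CS : C `<=` S := component_sub s.
have CP : C `<=` Pi := fsubset_trans CS SP.
have clC : adj_closed S C := @component_closed _ _ _ _ s.
have cC : dynkin_connected C := component_is_connected s.
have C0 : C != fset0 by apply/fset0Pn; exists s0.
have [Pe Ce maxe] := highest_rootP CP C0 cC; set ep := highest_root C in Pe Ce maxe.
have me : maximal_in C ep by [].
have re := Pe.1.
have memH al : (al \in highest_orth C) = (al \in C) && (pairing al ep == 0).
  by rewrite !inE.
have HC : highest_orth C `<=` C by apply/fsubsetP => al; rewrite memH => /andP[].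
(* Some element of [C] is not orthogonal to the highest root; it makes [S'] strictly smaller than
   [S] and keeps [C] out of K(S'). *)
have [c cC' pc] : exists2 c, c \in C & pairing c ep != 0.
  apply: contrapT => none; have := pairing_self char_k ssg sh re.
  rewrite pairing_expand big_seq big1 => [/esym/eqP|al aP].
    by rewrite (negPf (natr_neq0 char_k 1)).
  have [aC|aC] := boolP (al \in C); last by rewrite Ce ?mul0r.
  have [->|pa] := eqVneq (pairing al ep) 0; first by rewrite mulr0.
  by case: none; exists al.
pose S' := highest_orth C `|` (S `\` C).
have S'S : S' `<=` S.
  apply/fsubsetP => al; rewrite in_fsetU => /orP[/(fsubsetP HC)/(fsubsetP CS)//|].
  by rewrite in_fsetD => /andP[].
have cS' : c \notin S'.
  by rewrite in_fsetU memH (negPf pc) andbF in_fsetD cC'.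
have S'n : (#|` S'| <= n)%N.
  rewrite -ltnS; apply: leq_trans Sn; apply: fproper_ltn_card.
  by rewrite fproperEneq S'S andbT; apply: contraNneq cS' => ->; apply: (fsubsetP CS).
have [E gE sE] := IHn S' S'n (fsubset_trans S'S SP).
have S'D : S' `\` highest_orth C = S `\` C.
  apply/fsetP => al; rewrite in_fsetD in_fsetU.
  have [aH|//] := boolP (al \in highest_orth C).
  by rewrite in_fsetD (fsubsetP HC).
have clH : adj_closed S' (highest_orth C).
  move=> x y xH; rewrite in_fsetU => /orP[//|]; rewrite in_fsetD => /andP[yC yS] axy.
  by rewrite (clC x y) ?(fsubsetP HC) in yC.
have casE : cascade S = C |` cascade S'.
  rewrite (cascade_split CS clC) (cascade_connected C0 cC) -fsetUA.
  by rewrite -S'D -cascade_split ?fsubsetUl.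
have CnS' : C \notin cascade S'.
  by apply/negP => /cascadeP/cascade_sub/fsubsetP/(_ _ cC'); rewrite (negPf cS').
have orthD be : is_root be -> in_span (S `\` C) be -> pairing be ep = 0.
  move=> rb Sb; apply: (pairing_sym0 char_k ssg sh rb re).
  exact: (span_pairing0 SP CS clC).
have key be : P be -> in_span S be -> pairing be ep = 0 -> in_span S' be.
  move=> Pb Sb p0; have [Cb|Db] := support_split SP CS clC Pb.1 Sb; last first.
    by apply: in_spanS Db; apply: fsubsetUr.
  move=> al naS; have [aC|aC] := boolP (al \in C); last exact: Cb.
  rewrite pairing_expand in p0.
  have terms de : de \in Pi -> natc (cf de be * pairing de ep).
    move=> dP; have [dC|dC] := boolP (de \in C); last first.
      by rewrite Cb // mul0r; apply: natc0.
    apply: natcM; first exact: Pb.2.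
    by have [] := maximal_ge0 me (base_pos dP) (in_span_base dC dP).
  have /eqP := natc_sum0 char_k terms p0 (fsubsetP CP _ aC).
  rewrite mulf_eq0 => /orP[/eqP//|pa].
  by rewrite in_fsetU memH aC pa in naS.
exists (ep :: E); last by rewrite casE cardfsU1 CnS' /= sE.
apply: Greedy_cons => //.
- exact: in_spanS Ce.
- move=> be Pb Sb; have [Cb|Db] := support_split SP CS clC Pb.1 Sb; first exact: maxe.
  apply/negP => rs.
  have [Cs|Ds] := support_split SP CS clC rs (in_spanD (in_spanS CS Ce) Sb).
    case/negP: (root_nz Pb.1); apply/eqP/cf_eq0 => al _.
    have [aC|aC] := boolP (al \in C); first by apply: Db; rewrite in_fsetD aC.
    by have := Cs al aC; rewrite cfD Ce // add0r.
  case/negP: (root_nz re); apply/eqP/cf_eq0 => al _.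
  have [aC|aC] := boolP (al \in C); last exact: Ce.
  have naD : al \notin S `\` C by rewrite in_fsetD aC.
  by have := Ds al naD; rewrite cfD (Db al naD) addr0.
apply: (greedy_ext gE) => [be rb|al []//]; split=> [S'b|[Sb p0]].
  split; first exact: in_spanS S'b.
  rewrite pairing_expand big_seq big1 // => al aP.
  have [|aS] := boolP (al \in S'); last by rewrite S'b ?mul0r.
  rewrite in_fsetU memH => /orP[/andP[_ /eqP->]|aD]; first by rewrite mulr0.
  by rewrite orthD ?mulr0 ?base_root //; apply: in_span_base.
have [Pb|Pb] := pos_of_base_total rb; first exact: key.
rewrite -[be]opprK; apply/in_spanN/key => //; first exact: in_spanN.
by rewrite pairingNl p0 oppr0.
Qed.

Lemma base_cascade : exists2 E, greedy P (fun _ => True) E & size E = #|` cascade Pi|.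
Proof.
have [E gE sE] := cascade_greedy (fsubset_refl Pi); exists E => //.
by apply: (greedy_ext gE) => [be _|al []//]; split=> // _; apply: in_spanPi.
Qed.

End Base.

(** * Borel subalgebras and positive systems *)

Section BorelRoots.
Variables (k : closedFieldType) (char_k : [pchar k] =i pred0).
Variables (g : lieAlgType k) (ssg : lie_semisimple g).
Variables (h : lieSubalg g) (sh : split_cartan h).
Local Notation "h^*" := (dualv (lsub_of h)).
Implicit Types (al be ga : h^*).

(** The coroot would be a bracket in a solvable algebra, hence nilpotent, as well as
    diagonalizable. *)
Lemma solvable_no_opp (s : {vspace g}) al : lie_closed s -> lie_solvable s ->
  is_root al -> (root_space al <= s)%VS -> (root_space (- al) <= s)%VS -> False.
Proof.
move=> cs sols ra sa sa'; have [e [f [ea fa _ _ ef]]] := sl2_triple char_k ssg sh ra.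
have nilc : ad_nilp (vsval (coroot al)).
  rewrite -ef; apply: (solvable_br_nilp char_k cs sols).
    exact: (subvP sa).
  exact: (subvP sa').
have c0 : vsval (coroot al) = 0.
  by apply: (ad_diag_nilp0 char_k ssg _ nilc); apply: sh.1.2; apply: subvsP.
have := pairing_self char_k ssg sh ra; rewrite /pairing.
have -> : coroot al = 0 by apply: val_inj.
by rewrite linear0 => /esym/eqP; rewrite (negPf (natr_neq0 char_k 1)).
Qed.

Lemma root_spaceS (V : {vspace g}) al x : is_root al -> x \in root_space al -> x != 0 ->
  x \in V -> (root_space al <= V)%VS.
Proof.
move=> ra xa nz xV; apply/subvP => y /(root_space_line char_k ssg sh ra xa nz)[c ->].
exact: rpredZ.
Qed.

Section RootsOfBorel.
Variables (B : {vspace g}) (bB : borelv B) (hB : (h <= B)%VS).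

Definition borel_root al := is_root al /\ (root_space al <= B)%VS.

Lemma borel_ind (Q : g -> Prop) :
  Q 0 -> (forall a x y, Q x -> Q y -> Q (a *: x + y)) ->
  (forall x, x \in lsub_vspace h -> Q x) ->
  (forall al x, borel_root al -> x \in root_space al -> Q x) ->
  forall x, x \in B -> Q x.
Proof.
move=> Q0 Ql Qh Qr; have [cB _ _] := bB.
apply: (toral_eigen_ind sh.1 _ Q0 Ql) => [t x th xB|x mu xB xmu].
  by apply: cB => //; apply: (subvP hB).
have [->//|nz] := eqVneq x 0.
have lmu : linear (fun t : lsub_of h => (mu (vsval t) : k^o)).
  move=> a t u; apply/eqP; rewrite -subr_eq0; apply/eqP.
  have /eqP := xmu _ (subvsP (a *: t + u)); rewrite linearP /= lieDl lieZl.
  rewrite !xmu ?subvsP // scalerA -scalerDl eq_sym -subr_eq0 -scalerBl.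
  by rewrite scaler_eq0 (negPf nz) orbF => /eqP.
pose al : h^* := linfun (fun t : lsub_of h => (mu (vsval t) : k^o)).
have xa : x \in root_space al.
  by apply/root_spaceP => t; rewrite xmu ?subvsP // (linfunE_of lmu).
have [a0|na] := eqVneq al 0.
  by apply: Qh; apply/(root_space0 sh); rewrite -a0.
have ra : is_root al by apply/rootP; split; [apply/eqP|exists x].
by apply: (Qr al) => //; split=> //; apply: (root_spaceS ra xa nz xB).
Qed.

(** If the root space of [- al] is not in [B], that of [al] is orthogonal to [B], hence inside [B]
    by [borel_korth]; this gives totality. *)
Lemma borel_pos_system : pos_system borel_root.
Proof.
have [cB solB _] := bB; split=> [al []//|al ra|al [ra aB] [_ aB']|al be [ra aB] [rb bB'] rs].
- have [aB|naB] := boolP (root_space (- al) <= B)%VS.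
    by right; split; first exact: (root_opp char_k ssg sh).
  left; split=> //; apply: subv_trans (borel_korth char_k ssg bB).
  apply/subvP => x xa; apply/korthP; apply: borel_ind => [|a y z y0 z0|y yh|be y [rbe beB] yb].
  + exact: killing0r.
  + by rewrite killingDr killingZr y0 z0 mulr0 addr0.
  + apply: (killing_root_orth (al := al) (be := 0)) => //; last exact/(root_space0 sh).
    by rewrite addr0; apply: root_nz ra.
  apply: (killing_root_orth _ xa yb); apply: contraNneq naB => /eqP.
  by rewrite addrC addr_eq0 => /eqP <-.
- exact: (solvable_no_opp cB solB ra aB aB').
split=> //.
have [_ [x xa nx]] := (rootP al).1 ra; have [_ [y yb ny]] := (rootP be).1 rb.
have nz := root_br_neq0 char_k ssg sh ra rb rs xa yb nx ny.
apply: (root_spaceS rs (root_space_br xa yb) nz).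
by apply: cB; [apply: (subvP aB)|apply: (subvP bB')].
Qed.

End RootsOfBorel.

Lemma borel_cascade (b : lieSubalg g) E : borelv b -> (h <= b)%VS ->
  greedy (borel_root b) (fun _ => True) E ->
  (exists f : dualv (lsub_of b), stable_form f) /\
  (lie_index (lsub_of b) + size E)%N = \dim h.
Proof.
move=> bb hb gE; have posB := borel_pos_system bb hb.
have [kE covE] := greedy_kostant gE.
have rB al : borel_root b al -> (root_space al <= b)%VS by case.
have ind := borel_ind bb hb.
split; last exact: (lie_index_dim char_k ssg sh posB kE covE hb rB ind).
by eexists; exact: (f0_stable char_k ssg sh posB kE covE hb rB ind).
Qed.

(** [h] and the root spaces of [P] span a subalgebra [U] whose brackets are sums of positive root
    vectors, hence orthogonal to [U]; Cartan's criterion makes [U] solvable. A Borel subalgebra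
    containing [U] has no further roots, since it cannot contain opposite ones. *)
Lemma standard_borel (P : h^* -> Prop) : pos_system P ->
  exists B, [/\ borelv B, (h <= B)%VS & borel_root B = P].
Proof.
move=> posP; have [rP totP nP addP] := posP.
(* The span is described impredicatively, which provides its induction principle at once. *)
pose gen (x : g) := forall Q : g -> Prop, Q 0 ->
  (forall a x y, Q x -> Q y -> Q (a *: x + y)) ->
  (forall x, x \in lsub_vspace h -> Q x) ->
  (forall al x, P al -> x \in root_space al -> Q x) -> Q x.
have [|a x y gx gy|U UP] := @vspace_of_pred _ _ gen; first by move=> Q.
  by move=> Q Q0 Ql Qh Qr; apply: (Ql); [apply: gx|apply: gy].
have hU : (h <= U)%VS by apply/subvP => x xh; apply/UP => Q _ _ Qh _; apply: Qh.
have rU al : P al -> (root_space al <= U)%VS.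
  by move=> Pa; apply/subvP => x xa; apply/UP => Q _ _ _ Qr; apply: Qr xa.
have brU (Q : g -> Prop) : Q 0 -> (forall a x y, Q x -> Q y -> Q (a *: x + y)) ->
    (forall al x, P al -> x \in root_space al -> Q x) ->
    forall x y, x \in U -> y \in U -> Q [lie x, y].
  move=> Q0 Ql Qr x y /UP gx /UP gy.
  apply: (gx (fun x => Q [lie x, y])) => [|a x1 x2 q1 q2|u xh|al u Pa xa].
  - by rewrite lie0l.
  - by rewrite lieDl lieZl; apply: Ql.
  - apply: (gy (fun y => Q [lie u, y])) => [|a y1 y2 q1 q2|v yh|al v Pa ya].
    + by rewrite lie0r.
    + by rewrite lieDr lieZr; apply: Ql.
    + by rewrite (sh.1.1 _ _ xh yh).
    apply: (Qr al) => //; rewrite -[al]add0r; apply: root_space_br => //.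
    exact/(root_space0 sh).
  apply: (gy (fun y => Q [lie u, y])) => [|a y1 y2 q1 q2|v yh|be v Pb yb].
  - by rewrite lie0r.
  - by rewrite lieDr lieZr; apply: Ql.
  - apply: (Qr al) => //; rewrite -[al]addr0; apply: root_space_br => //.
    exact/(root_space0 sh).
  have [rs|nrs] := boolP (is_root (al + be)).
    by apply: (Qr (al + be)); [apply: addP|apply: root_space_br].
  rewrite (br_nonroot xa yb) //; exact: (pos_add_neq0 char_k ssg sh posP).
have cU : lie_closed U.
  apply: (brU (fun x => x \in U)) => [|a x y xU yU|al x Pa xa]; first exact: rpred0.
    by rewrite rpredD // rpredZ.
  exact: (subvP (rU al Pa)).
have solU : lie_solvable U.
  apply: (cartan_solvable char_k cU) => y z yU; move: z.
  apply: (lie_brv_ind (P := fun y => forall z, z \in U -> killing y z = 0)) yU.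
  - by move=> z _; rewrite killing0l.
  - by move=> a x x' x0 x'0 z zU; rewrite killingDl killingZl x0 // x'0 // mulr0 addr0.
  apply: (brU (fun y => forall z, z \in U -> killing y z = 0)) => [z _|a x x' x0 x'0 z zU|al x Pa xa z /UP gz].
  - by rewrite killing0l.
  - by rewrite killingDl killingZl x0 // x'0 // mulr0 addr0.
  apply: (gz (fun z => killing x z = 0)) => [|a y1 y2 q1 q2|v zh|be v Pb zb].
  - exact: killing0r.
  - by rewrite killingDr killingZr q1 q2 mulr0 addr0.
  - apply: (killing_root_orth (al := al) (be := 0)) => //; last exact/(root_space0 sh).
    by rewrite addr0; apply/root_nz/rP.
  by apply: (killing_root_orth _ xa zb); apply: (pos_add_neq0 char_k ssg sh posP).
have [B bB UB] := ex_borelv cU solU; have [cB solB _] := bB.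
have PB al : P al -> borel_root B al.
  by move=> Pa; split; [apply: rP|apply: subv_trans UB; apply: rU].
exists B; split=> //; first exact: subv_trans UB.
apply/funext => al; apply/propext; split=> [[ra aB]|/PB//].
have [//|/PB[_ aB']] := totP _ ra.
by case: (solvable_no_opp cB solB ra aB aB').
Qed.

End BorelRoots.

Theorem mainTheorem6 (k : closedFieldType) (char_k : [pchar k] =i pred0)
    (g : lieAlgType k) (ss_g : lie_semisimple g)
    (b : lieSubalg g) (borel_b : borel_subalgebra b) :
  (exists f : dualv (lsub_of b), stable_form f) /\
  (forall (h : lieSubalg g) (Pi : {fset dualv (lsub_of h)}),
     cartan_subalgebra h -> root_base Pi ->
     (lie_index (lsub_of b))%:Z = (\dim h)%:Z - (#|` cascade Pi|)%:Z).
Proof.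
have bb := borel_subalgebra_borelv borel_b.
have greedyT (T : lieSubalg g) (sT : split_cartan T) P (posP : pos_system P) :
    exists E : seq (dualv (lsub_of T)), greedy P (fun _ => True) E.
  exact: (ex_greedy char_k ss_g sT posP).
split.
  (* Applied to [b] twice, this provides a Cartan subalgebra inside [b]. *)
  have [T [sT Tb _ _]] := borel_common char_k ss_g bb bb.
  pose T' := LieSubalg (toral_closed sT.1).
  have [E gE] := greedyT T' sT _ (borel_pos_system (h := T') char_k ss_g sT bb Tb).
  by case: (borel_cascade (h := T') char_k ss_g sT bb Tb gE).
move=> h Pi cart_h base_Pi; have sh := cartan_split char_k ss_g cart_h.
have posPi := pos_of_base_system char_k ss_g sh base_Pi.
have [B [bB hB BPi]] := standard_borel char_k ss_g sh posPi.
have [cB _ _] := bB; pose B' := LieSubalg cB.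
have [E gE sE] := base_cascade char_k ss_g sh base_Pi.
rewrite -BPi in gE; have [_ iB] := borel_cascade (b := B') char_k ss_g sh bB hB gE.
have [T [sT Tb TB _]] := borel_common char_k ss_g bb bB.
pose T' := LieSubalg (toral_closed sT.1).
have posb := borel_pos_system (h := T') char_k ss_g sT bb Tb.
have posB := borel_pos_system (h := T') char_k ss_g sT bB TB.
have [E1 gE1] := greedyT T' sT _ posb.
have [E2 gE2 sE2] := greedy_length (h := T') char_k ss_g sT posb posB gE1.
have [_ ib] := borel_cascade (h := T') char_k ss_g sT bb Tb gE1.
(* The index of [B'] is computed a second time, now in [T']: there it is compared with that of [b],
   while the computation in [h] links it to K(Pi). *)
have [_ iB2] := borel_cascade (b := B') (h := T') char_k ss_g sT bB TB gE2.
have -> : lie_index (lsub_of b) = lie_index (lsub_of B').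
  by apply: (@addIn (size E1)); rewrite ib -iB2 sE2.
rewrite -iB sE PoszD addrK; by [].
Qed.
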